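(* Let $\varphi(\lambda)=i\theta_1^*(\lambda I_n-\beta)^{-1}\theta_2e^{-2i\lambda D}R$, where $\theta_1,\theta_2$ are $n\times p$ matrices, $\beta$ is an $n\times n$ matrix, $R$ is a unitary $p\times p$ matrix, and $$D=\mathrm{diag}\{\tilde d_1I_{p_1},\ldots,\tilde d_\kappa I_{p_\kappa}\},\quad p_1+\ldots+p_\kappa=p,\quad 0\le\tilde d_1<\tilde d_2<\ldots<\tilde d_\kappa .$$ Assume that the matrix identities $i(\beta X_j-X_j\beta^* )=Q_j$, $Q_j:=\nu P_j\nu^*$ $(1\le j\le\kappa)$, have solutions, and take solutions with $X_j=X_j^*$. Fix $0<l<\infty$ and let $$(Sf)(x)=f(x)+\frac12\int_0^l\int_{|x-t|}^{x+t}k\Big(\frac{r+x-t}{2}\Big)k\Big(\frac{r+t-x}{2}\Big)^*dr\,f(t)\,dt$$ in $L^2_p(0,l)$, where $k=s'$ and $s$ is defined via $\varphi$ as described in the context. Set $$B(x)=\sqrt2\begin{bmatrix}e^{-2ix\beta}\widetilde Z_m-Z_me^{-2ix\beta^*}\\ e^{-2ix\beta^*}\end{bmatrix}\theta_1,\qquad C(x)=\sqrt2\,\theta_1^*\begin{bmatrix}e^{2ix\beta}&e^{2ix\beta}Z_m-\widetilde Z_me^{2ix\beta^*}\end{bmatrix}\qquad(\tilde d_m<x<\tilde d_{m+1}),$$ and let the $2n\times 2n$ matrix function $U$ on $[0,l]$ be given by $$U(x)=\Omega_me^{-x\mathcal A}e^{x\mathcal A_m^\times}\Xi_m^{-1}U(\tilde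 d_m)\quad(\tilde d_m\le x\le\tilde d_{m+1}),\qquad U(0)=I_{2n}.$$ Then the operator $T=S^{-1}$ is given by $$T=I+\int_0^lT(x,t)\,\cdot\,dt,\qquad T(x,t)=\begin{cases}C(x)U(x)\big(I_{2n}-P^\times\big)U(t)^{-1}B(t),&x>t,\\ -C(x)U(x)P^\times U(t)^{-1}B(t),&x<t,\end{cases}$$ where $$P^\times=\begin{bmatrix}0&0\\ U_{22}(l)^{-1}U_{21}(l)&I_n\end{bmatrix}$$ and $U_{21}(l),U_{22}(l)$ are the $n\times n$ lower blocks of $U(l)$. Moreover, $$U(x)^*JU(x)=J,\qquad U(x)^{-1}=JU(x)^*J^*,\qquad J:=\begin{bmatrix}0&-I_n\\ I_n&0\end{bmatrix}.$$
   Context: $s$ is defined by $$s(x)=\frac{i}{2\pi}e^{-\eta x}\,\mathrm{l.i.m.}_{a\to\infty}\int_{-a}^{a}e^{i\xi x}\lambda^{-1}\varphi(\lambda/2)\,d\xi\qquad(x\ge0,\ \lambda=\xi+i\eta,\ \eta<-2M),$$ where $M>0$ is such that $\sigma(\beta+iMI_n)$ lies in the open upper half-plane, and the limit is in $L^2(0,l)$ entrywise for every $0<l<\infty$. Write $D=\mathrm{diag}\{d_1,\ldots,d_p\}$, let $\theta_{2,m}$ be the $m$-th column of $\theta_2$, and let $\nu$ be the $n\times p$ matrix whose $m$-th column is $\exp(-2id_m\beta)\theta_{2,m}$. $P_j=\mathrm{diag}\{0,\ldots,0,I_{p_j},0,\ldots,0\}$ is the $p\times p$ block-diagonal matrix (blocks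 of sizes $p_1,\ldots,p_\kappa$) with $I_{p_j}$ in the $j$-th block and zeros elsewhere. Further notation: $$Z_m=\sum_{j=1}^mX_j,\qquad \widetilde Z_m=\sum_{j=1}^me^{2i\tilde d_j\beta}X_je^{-2i\tilde d_j\beta^*},\qquad \mathcal A=2i\begin{bmatrix}\beta&0\\ 0&\beta^*\end{bmatrix},$$ $$\mathcal A_m^\times=\mathcal A+2Y_m,\qquad Y_m=\begin{bmatrix}\widetilde Z_m\\ I_n\end{bmatrix}\theta_1\theta_1^*\begin{bmatrix}I_n&-\widetilde Z_m\end{bmatrix},\qquad \Omega_m=\begin{bmatrix}I_n&-Z_m\\ 0&I_n\end{bmatrix},\qquad \Xi_m=\Omega_me^{-\tilde d_m\mathcal A}e^{\tilde d_m\mathcal A_m^\times}.$$ Convention on intervals: the intervals $\tilde d_m<x<\tilde d_{m+1}$ are considered only for $m$ with $\tilde d_m<l$ and are truncated at $l$, i.e. they mean $\tilde d_m<x<\min(l,\tilde d_{m+1})$ (similarly for the closed intervals). If $\tilde d_1>0$, one puts $\tilde d_0=0$ and the interval with $m=0$ is included; if $l>\tilde d_\kappa$, the interval with $m=\kappa$ is included with $\tilde d_{\kappa+1}:=l$. Empty sums ($m=0$) equal $0$. *)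

(* Defs.v *)
From HB Require Import structures.
From mathcomp Require Import all_boot all_order all_algebra spectral.
From mathcomp Require Import complex.
From mathcomp Require Import all_classical all_reals all_analysis.

Set Implicit Arguments.
Unset Strict Implicit.
Unset Printing Implicit Defensive.

Import Order.TTheory GRing.Theory Num.Theory.
Import numFieldNormedType.Exports.

Local Open Scope classical_set_scope.
Local Open Scope ring_scope.
Local Open Scope sesquilinear_scope.

Local Notation leb R := (@lebesgue_measure R) (only parsing).

(* The type R[i] carries no topology in the library: limits, derivatives,
   measurability and integrals of complex quantities are taken on real and
   imaginary parts, and entrywise for matrices. *)

Definition sqnorm (R : realType) (z : R[i]) : R :=
  complex.Re z ^+ 2 + complex.Im z ^+ 2.

Definition cexp (R : realType) (z : R[i]) : R[i] :=
  Complex (expR (complex.Re z) * cos (complex.Im z))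
          (expR (complex.Re z) * sin (complex.Im z)).

Definition expmx_part (R : realType) (n : nat) (A : 'M[R[i]]_n) (N : nat) :
    'M[R[i]]_n :=
  \sum_(0 <= k < N) ((k`!)%:R^-1 : R[i]) *: (A ^+ k).

Definition expmx (R : realType) (n : nat) (A : 'M[R[i]]_n) : 'M[R[i]]_n :=
  \matrix_(i, j) Complex
    (limn (fun N => complex.Re (expmx_part A N i j)))
    (limn (fun N => complex.Im (expmx_part A N i j))).

Definition mx_measurable (R : realType) (q r : nat) (D : set R)
    (F : R -> 'M[R[i]]_(q, r)) : Prop :=
  forall i j,
    measurable_fun D (fun x => complex.Re (F x i j)) /\
    measurable_fun D (fun x => complex.Im (F x i j)).

Definition mx_integrable (R : realType) (q r : nat) (D : set R)
    (F : R -> 'M[R[i]]_(q, r)) : Prop :=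
  forall i j,
    (leb R).-integrable D (fun x => (complex.Re (F x i j))%:E) /\
    (leb R).-integrable D (fun x => (complex.Im (F x i j))%:E).

Definition mxint (R : realType) (q r : nat) (D : set R)
    (F : R -> 'M[R[i]]_(q, r)) : 'M[R[i]]_(q, r) :=
  \matrix_(i, j) Complex
    (\int[leb R]_(x in D) complex.Re (F x i j))
    (\int[leb R]_(x in D) complex.Im (F x i j)).

Definition mxL2 (R : realType) (q r : nat) (D : set R)
    (F : R -> 'M[R[i]]_(q, r)) : Prop :=
  mx_measurable D F /\
  forall i j, (\int[leb R]_(x in D) (sqnorm (F x i j))%:E < +oo)%E.

(* G = l.i.m._{a -> oo} F_a on the half-line: entrywise convergence in
   L^2(0,l) for every 0 < l < oo. *)
Definition is_lim_in_mean (R : realType) (q r : nat)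
    (F : R -> R -> 'M[R[i]]_(q, r)) (G : R -> 'M[R[i]]_(q, r)) : Prop :=
  forall l : R, 0 < l ->
    mxL2 `]0, l[ G /\
    forall i j,
      (\int[leb R]_(x in `]0%R, l[) (sqnorm (F a x i j - G x i j))%:E)%E
        @[a --> +oo] --> 0%E.

(* K = S' on the half-line, as an equality of (classes of) measurable
   functions. *)
Definition is_ae_derivative (R : realType) (q r : nat)
    (S K : R -> 'M[R[i]]_(q, r)) : Prop :=
  mx_measurable `]0, +oo[ K /\
  {ae leb R, forall x : R, 0 < x -> forall i j,
    is_derive x 1 (fun y => complex.Re (S y i j)) (complex.Re (K x i j)) /\
    is_derive x 1 (fun y => complex.Im (S y i j)) (complex.Im (K x i j))}.

Definition int_op (R : realType) (p : nat) (l : R)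
    (K : R -> R -> 'M[R[i]]_p) (f : R -> 'cV[R[i]]_p) (x : R) : 'cV[R[i]]_p :=
  f x + mxint `]0, l[ (fun t => K x t *m f t).

Definition acts_on_L2 (R : realType) (p : nat) (l : R)
    (K : R -> R -> 'M[R[i]]_p) : Prop :=
  forall f : R -> 'cV[R[i]]_p, mxL2 `]0, l[ f ->
    {ae leb R, forall x : R, 0 < x < l ->
      mx_integrable `]0, l[ (fun t => K x t *m f t)} /\
    mxL2 `]0, l[ (int_op l K f).

(* I + KT is the two-sided inverse of I + KS on L^2_p(0,l), whose elements are
   functions up to equality almost everywhere. *)
Definition L2_inverse (R : realType) (p : nat) (l : R)
    (KS KT : R -> R -> 'M[R[i]]_p) : Prop :=
  [/\ acts_on_L2 l KS, acts_on_L2 l KT &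
    forall f : R -> 'cV[R[i]]_p, mxL2 `]0, l[ f ->
      {ae leb R, forall x : R, 0 < x < l ->
        int_op l KT (int_op l KS f) x = f x /\
        int_op l KS (int_op l KT f) x = f x}].

(* The numbers d_1 < ... < d_kappa are indexed from 0 as d : 'I_kappa -> R,
   so the j-th of them (1 <= j <= kappa) is the value of d at j - 1; p_j and
   X_j are indexed in the same way.  [node d l m] uses the 1-based index,
   with d_0 = 0 and d_(kappa+1) = l.  When d_1 = 0, the interval with m = 0
   degenerates to a point. *)
Definition node (R : realType) (kappa : nat) (d : 'I_kappa -> R) (l : R)
    (m : nat) : R :=
  if m is m'.+1 then (if insub m' is Some j then d j else l) else 0.

Definition diagD (R : realType) (kappa : nat) (p_ : 'I_kappa -> nat)
    (d : 'I_kappa -> R) : 'M[R[i]]_(\sum_j p_ j) :=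
  \mxdiag_j ((d j)%:C%C)%:M.

Definition blockP (R : realType) (kappa : nat) (p_ : 'I_kappa -> nat)
    (j : 'I_kappa) : 'M[R[i]]_(\sum_j p_ j) :=
  \mxdiag_i (if i == j then 1%:M else 0).

Definition phi (R : realType) (n p : nat) (th1 th2 : 'M[R[i]]_(n, p))
    (beta : 'M[R[i]]_n) (D Ru : 'M[R[i]]_p) (lam : R[i]) : 'M[R[i]]_p :=
  'i%C *: (th1^t* *m invmx (lam%:M - beta) *m th2
           *m expmx ((- 2%:R * 'i%C * lam) *: D) *m Ru).

Definition nu (R : realType) (n p : nat) (th2 : 'M[R[i]]_(n, p))
    (beta : 'M[R[i]]_n) (D : 'M[R[i]]_p) : 'M[R[i]]_(n, p) :=
  \matrix_(i, m) (expmx ((- 2%:R * 'i%C * D m m) *: beta) *m col m th2) i ord0.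

(* int_{-a}^a e^{i xi x} lambda^{-1} phi(lambda/2) d xi, lambda = xi + i eta *)
Definition fourier_part (R : realType) (p : nat) (ph : R[i] -> 'M[R[i]]_p)
    (eta a x : R) : 'M[R[i]]_p :=
  mxint `[- a, a] (fun xi : R =>
    let lam : R[i] := Complex xi eta in
    (cexp ('i%C * (xi * x)%:C%C) * lam^-1) *: ph (lam / 2%:R)).

Definition kerS (R : realType) (p : nat) (k : R -> 'M[R[i]]_p) (x t : R) :
    'M[R[i]]_p :=
  (2%:R^-1 : R[i]) *: mxint `[`|x - t|, x + t] (fun r =>
    k ((r + x - t) / 2%:R) *m (k ((r + t - x) / 2%:R))^t*).

Definition Zsum (R : realType) (n kappa : nat) (X : 'I_kappa -> 'M[R[i]]_n)
    (m : nat) : 'M[R[i]]_n :=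
  \sum_(j < kappa | (j < m)%N) X j.

Definition Ztsum (R : realType) (n kappa : nat) (d : 'I_kappa -> R)
    (beta : 'M[R[i]]_n) (X : 'I_kappa -> 'M[R[i]]_n) (m : nat) :
    'M[R[i]]_n :=
  \sum_(j < kappa | (j < m)%N)
    expmx ((2%:R * 'i%C * (d j)%:C%C) *: beta) *m X j
      *m expmx ((- 2%:R * 'i%C * (d j)%:C%C) *: beta^t*).

Definition calA (R : realType) (n : nat) (beta : 'M[R[i]]_n) :
    'M[R[i]]_(n + n) :=
  (2%:R * 'i%C) *: block_mx beta 0 0 (beta^t*).

Definition calY (R : realType) (n p : nat) (th1 : 'M[R[i]]_(n, p))
    (Zt : 'M[R[i]]_n) : 'M[R[i]]_(n + n) :=
  col_mx Zt 1%:M *m th1 *m th1^t* *m row_mx 1%:M (- Zt).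

Definition calAx (R : realType) (n p : nat) (beta : 'M[R[i]]_n)
    (th1 : 'M[R[i]]_(n, p)) (Zt : 'M[R[i]]_n) : 'M[R[i]]_(n + n) :=
  calA beta + 2%:R *: calY th1 Zt.

Definition Omega (R : realType) (n : nat) (Z : 'M[R[i]]_n) :
    'M[R[i]]_(n + n) :=
  block_mx 1%:M (- Z) 0 1%:M.

(* Omega_m exp(-x A) exp(x A_m^x); Xi_m is its value at x = d_m. *)
Definition flow (R : realType) (n p : nat) (beta : 'M[R[i]]_n)
    (th1 : 'M[R[i]]_(n, p)) (Z Zt : 'M[R[i]]_n) (x : R) : 'M[R[i]]_(n + n) :=
  Omega Z *m expmx ((- x)%:C%C *: calA beta)
    *m expmx (x%:C%C *: calAx beta th1 Zt).

Definition Bform (R : realType) (n p : nat) (beta : 'M[R[i]]_n)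
    (th1 : 'M[R[i]]_(n, p)) (Z Zt : 'M[R[i]]_n) (x : R) :
    'M[R[i]]_(n + n, p) :=
  let c : R[i] := - 2%:R * 'i%C * x%:C%C in
  (Num.sqrt (2%:R : R))%:C%C *:
    (col_mx (expmx (c *: beta) *m Zt - Z *m expmx (c *: beta^t*))
            (expmx (c *: beta^t*)) *m th1).

Definition Cform (R : realType) (n p : nat) (beta : 'M[R[i]]_n)
    (th1 : 'M[R[i]]_(n, p)) (Z Zt : 'M[R[i]]_n) (x : R) :
    'M[R[i]]_(p, n + n) :=
  let c : R[i] := 2%:R * 'i%C * x%:C%C in
  (Num.sqrt (2%:R : R))%:C%C *:
    (th1^t* *m row_mx (expmx (c *: beta))
                      (expmx (c *: beta) *m Z - Zt *m expmx (c *: beta^t*))).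

Definition Pcross (R : realType) (n : nat) (Ul : 'M[R[i]]_(n + n)) :
    'M[R[i]]_(n + n) :=
  block_mx 0 0 (invmx (drsubmx Ul) *m dlsubmx Ul) 1%:M.

(* The value on the diagonal x = t is immaterial. *)
Definition kerT (R : realType) (n p : nat) (B : R -> 'M[R[i]]_(n + n, p))
    (C : R -> 'M[R[i]]_(p, n + n)) (U : R -> 'M[R[i]]_(n + n))
    (Px : 'M[R[i]]_(n + n)) (x t : R) : 'M[R[i]]_p :=
  if t < x then C x *m U x *m (1%:M - Px) *m invmx (U t) *m B t
  else - (C x *m U x *m Px *m invmx (U t) *m B t).

Definition Jmx (R : realType) (n : nat) : 'M[R[i]]_(n + n) :=
  block_mx 0 (- 1%:M) 1%:M 0.

(* Main.v *)
Require Import Defs.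
From HB Require Import structures.
From mathcomp Require Import all_boot all_order all_algebra spectral.
From mathcomp Require Import complex.
From mathcomp Require Import all_classical all_reals all_analysis.
From mathcomp Require Import measurable_realfun ring lra.

(* For eta below the spectrum, the integral over the line Im lambda = eta of
   e^(i lambda y) lambda^-1 (lambda - 2 beta)^-1 vanishes in the limit for y <= 0
   (Cauchy's theorem on rectangles in the lower half-plane), while for y > 0 its limit solves a
   linear differential equation. Comparing the result with the limit in mean
   gives, almost everywhere,
     k(x) = 2 theta1^* e^(2 i x beta) nu Pi(x) R,
   with Pi(x) the sum of the P_j with d_j < x.
   By the identities for the X_j, Lambda_j(s) = X_j - e^(-2 i s beta) X_j e^(2 i s beta^* )
   is a primitive of 2 e^(-2 i s beta) Q_j e^(2 i s beta^* ). As R is unitary, the kernel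
   of S is therefore semiseparable:
     2 theta1^* e^(2 i x beta) L(min(x, t)) e^(-2 i t beta^* ) theta1,
     L(x) = sum over d_j < x of Lambda_j(x - d_j).
   Since L is continuous and Hermitian, B and C = B^* J extend continuously to [0, l] and
   U' = B C U, so that U is J-unitary. If U22(l) v = 0, put y = U [0; v]; then
   Re (y2^* (y1 + L y2)) vanishes at 0 and l, and its derivative dominates |C y|^2,
   hence C y = 0, y is constant and v = 0: U22(l) is invertible.
   Finally S f = f - C z, where z' = B f almost everywhere and z satisfies the
   boundary conditions of the projection onto the last n coordinates; the product
   rule for U^-1 z carries them to those of P^x, and yields T S = S T = I. *)

Set Implicit Arguments.
Unset Strict Implicit.
Unset Printing Implicit Defensive.

Import Order.TTheory GRing.Theory Num.Theory.
Import numFieldNormedType.Exports.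

Local Open Scope classical_set_scope.
Local Open Scope ring_scope.
Local Open Scope sesquilinear_scope.

(** Cauchy's theorem is available only below the spectrum, and no residue is ever computed. For y >
    0 the resolvent integral is divided once more by lambda; the result G solves G' = i B G + i V
    with B = 2 beta, where V is the scalar integral of e^(i lambda y) lambda^-2. The limit of V is
    -2 pi max(y, 0); being continuous, it can be approached uniformly on compact sets, whereas
    lambda^-1 would give a jump at y = 0. For positive y it is found by conjugation, which exchanges
    the half-planes. On the side of the operator, Z_m and its conjugated counterpart enter B and C
    only through one Hermitian matrix, which on the m-th interval equals L. This is why the pieces
    of B, C and U fit together at the nodes d_j. The data are weak: k is known almost everywhere, B
    and C only between the nodes, f is only square integrable. So the inversion is first carried out
    for kernels built from functions that are continuous on the whole line, with identities valid at
    every x, and then transferred across the finite set of nodes; the product rule is needed for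
    primitives of integrable functions. *)

Local Notation ii := ('i%C).

(** * Functions of a real variable with complex values *)

Local Notation Re := complex.Re.
Local Notation Im := complex.Im.

Section ComplexCalculus.
Context {R : realType}.
Implicit Types (f g : R -> R[i]) (x y : R) (z w : R[i]).

Lemma ReD z w : Re (z + w) = Re z + Re w. Proof. by case: z w => [a b] []. Qed.
Lemma ImD z w : Im (z + w) = Im z + Im w. Proof. by case: z w => [a b] []. Qed.
Lemma ReN z : Re (- z) = - Re z. Proof. by case: z. Qed.
Lemma ImN z : Im (- z) = - Im z. Proof. by case: z. Qed.
Lemma ReM z w : Re (z * w) = Re z * Re w - Im z * Im w.
Proof. by case: z w => [a b] []. Qed.
Lemma ImM z w : Im (z * w) = Re z * Im w + Im z * Re w.
Proof. by case: z w => [a b] []. Qed.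
Lemma Re_conj z : Re z^* = Re z. Proof. by case: z. Qed.
Lemma Im_conj z : Im z^* = - Im z. Proof. by case: z. Qed.
Lemma ReV z : Re z^-1 = Re z / (Re z ^+ 2 + Im z ^+ 2). Proof. by case: z. Qed.
Lemma ImV z : Im z^-1 = - Im z / (Re z ^+ 2 + Im z ^+ 2).
Proof. by case: z => a b /=; rewrite mulNr. Qed.
Lemma Re_sum I (r : seq I) (P : pred I) (F : I -> R[i]) :
  Re (\sum_(i <- r | P i) F i) = \sum_(i <- r | P i) Re (F i).
Proof. exact: (big_morph _ ReD). Qed.
Lemma Im_sum I (r : seq I) (P : pred I) (F : I -> R[i]) :
  Im (\sum_(i <- r | P i) F i) = \sum_(i <- r | P i) Im (F i).
Proof. exact: (big_morph _ ImD). Qed.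
Lemma ReC (r : R) : Re r%:C%C = r. Proof. by []. Qed.
Lemma ImC (r : R) : Im r%:C%C = 0. Proof. by []. Qed.
Lemma complex_ext z w : Re z = Re w -> Im z = Im w -> z = w.
Proof. by case: z w => [a b] [c d] /= -> ->. Qed.

Lemma Re_i : Re (ii : R[i]) = 0. Proof. by []. Qed.
Lemma Im_i : Im (ii : R[i]) = 1. Proof. by []. Qed.
Lemma ReComplex (a b : R) : Re (Complex a b) = a. Proof. by []. Qed.
Lemma ImComplex (a b : R) : Im (Complex a b) = b. Proof. by []. Qed.

Definition ReImE := (Re_i, Im_i, ReD, ImD, ReN, ImN, ReM, ImM, Re_conj, Im_conj, ReC, ImC,
  ReComplex, ImComplex).

(** The norm of [R[i]] takes its values in [R[i]]. The l1-norm of real and imaginary part is real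
    and submultiplicative, and leaves the estimates to linear and polynomial arithmetic over [R]. *)
Definition c1 z : R := `|Re z| + `|Im z|.

Lemma c1_ge0 z : 0 <= c1 z. Proof. exact: addr_ge0. Qed.
Lemma c1_Re z : `|Re z| <= c1 z. Proof. by rewrite lerDl. Qed.
Lemma c1_Im z : `|Im z| <= c1 z. Proof. by rewrite lerDr. Qed.
Lemma c1D z w : c1 (z + w) <= c1 z + c1 w.
Proof. by rewrite /c1 ReD ImD addrACA lerD// ler_normD. Qed.
Lemma c1N z : c1 (- z) = c1 z. Proof. by rewrite /c1 ReN ImN !normrN. Qed.
Lemma c1B z w : c1 (z - w) <= c1 z + c1 w. Proof. by rewrite -(c1N w) c1D. Qed.
Lemma c1M z w : c1 (z * w) <= c1 z * c1 w.
Proof.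
rewrite /c1 ReM ImM mulrDl !mulrDr -!normrM.
have := ler_normB (Re z * Re w) (Im z * Im w).
have := ler_normD (Re z * Im w) (Im z * Re w); lra.
Qed.
Lemma c10 : c1 0 = 0. Proof. by rewrite /c1 /= normr0 addr0. Qed.
Lemma c1_1 : c1 1 = 1. Proof. by rewrite /c1 /= normr0 addr0 normr1. Qed.
Lemma c1_real (r : R) : c1 r%:C%C = `|r|. Proof. by rewrite /c1 /= normr0 addr0. Qed.
Lemma c1_i : c1 ii = 1. Proof. by rewrite /c1 /= normr0 add0r normr1. Qed.
Lemma c1_sum I (r : seq I) (P : pred I) (F : I -> R[i]) :
  c1 (\sum_(i <- r | P i) F i) <= \sum_(i <- r | P i) c1 (F i).
Proof.
elim/big_ind2 : _ => //; first by rewrite c10.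
by move=> a b c d h1 h2; apply: le_trans (c1D _ _) (lerD h1 h2).
Qed.
Lemma c1_eq0 z : c1 z = 0 -> z = 0.
Proof.
move=> h; have := c1_Re z; have := c1_Im z; rewrite h !normr_le0.
by move=> /eqP h1 /eqP h2; apply: complex_ext.
Qed.
Lemma c1_conj z : c1 z^* = c1 z.
Proof. by rewrite /c1 Re_conj Im_conj normrN. Qed.
Lemma sqnorm_le_c1 z : sqnorm z <= c1 z ^+ 2.
Proof.
rewrite /sqnorm /c1 -(real_normK (num_real (Re z))) -(real_normK (num_real (Im z))).
have := normr_ge0 (Re z); have := normr_ge0 (Im z); nra.
Qed.
Lemma c1_le_sqnorm z : c1 z ^+ 2 <= 2 * sqnorm z.
Proof.
rewrite /sqnorm /c1 -(real_normK (num_real (Re z))) -(real_normK (num_real (Im z))).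
have := normr_ge0 (Re z); have := normr_ge0 (Im z).
have := sqr_ge0 (`|Re z| - `|Im z|); nra.
Qed.
(** The l1-norm is not multiplicative, hence the factor 2: the exact value is [c1 z / sqnorm z], and
    [sqnorm z] is at least half the square of [c1 z]. *)
Lemma c1V z : c1 z^-1 <= 2 / c1 z.
Proof.
have [->|z0] := eqVneq z 0; first by rewrite invr0 c10 invr0 mulr0.
have cz : 0 < c1 z.
  rewrite lt_neqAle c1_ge0 andbT; apply: contra_neq z0 => /esym.
  exact: c1_eq0.
have sz : 0 < sqnorm z by have := c1_le_sqnorm z; nra.
have -> : c1 z^-1 = c1 z / sqnorm z.
  rewrite /c1 ReV ImV !normrM normrN -mulrDl; congr (_ * _).
  by rewrite normfV ger0_norm// ltW.
rewrite ler_pdivrMr// mulrAC ler_pdivlMr// -expr2.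
exact: c1_le_sqnorm.
Qed.
Lemma c1_cexp z : c1 (cexp z) <= 2 * expR (Re z).
Proof.
rewrite /c1 /cexp /= !normrM (ger0_norm (expR_ge0 _)) -mulrDr mulrC.
by rewrite ler_wpM2r ?expR_ge0//; have := cos_max (Im z); have := sin_max (Im z); lra.
Qed.

Lemma cexpD z w : cexp (z + w) = cexp z * cexp w.
Proof.
case: z w => [a b] [c d]; rewrite /cexp /= expRD cosD sinD.
by apply: complex_ext; rewrite /= ; ring.
Qed.
Lemma cexp0 : cexp 0 = 1 :> R[i].
Proof. by rewrite /cexp /= expR0 cos0 sin0 mulr1 mulr0. Qed.
Lemma cexpR (r : R) : cexp r%:C%C = (expR r)%:C%C.
Proof. by rewrite /cexp /= cos0 sin0 mulr1 mulr0. Qed.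

Definition is_cder f x z : Prop :=
  is_derive x 1 (fun y => Re (f y)) (Re z) /\
  is_derive x 1 (fun y => Im (f y)) (Im z).

Lemma is_derive_ext (h k : R -> R) x (a : R) :
  h =1 k -> is_derive x 1 h a -> is_derive x 1 k a.
Proof. by move=> /funext ->. Qed.

Lemma is_derive_uniq (h : R -> R) x (a b : R) :
  is_derive x 1 h a -> is_derive x 1 h b -> a = b.
Proof. by move=> [_ <-] [_ <-]. Qed.

Lemma is_derive_shiftN (h : R -> R) x (a : R) (c e : R) :
  is_derive (c * x + e) 1 h a -> is_derive x 1 (fun y => h (c * y + e)) (c * a).
Proof.
move=> dh.
have dl : is_derive x 1 (fun y : R => c * y + e) c.
  apply: is_derive_eq.
  by rewrite addr0 [c%:A]mulr1.
apply: is_derive_eq (_ : is_derive x 1 _ (a * c)) _; last by rewrite mulrC.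
Qed.

Lemma cder_ext f g x z : f =1 g -> is_cder f x z -> is_cder g x z.
Proof. by move=> /funext ->. Qed.

Lemma cder_eq f x z w : is_cder f x z -> z = w -> is_cder f x w.
Proof. by move=> ? <-. Qed.

Lemma cder_cst z x : is_cder (fun=> z) x 0.
Proof. by split; exact: is_derive_cst. Qed.

Lemma cderD f g x z w : is_cder f x z -> is_cder g x w ->
  is_cder (fun y => f y + g y) x (z + w).
Proof.
move=> [f1 f2] [g1 g2]; split; rewrite ReImE.
- apply: is_derive_ext (is_deriveD f1 g1) => y; by rewrite ReImE.
- apply: is_derive_ext (is_deriveD f2 g2) => y; by rewrite ReImE.
Qed.

Lemma cderN f x z : is_cder f x z -> is_cder (fun y => - f y) x (- z).
Proof.
move=> [f1 f2]; split; rewrite ReImE.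
- apply: is_derive_ext (is_deriveN f1) => y; by rewrite ReImE.
- apply: is_derive_ext (is_deriveN f2) => y; by rewrite ReImE.
Qed.

Lemma cderB f g x z w : is_cder f x z -> is_cder g x w ->
  is_cder (fun y => f y - g y) x (z - w).
Proof. by move=> hf hg; apply: cderD hf (cderN hg). Qed.

Lemma cderM f g x z w : is_cder f x z -> is_cder g x w ->
  is_cder (fun y => f y * g y) x (z * g x + f x * w).
Proof.
move=> [f1 f2] [g1 g2]; split.
- apply: is_derive_eq (is_derive_ext _ (is_deriveB (is_deriveM f1 g1) (is_deriveM f2 g2))) _.
    by move=> y; rewrite ReImE.
  rewrite !ReImE /GRing.scale /=; ring.
- apply: is_derive_eq (is_derive_ext _ (is_deriveD (is_deriveM f1 g2) (is_deriveM f2 g1))) _.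
    by move=> y; rewrite ReImE.
  rewrite !ReImE /GRing.scale /=; ring.
Qed.

Lemma cderZl f x z w : is_cder f x z -> is_cder (fun y => w * f y) x (w * z).
Proof.
move=> hf; apply: cder_eq (cderM (cder_cst w x) hf) _.
by rewrite mul0r add0r.
Qed.

Lemma cderZr f x z w : is_cder f x z -> is_cder (fun y => f y * w) x (z * w).
Proof.
move=> hf; apply: cder_eq (cderM hf (cder_cst w x)) _.
by rewrite mulr0 addr0.
Qed.

Lemma cder_sum (I : Type) (r : seq I) (P : pred I) (F : I -> R -> R[i]) (D : I -> R[i]) x :
  (forall i, P i -> is_cder (F i) x (D i)) ->
  is_cder (fun y => \sum_(i <- r | P i) F i y) x (\sum_(i <- r | P i) D i).
Proof.
move=> h; elim: r => [|i r ih].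
  by rewrite big_nil; apply: cder_ext (cder_cst 0 x) => y; rewrite big_nil.
rewrite big_cons; case: ifP => Pi.
  by apply: cder_ext (cderD (h i Pi) ih) => y; rewrite big_cons Pi.
by apply: cder_ext ih => y; rewrite big_cons Pi.
Qed.

Lemma cder_conj f x z : is_cder f x z -> is_cder (fun y => (f y)^*) x z^*.
Proof.
move=> [f1 f2]; split; rewrite ReImE.
- by apply: is_derive_ext f1 => y; rewrite ReImE.
- by apply: is_derive_ext (is_deriveN f2) => y; rewrite ReImE.
Qed.

Lemma cder_real (h : R -> R) x (a : R) :
  is_derive x 1 h a -> is_cder (fun y => (h y)%:C%C) x a%:C%C.
Proof. by move=> dh; split => //; exact: is_derive_cst. Qed.

Lemma cder_id x : is_cder (fun y => y%:C%C) x 1.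
Proof. by have := cder_real (is_derive_id x 1). Qed.

Lemma cder_affine f x z (c e : R) :
  is_cder f (c * x + e) z -> is_cder (fun y => f (c * y + e)) x (c%:C%C * z).
Proof.
move=> [f1 f2]; split.
- apply: is_derive_eq (is_derive_shiftN f1) _; rewrite !ReImE; ring.
- apply: is_derive_eq (is_derive_shiftN f2) _; rewrite !ReImE; ring.
Qed.

Lemma cder_cexp f x z : is_cder f x z ->
  is_cder (fun y => cexp (f y)) x (z * cexp (f x)).
Proof.
move=> [f1 f2].
have e1 := is_derive1_comp (is_derive_expR (Re (f x))) f1.
have c2 := is_derive1_comp (is_derive_cos (Im (f x))) f2.
have s2 := is_derive1_comp (is_derive_sin (Im (f x))) f2.
split.
- apply: is_derive_eq (is_derive_ext _ (is_deriveM e1 c2)) _ => //.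
  by rewrite ReM /cexp /GRing.scale /=; ring.
- apply: is_derive_eq (is_derive_ext _ (is_deriveM e1 s2)) _ => //.
  by rewrite ImM /cexp /GRing.scale /=; ring.
Qed.

Lemma sqnorm_eq0 z : sqnorm z = 0 -> z = 0.
Proof.
move=> h; have := c1_le_sqnorm z; rewrite h mulr0 => h2; apply: c1_eq0.
by apply/eqP; rewrite -sqrf_eq0 eq_le h2 sqr_ge0.
Qed.

Lemma sqnorm_ge0 z : 0 <= sqnorm z.
Proof. by rewrite addr_ge0 ?sqr_ge0. Qed.

Lemma cderV f x z : f x != 0 -> is_cder f x z ->
  is_cder (fun y => (f y)^-1) x (- z / f x ^+ 2).
Proof.
move=> f0 [f1 f2].
have s0 : sqnorm (f x) != 0 by apply: contra_neq f0 => /sqnorm_eq0.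
have ds := is_deriveD (is_deriveM f1 f1) (is_deriveM f2 f2).
have {ds} ds := is_derive_ext (fun y => erefl (sqnorm (f y))) ds.
have dv := is_deriveV (f := fun y => sqnorm (f y)) s0 ds.
have f2N : is_derive x 1 (fun y => - Im (f y)) (- Im z) := is_deriveN f2.
have e : Re (f x) ^+ 2 + Im (f x) ^+ 2 != 0 := s0.
have e1 : forall a b : R, (a * a - b * b) ^+ 2 + (a * b + b * a) ^+ 2 = (a ^+ 2 + b ^+ 2) ^+ 2.
  by move=> a b; ring.
split.
- apply: is_derive_eq (is_derive_ext _ (is_deriveM f1 dv)) _.
    by move=> y; rewrite ReV.
  rewrite [f x ^+ 2]expr2 !(ReImE, ReV, ImV) e1 /GRing.scale /sqnorm /=; field.
  exact: e.
- apply: is_derive_eq (is_derive_ext _ (is_deriveM f2N dv)) _.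
    by move=> y; rewrite ImV.
  rewrite [f x ^+ 2]expr2 !(ReImE, ReV, ImV) e1 /GRing.scale /sqnorm /=; field.
  exact: e.
Qed.

Definition ccont f x := {for x, continuous (fun y => Re (f y))} /\
  {for x, continuous (fun y => Im (f y))}.

Lemma is_derive_continuous (h : R -> R) x (a : R) :
  is_derive x 1 h a -> {for x, continuous h}.
Proof. by move=> dh; apply/differentiable_continuous/derivable1_diffP. Qed.

Lemma cder_ccont f x z : is_cder f x z -> ccont f x.
Proof. by move=> [f1 f2]; split; exact: is_derive_continuous. Qed.

Lemma cont_ext (h k : R -> R) x : h =1 k ->
  {for x, continuous h} -> {for x, continuous k}.
Proof. by move=> /funext ->. Qed.

Lemma ccont_ext f g x : f =1 g -> ccont f x -> ccont g x.
Proof. by move=> /funext ->. Qed.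

Lemma ccont_cst z x : ccont (fun=> z) x.
Proof. exact: cder_ccont (cder_cst z x). Qed.

Lemma ccontD f g x : ccont f x -> ccont g x -> ccont (fun y => f y + g y) x.
Proof.
move=> [f1 f2] [g1 g2]; split.
- by apply: cont_ext (@continuousD R R R _ _ x f1 g1) => y; rewrite ReD.
- by apply: cont_ext (@continuousD R R R _ _ x f2 g2) => y; rewrite ImD.
Qed.

Lemma ccontN f x : ccont f x -> ccont (fun y => - f y) x.
Proof.
move=> [f1 f2]; split.
- by apply: cont_ext (@continuousN R R R _ x f1) => y; rewrite ReN.
- by apply: cont_ext (@continuousN R R R _ x f2) => y; rewrite ImN.
Qed.

Lemma ccontM f g x : ccont f x -> ccont g x -> ccont (fun y => f y * g y) x.
Proof.
move=> [f1 f2] [g1 g2]; split.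
- apply: cont_ext (@continuousB R R R _ _ x (@continuousM R R _ _ x f1 g1)
    (@continuousM R R _ _ x f2 g2)) => y; by rewrite ReM.
- apply: cont_ext (@continuousD R R R _ _ x (@continuousM R R _ _ x f1 g2)
    (@continuousM R R _ _ x f2 g1)) => y; by rewrite ImM.
Qed.

Lemma ccont_conj f x : ccont f x -> ccont (fun y => (f y)^*) x.
Proof.
move=> [f1 f2]; split.
- by apply: cont_ext f1 => y; rewrite Re_conj.
- by apply: cont_ext (@continuousN R R R _ x f2) => y; rewrite Im_conj.
Qed.

Lemma ccont_sum (I : Type) (r : seq I) (P : pred I) (F : I -> R -> R[i]) x :
  (forall i, P i -> ccont (F i) x) ->
  ccont (fun y => \sum_(i <- r | P i) F i y) x.
Proof.
move=> h; elim: r => [|i r ih].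
  rewrite (_ : (fun y => _) = (fun=> 0)); first exact: ccont_cst.
  by apply/funext => y; rewrite big_nil.
case Pi : (P i).
  rewrite (_ : (fun y => _) = (fun y => F i y + \sum_(i <- r | P i) F i y)).
    exact: ccontD (h _ Pi) ih.
  by apply/funext => y; rewrite big_cons Pi.
rewrite (_ : (fun y => _) = (fun y => \sum_(i <- r | P i) F i y)) //.
by apply/funext => y; rewrite big_cons Pi.
Qed.

Lemma ccont_comp f (h : R -> R) x :
  {for x, continuous h} -> ccont f (h x) -> ccont (fun y => f (h y)) x.
Proof.
move=> ch [f1 f2]; split.
- exact: (@continuous_comp _ _ _ h (fun y => Re (f y))).
- exact: (@continuous_comp _ _ _ h (fun y => Im (f y))).
Qed.

(** Induction on the exceptional points: one inside the interval splits it, one outside is dropped,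
    and the mean value theorem applies when none is left. The intended functions are continuous with
    kinks at the d_j. *)
Lemma nondecreasing_off_finite (s : seq R) (h dh : R -> R) (a b : R) :
  a <= b -> {within `[a, b], continuous h} ->
  (forall x, a < x < b -> x \notin s -> is_derive x 1 h (dh x) /\ 0 <= dh x) ->
  h a <= h b.
Proof.
elim: s a b => [|c s ih] a b ab ch hd.
  move: ab; rewrite le_eqVlt => /predU1P[-> //|ab].
  have hd1 x : x \in `]a, b[ -> is_derive x 1 h (dh x).
    by rewrite in_itv /= => xab; case: (hd x xab isT).
  have [y] := MVT ab hd1 ch; rewrite in_itv /= => yab e.
  rewrite -subr_ge0 e mulr_ge0 ?subr_ge0 ?(ltW ab)//.
  by case: (hd y yab isT).
have [/andP[ac cb]|cab] := boolP (a < c < b).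
  apply: (@le_trans _ _ (h c)).
    apply: ih (ltW ac) _ _.
      apply: continuous_subspaceW ch; apply: subset_itvl.
      by rewrite bnd_simp ltW.
    move=> x /andP[ax xc] xs; apply: hd; first by rewrite ax (lt_trans xc).
    by rewrite inE negb_or xs andbT lt_eqF.
  apply: ih (ltW cb) _ _.
    apply: continuous_subspaceW ch; apply: subset_itvr.
    by rewrite bnd_simp ltW.
  move=> x /andP[cx xb] xs; apply: hd; first by rewrite xb (lt_trans ac).
  by rewrite inE negb_or xs andbT gt_eqF.
apply: ih => // x xab xs; apply: hd => //.
by rewrite inE negb_or xs andbT; apply: contraNneq cab => <-.
Qed.

Lemma cst_off_finite (s : seq R) (h : R -> R) (a b : R) :
  a <= b -> {within `[a, b], continuous h} ->
  (forall x, a < x < b -> x \notin s -> is_derive x 1 h 0) -> h a = h b.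
Proof.
move=> ab ch hd; apply/eqP; rewrite eq_le; apply/andP; split.
  apply: (@nondecreasing_off_finite s h (fun=> 0)) => // x xab xs.
  by split; [exact: hd|].
rewrite -lerN2.
apply: (@nondecreasing_off_finite s (fun x => - h x) (fun=> 0)) => //.
  by move=> x; apply: (@continuousN R R); exact: ch.
move=> x xab xs; split => //; rewrite -oppr0; apply: is_deriveN; exact: hd.
Qed.

Lemma is_derive_bound (h dh : R -> R) (a b M : R) : 
  a <= b -> (forall x, a <= x <= b -> is_derive x 1 h (dh x)) ->
  (forall x, a <= x <= b -> `|dh x| <= M) -> `|h b - h a| <= M * (b - a).
Proof.
move=> ab hd hM.
have ch : {within `[a, b], continuous h}.
  apply: derivable_within_continuous => x; rewrite in_itv /= => xab.
  by case: (hd x xab).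
have hd1 x : x \in `]a, b[ -> is_derive x 1 h (dh x).
  by rewrite in_itv /= => /andP[/ltW ax /ltW xb]; apply: hd; rewrite ax.
have [x xab ->] := MVT_segment ab hd1 ch.
rewrite normrM (ger0_norm (x := b - a)) ?subr_ge0//.
by rewrite ler_wpM2r ?subr_ge0//; apply: hM; rewrite in_itv in xab.
Qed.

Lemma cder_bound f (df : R -> R[i]) (a b M : R) :
  a <= b -> (forall x, a <= x <= b -> is_cder f x (df x)) ->
  (forall x, a <= x <= b -> c1 (df x) <= M) -> c1 (f b - f a) <= 2 * M * (b - a).
Proof.
move=> ab hd hM.
have h1 : `|Re (f b) - Re (f a)| <= M * (b - a).
  apply: (@is_derive_bound (fun x => Re (f x)) (fun x => Re (df x))) => // x xab.
    exact: (hd x xab).1.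
  exact: le_trans (c1_Re _) (hM x xab).
have h2 : `|Im (f b) - Im (f a)| <= M * (b - a).
  apply: (@is_derive_bound (fun x => Im (f x)) (fun x => Im (df x))) => // x xab.
    exact: (hd x xab).2.
  exact: le_trans (c1_Im _) (hM x xab).
by rewrite /c1 !ReImE; lra.
Qed.

Lemma cder0_cst f x y : (forall x, is_cder f x 0) -> f x = f y.
Proof.
move=> h; apply: complex_ext.
- by apply: (is_derive_0_is_cst (f := fun x => Re (f x))) => t; exact: (h t).1.
- by apply: (is_derive_0_is_cst (f := fun x => Im (f x))) => t; exact: (h t).2.
Qed.
End ComplexCalculus.

(** * Matrix-valued functions *)

Section MatrixCalculus.
Context {R : realType}.
Implicit Types (x y : R).

Definition is_mder q r (F : R -> 'M[R[i]]_(q, r)) x (D : 'M[R[i]]_(q, r)) :=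
  forall i j, is_cder (fun y => F y i j) x (D i j).

Definition mcont q r (F : R -> 'M[R[i]]_(q, r)) x :=
  forall i j, ccont (fun y => F y i j) x.

Definition mnorm q r (A : 'M[R[i]]_(q, r)) : R := \sum_i \sum_j c1 (A i j).

Lemma mder_ext q r (F G : R -> 'M[R[i]]_(q, r)) x D :
  F =1 G -> is_mder F x D -> is_mder G x D.
Proof. by move=> /funext ->. Qed.

Lemma mder_eq q r (F : R -> 'M[R[i]]_(q, r)) x D E :
  is_mder F x D -> D = E -> is_mder F x E.
Proof. by move=> ? <-. Qed.

Lemma mder_mcont q r (F : R -> 'M[R[i]]_(q, r)) x D : is_mder F x D -> mcont F x.
Proof. by move=> h i j; exact: cder_ccont (h i j). Qed.

Lemma mder_cst q r (A : 'M[R[i]]_(q, r)) x : is_mder (fun=> A) x 0.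
Proof. by move=> i j; rewrite mxE; exact: cder_cst. Qed.

Lemma mderD q r (F G : R -> 'M[R[i]]_(q, r)) x D E :
  is_mder F x D -> is_mder G x E -> is_mder (fun y => F y + G y) x (D + E).
Proof.
move=> h1 h2 i j; rewrite mxE; apply: cder_ext (cderD (h1 i j) (h2 i j)).
by move=> y; rewrite mxE.
Qed.

Lemma mderN q r (F : R -> 'M[R[i]]_(q, r)) x D :
  is_mder F x D -> is_mder (fun y => - F y) x (- D).
Proof.
move=> h1 i j; rewrite mxE; apply: cder_ext (cderN (h1 i j)).
by move=> y; rewrite mxE.
Qed.

Lemma mderB q r (F G : R -> 'M[R[i]]_(q, r)) x D E :
  is_mder F x D -> is_mder G x E -> is_mder (fun y => F y - G y) x (D - E).
Proof. by move=> h1 h2; apply: mderD h1 (mderN h2). Qed.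

Lemma mderM q r s (F : R -> 'M[R[i]]_(q, r)) (G : R -> 'M[R[i]]_(r, s)) x D E :
  is_mder F x D -> is_mder G x E ->
  is_mder (fun y => F y *m G y) x (D *m G x + F x *m E).
Proof.
move=> h1 h2 i j; rewrite !mxE -big_split /=.
apply: (cder_ext (f := fun y => \sum_k F y i k * G y k j)).
  by move=> y; rewrite mxE.
by apply: cder_sum => k _; exact: cderM.
Qed.

Lemma mderMl q r s (A : 'M[R[i]]_(q, r)) (G : R -> 'M[R[i]]_(r, s)) x E :
  is_mder G x E -> is_mder (fun y => A *m G y) x (A *m E).
Proof.
by move=> h; apply: mder_eq (mderM (mder_cst A x) h) _; rewrite mul0mx add0r.
Qed.

Lemma mderMr q r s (F : R -> 'M[R[i]]_(q, r)) (A : 'M[R[i]]_(r, s)) x D :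
  is_mder F x D -> is_mder (fun y => F y *m A) x (D *m A).
Proof.
by move=> h; apply: mder_eq (mderM h (mder_cst A x)) _; rewrite mulmx0 addr0.
Qed.

Lemma mderZ q r (f : R -> R[i]) (G : R -> 'M[R[i]]_(q, r)) x z E :
  is_cder f x z -> is_mder G x E ->
  is_mder (fun y => f y *: G y) x (z *: G x + f x *: E).
Proof.
move=> h1 h2 i j; rewrite !mxE; apply: cder_ext (cderM h1 (h2 i j)).
by move=> y; rewrite mxE.
Qed.

Lemma mderZl q r (a : R[i]) (G : R -> 'M[R[i]]_(q, r)) x E :
  is_mder G x E -> is_mder (fun y => a *: G y) x (a *: E).
Proof.
by move=> h; apply: mder_eq (mderZ (cder_cst a x) h) _; rewrite scale0r add0r.
Qed.

Lemma mder_sum q r (I : Type) (s : seq I) (P : pred I)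
    (F : I -> R -> 'M[R[i]]_(q, r)) (D : I -> 'M[R[i]]_(q, r)) x :
  (forall i, P i -> is_mder (F i) x (D i)) ->
  is_mder (fun y => \sum_(i <- s | P i) F i y) x (\sum_(i <- s | P i) D i).
Proof.
move=> h i j; rewrite summxE.
apply: (cder_ext (f := fun y => \sum_(k <- s | P k) F k y i j)).
  by move=> y; rewrite summxE.
by apply: cder_sum => k Pk; exact: h.
Qed.

Lemma mder_adj q r (F : R -> 'M[R[i]]_(q, r)) x D :
  is_mder F x D -> is_mder (fun y => (F y)^t*) x (D^t*).
Proof.
move=> h i j; rewrite !mxE; apply: cder_ext (cder_conj (h j i)).
by move=> y; rewrite !mxE.
Qed.

Lemma mder_row_mx q r s (F : R -> 'M[R[i]]_(q, r)) (G : R -> 'M[R[i]]_(q, s)) x D E :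
  is_mder F x D -> is_mder G x E -> is_mder (fun y => row_mx (F y) (G y)) x (row_mx D E).
Proof.
move=> h1 h2 i j; rewrite mxE; case: splitP => k jk.
- apply: cder_ext (h1 i k) => y; rewrite mxE.
  by rewrite (_ : j = lshift s k) ?(unsplitK (inl _ k)) //; exact/val_inj.
- apply: cder_ext (h2 i k) => y; rewrite mxE.
  by rewrite (_ : j = rshift r k) ?(unsplitK (inr _ k)) //; exact/val_inj.
Qed.

Lemma mder_col_mx q r s (F : R -> 'M[R[i]]_(q, r)) (G : R -> 'M[R[i]]_(s, r)) x D E :
  is_mder F x D -> is_mder G x E -> is_mder (fun y => col_mx (F y) (G y)) x (col_mx D E).
Proof.
move=> h1 h2 i j; rewrite mxE; case: splitP => k jk.
- apply: cder_ext (h1 k j) => y; rewrite mxE.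
  by rewrite (_ : i = lshift s k) ?(unsplitK (inl _ k)) //; exact/val_inj.
- apply: cder_ext (h2 k j) => y; rewrite mxE.
  by rewrite (_ : i = rshift q k) ?(unsplitK (inr _ k)) //; exact/val_inj.
Qed.

Lemma mder_affine q r (F : R -> 'M[R[i]]_(q, r)) x D (c e : R) :
  is_mder F (c * x + e) D -> is_mder (fun y => F (c * y + e)) x (c%:C%C *: D).
Proof.
by move=> h i j; rewrite mxE; apply: (@cder_affine _ (fun y => F y i j)).
Qed.

Lemma mder0_cst q r (F : R -> 'M[R[i]]_(q, r)) x y :
  (forall x, is_mder F x 0) -> F x = F y.
Proof.
move=> h; apply/matrixP => i j; apply: (@cder0_cst _ (fun x => F x i j)) => t.
by have := h t i j; rewrite mxE.
Qed.

Lemma mcont_ext q r (F G : R -> 'M[R[i]]_(q, r)) x :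
  F =1 G -> mcont F x -> mcont G x.
Proof. by move=> /funext ->. Qed.

Lemma mcont_cst q r (A : 'M[R[i]]_(q, r)) x : mcont (fun=> A) x.
Proof. exact: mder_mcont (mder_cst A x). Qed.

Lemma mcontD q r (F G : R -> 'M[R[i]]_(q, r)) x :
  mcont F x -> mcont G x -> mcont (fun y => F y + G y) x.
Proof.
by move=> h1 h2 i j; apply: ccont_ext (ccontD (h1 i j) (h2 i j)) => y; rewrite mxE.
Qed.

Lemma mcontN q r (F : R -> 'M[R[i]]_(q, r)) x :
  mcont F x -> mcont (fun y => - F y) x.
Proof. by move=> h i j; apply: ccont_ext (ccontN (h i j)) => y; rewrite mxE. Qed.

Lemma mcontM q r s (F : R -> 'M[R[i]]_(q, r)) (G : R -> 'M[R[i]]_(r, s)) x :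
  mcont F x -> mcont G x -> mcont (fun y => F y *m G y) x.
Proof.
move=> h1 h2 i j.
apply: (ccont_ext (f := fun y => \sum_k F y i k * G y k j)).
  by move=> y; rewrite mxE.
by apply: ccont_sum => k _; exact: ccontM.
Qed.

Lemma mcontZl q r (a : R[i]) (F : R -> 'M[R[i]]_(q, r)) x :
  mcont F x -> mcont (fun y => a *: F y) x.
Proof.
by move=> h i j; apply: ccont_ext (ccontM (ccont_cst a x) (h i j)) => y; rewrite mxE.
Qed.

Lemma mcont_sum q r (I : Type) (s : seq I) (P : pred I)
    (F : I -> R -> 'M[R[i]]_(q, r)) x :
  (forall i, P i -> mcont (F i) x) ->
  mcont (fun y => \sum_(i <- s | P i) F i y) x.
Proof.
move=> h i j; apply: (ccont_ext (f := fun y => \sum_(k <- s | P k) F k y i j)).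
  by move=> y; rewrite summxE.
by apply: ccont_sum => k Pk; exact: h.
Qed.

Lemma mcont_adj q r (F : R -> 'M[R[i]]_(q, r)) x :
  mcont F x -> mcont (fun y => (F y)^t*) x.
Proof. by move=> h i j; apply: ccont_ext (ccont_conj (h j i)) => y; rewrite !mxE. Qed.

Lemma mcont_col_mx q r s (F : R -> 'M[R[i]]_(q, r)) (G : R -> 'M[R[i]]_(s, r)) x :
  mcont F x -> mcont G x -> mcont (fun y => col_mx (F y) (G y)) x.
Proof.
move=> h1 h2 i j; case: (splitP i) => k ik.
- apply: ccont_ext (h1 k j) => y; rewrite mxE.
  by rewrite (_ : i = lshift s k) ?(unsplitK (inl _ k)) //; exact/val_inj.
- apply: ccont_ext (h2 k j) => y; rewrite mxE.
  by rewrite (_ : i = rshift q k) ?(unsplitK (inr _ k)) //; exact/val_inj.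
Qed.

Lemma mcont_comp q r (F : R -> 'M[R[i]]_(q, r)) (h : R -> R) x :
  {for x, continuous h} -> mcont F (h x) -> mcont (fun y => F (h y)) x.
Proof. by move=> ch hF i j; apply: (@ccont_comp _ (fun y => F y i j)). Qed.

Lemma mnorm_ge0 q r (A : 'M[R[i]]_(q, r)) : 0 <= mnorm A.
Proof. by apply: sumr_ge0 => i _; apply: sumr_ge0 => j _; exact: c1_ge0. Qed.

Lemma c1_le_mnorm q r (A : 'M[R[i]]_(q, r)) i j : c1 (A i j) <= mnorm A.
Proof.
rewrite /mnorm (bigD1 i)//= (bigD1 j)//= -addrA lerDl addr_ge0//.
  by apply: sumr_ge0 => k _; exact: c1_ge0.
by apply: sumr_ge0 => k _; apply: sumr_ge0 => m _; exact: c1_ge0.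
Qed.

Lemma mnormD q r (A B : 'M[R[i]]_(q, r)) : mnorm (A + B) <= mnorm A + mnorm B.
Proof.
rewrite -big_split; apply: ler_sum => i _; rewrite -big_split.
by apply: ler_sum => j _; rewrite mxE c1D.
Qed.

Lemma mnormN q r (A : 'M[R[i]]_(q, r)) : mnorm (- A) = mnorm A.
Proof. by apply: eq_bigr => i _; apply: eq_bigr => j _; rewrite mxE c1N. Qed.

Lemma mnormZ q r (a : R[i]) (A : 'M[R[i]]_(q, r)) : mnorm (a *: A) <= c1 a * mnorm A.
Proof.
rewrite mulr_sumr; apply: ler_sum => i _; rewrite mulr_sumr.
by apply: ler_sum => j _; rewrite mxE c1M.
Qed.

Lemma mnormM q r s (A : 'M[R[i]]_(q, r)) (B : 'M[R[i]]_(r, s)) :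
  mnorm (A *m B) <= mnorm A * mnorm B.
Proof.
rewrite mulr_suml; apply: ler_sum => i _.
apply: (@le_trans _ _ (\sum_j \sum_k c1 (A i k) * c1 (B k j))).
  apply: ler_sum => j _; rewrite mxE; apply: le_trans (c1_sum _ _ _) _.
  by apply: ler_sum => k _; exact: c1M.
rewrite exchange_big mulr_suml; apply: ler_sum => k _.
rewrite -mulr_sumr ler_wpM2l ?c1_ge0// /mnorm (bigD1 k)//= lerDl.
by apply: sumr_ge0 => m _; apply: sumr_ge0 => j _; exact: c1_ge0.
Qed.

(* The factor counts the entries, whose real and imaginary parts are estimated
   separately by the mean value theorem. *)
Lemma mder_bound q r (F DF : R -> 'M[R[i]]_(q, r)) (a b M : R) :
  a <= b -> (forall x, a <= x <= b -> is_mder F x (DF x)) ->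
  (forall x, a <= x <= b -> mnorm (DF x) <= M) ->
  mnorm (F b - F a) <= (2 * q%:R * r%:R) * M * (b - a).
Proof.
move=> ab hd hM.
have -> : 2 * q%:R * r%:R * M * (b - a) =
    \sum_(i < q) \sum_(j < r) (2 * M * (b - a)).
  by rewrite !sumr_const !card_ord -mulrnA -[RHS]mulr_natr natrM; ring.
apply: ler_sum => i _; apply: ler_sum => j _; rewrite !mxE.
apply: (@cder_bound _ (fun x => F x i j) (fun x => DF x i j)) => // x xab.
  exact: hd.
by apply: le_trans (hM x xab); exact: c1_le_mnorm.
Qed.

Lemma cvg_big_sum (I : Type) (s : seq I) (P : pred I) (u : I -> nat -> R) (a : I -> R) :
  (forall i, P i -> u i N @[N --> \oo] --> a i) ->
  \sum_(i <- s | P i) u i N @[N --> \oo] --> \sum_(i <- s | P i) a i.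
Proof.
move=> h; elim: s => [|i s ih].
  by under eq_fun do rewrite big_nil; rewrite big_nil; exact: cvg_cst.
under eq_fun do rewrite big_cons; rewrite big_cons.
by case: ifP => Pi //; apply: cvgD => //; exact: h.
Qed.

Definition mcvg q r (F : nat -> 'M[R[i]]_(q, r)) (L : 'M[R[i]]_(q, r)) :=
  forall i j, (complex.Re (F N i j) @[N --> \oo] --> complex.Re (L i j)) /\
    (complex.Im (F N i j) @[N --> \oo] --> complex.Im (L i j)).

Lemma mcvg_uniq q r (F : nat -> 'M[R[i]]_(q, r)) L L' :
  mcvg F L -> mcvg F L' -> L = L'.
Proof.
move=> h h'; apply/matrixP => i j; have [a b] := h i j; have [c d] := h' i j.
by apply: complex_ext; [exact: cvg_unique a c|exact: cvg_unique b d].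
Qed.

Lemma mcvg_ext q r (F G : nat -> 'M[R[i]]_(q, r)) L :
  F =1 G -> mcvg F L -> mcvg G L.
Proof. by move=> /funext ->. Qed.

Lemma mcvg_adj q r (F : nat -> 'M[R[i]]_(q, r)) L :
  mcvg F L -> mcvg (fun N => (F N)^t*) (L^t*).
Proof.
move=> h i j; have [a b] := h j i; split.
- by under eq_fun do rewrite !mxE Re_conj; rewrite !mxE Re_conj.
- by under eq_fun do rewrite !mxE Im_conj; rewrite !mxE Im_conj; exact: cvgN.
Qed.

Lemma mcvgMl q r s (A : 'M[R[i]]_(q, r)) (F : nat -> 'M[R[i]]_(r, s)) L :
  mcvg F L -> mcvg (fun N => A *m F N) (A *m L).
Proof.
move=> h i j; split.
- under eq_fun do rewrite mxE Re_sum; rewrite mxE Re_sum.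
  apply: cvg_big_sum => k _; have [a b] := h k j.
  under eq_fun do rewrite ReM; rewrite ReM.
  by apply: cvgB; apply: cvgM => //; exact: cvg_cst.
- under eq_fun do rewrite mxE Im_sum; rewrite mxE Im_sum.
  apply: cvg_big_sum => k _; have [a b] := h k j.
  under eq_fun do rewrite ImM; rewrite ImM.
  by apply: cvgD; apply: cvgM => //; exact: cvg_cst.
Qed.

End MatrixCalculus.

(** * The matrix exponential *)

Section MatrixExponential.
Context {R : realType}.
Implicit Types (x y : R).

(** Taylor coefficients of e^(xA) B. The right factor makes the family stable under differentiation,
    which turns B into AB, so one convergence statement serves the series and all its
    derivatives. *)
Definition exp_coef n q (A : 'M[R[i]]_n) (B : 'M[R[i]]_(n, q)) (i : 'I_n) (j : 'I_q)
  (k : nat) : R[i] := (k`!%:R^-1)%:C%C * (A ^+ k *m B) i j.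

Lemma mnorm_exprM n q (A : 'M[R[i]]_n) (B : 'M[R[i]]_(n, q)) k :
  mnorm (A ^+ k *m B) <= mnorm A ^+ k * mnorm B.
Proof.
elim: k => [|k ih]; first by rewrite !expr0 mul1mx mul1r.
rewrite !exprS -mulmxA -mulrA; apply: le_trans (mnormM _ _) _.
by rewrite ler_wpM2l ?mnorm_ge0.
Qed.

Lemma c1_exp_coef n q (A : 'M[R[i]]_n) (B : 'M[R[i]]_(n, q)) i j k :
  c1 (exp_coef A B i j k) <= mnorm A ^+ k * mnorm B / k`!%:R.
Proof.
apply: le_trans (c1M _ _) _; rewrite c1_real mulrC.
rewrite ger0_norm ?invr_ge0// ler_wpM2r ?invr_ge0//.
exact: le_trans (c1_le_mnorm _ _ _) (mnorm_exprM _ _ _).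
Qed.

Lemma pseries_expmx_cvg (u : nat -> R) (a b : R) x :
  (forall k, `|u k| <= a ^+ k * b / k`!%:R) -> 0 <= a -> cvgn (pseries u x).
Proof.
move=> h a0; apply: normed_cvg.
have hb : cvgn (series (b *: exp_coeff (a * `|x|))).
  apply: is_cvg_seriesZ; exact: is_cvg_series_exp_coeff.
have eb k : (b *: exp_coeff (a * `|x|)) k = a ^+ k * b / k`!%:R * `|x| ^+ k.
  rewrite -[LHS]/(b * ((a * `|x|) ^+ k / k`!%:R)) exprMn; ring.
have le k : `|u k * x ^+ k| <= (b *: exp_coeff (a * `|x|)) k.
  by rewrite eb normrM normrX; apply: ler_wpM2r; rewrite ?exprn_ge0.
apply: (series_le_cvg _ _ _ hb) => k; [exact: normr_ge0| |exact: le].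
exact: le_trans (normr_ge0 _) (le k).
Qed.

Lemma cvg_exp_coefRe n q (A : 'M[R[i]]_n) (B : 'M[R[i]]_(n, q)) i j x :
  cvgn (pseries (fun k => complex.Re (exp_coef A B i j k)) x).
Proof.
apply: (@pseries_expmx_cvg _ (mnorm A) (mnorm B)); last exact: mnorm_ge0.
by move=> k; apply: le_trans (c1_Re _) (c1_exp_coef _ _ _ _ _).
Qed.

Lemma cvg_exp_coefIm n q (A : 'M[R[i]]_n) (B : 'M[R[i]]_(n, q)) i j x :
  cvgn (pseries (fun k => complex.Im (exp_coef A B i j k)) x).
Proof.
apply: (@pseries_expmx_cvg _ (mnorm A) (mnorm B)); last exact: mnorm_ge0.
by move=> k; apply: le_trans (c1_Im _) (c1_exp_coef _ _ _ _ _).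
Qed.

Lemma exp_coef_diffs n q (A : 'M[R[i]]_n) (B : 'M[R[i]]_(n, q)) i j k :
  k.+1%:R%:C%C * exp_coef A B i j k.+1 = exp_coef A (A *m B) i j k.
Proof.
rewrite /exp_coef exprSr -mulmxA mulrA -rmorphM /= factS natrM invfM mulrA.
by rewrite divff ?mul1r// pnatr_eq0.
Qed.

Lemma exprmxZ n (a : R[i]) (A : 'M[R[i]]_n) k : (a *: A) ^+ k = a ^+ k *: A ^+ k.
Proof.
elim: k => [|k ih]; first by rewrite !expr0 scale1r.
by rewrite !exprS ih -[_ * _]/(_ *m _) -scalemxAl -scalemxAr scalerA.
Qed.

Lemma expmx_part_coef n (A : 'M[R[i]]_n) x N i j :
  expmx_part (x%:C%C *: A) N i j =
  \sum_(0 <= k < N) exp_coef A 1%:M i j k * (x ^+ k)%:C%C.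
Proof.
rewrite /expmx_part summxE; apply: eq_bigr => k _.
rewrite !mxE exprmxZ mxE /exp_coef mulmx1 rmorphXn /=.
by rewrite -mulrA [X in _ = _ * X]mulrC fmorphV rmorph_nat.
Qed.

Definition expM n q (A : 'M[R[i]]_n) (B : 'M[R[i]]_(n, q)) x : 'M[R[i]]_(n, q) :=
  \matrix_(i, j) Complex
    (limn (pseries (fun k => complex.Re (exp_coef A B i j k)) x))
    (limn (pseries (fun k => complex.Im (exp_coef A B i j k)) x)).

Lemma expmxE n (A : 'M[R[i]]_n) x : expmx (x%:C%C *: A) = expM A 1%:M x.
Proof.
apply/matrixP => i j; rewrite !mxE; congr Complex; congr (limn _).
- apply/funext => N; rewrite expmx_part_coef Re_sum.
  by apply: eq_bigr => k _; rewrite ReM !(ReC, ImC) mulr0 subr0.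
- apply/funext => N; rewrite expmx_part_coef Im_sum.
  by apply: eq_bigr => k _; rewrite ImM !(ReC, ImC) mulr0 add0r.
Qed.

Lemma mder_expM n q (A : 'M[R[i]]_n) (B : 'M[R[i]]_(n, q)) x :
  is_mder (expM A B) x (expM A (A *m B) x).
Proof.
have dR (C : 'M[R[i]]_(n, q)) i j : pseries_diffs (fun k => complex.Re (exp_coef A C i j k)) =
    (fun k => complex.Re (exp_coef A (A *m C) i j k)).
  by apply/funext => k; rewrite -exp_coef_diffs ReM !(ReC, ImC) mul0r subr0.
have dI (C : 'M[R[i]]_(n, q)) i j : pseries_diffs (fun k => complex.Im (exp_coef A C i j k)) =
    (fun k => complex.Im (exp_coef A (A *m C) i j k)).
  by apply/funext => k; rewrite -exp_coef_diffs ImM !(ReC, ImC) mul0r addr0.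
(* Any radius beyond |x| would do, since the series converge everywhere. *)
have xK : `|x| < `| (`|x| + 1) | by rewrite [ltRHS]ger0_norm ?addr_ge0// ltrDl.
move=> i j; split.
- apply: (is_derive_ext (h := fun y => limn (pseries (fun k => complex.Re (exp_coef A B i j k)) y))).
    by move=> y; rewrite mxE.
  rewrite mxE /= -dR; apply: (pseries_snd_diffs _ _ _ xK); rewrite ?dR;
  exact: cvg_exp_coefRe.
- apply: (is_derive_ext (h := fun y => limn (pseries (fun k => complex.Im (exp_coef A B i j k)) y))).
    by move=> y; rewrite mxE.
  rewrite mxE /= -dI; apply: (pseries_snd_diffs _ _ _ xK); rewrite ?dI;
  exact: cvg_exp_coefIm.
Qed.

Lemma mcvg_expM n q (A : 'M[R[i]]_n) (B : 'M[R[i]]_(n, q)) x :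
  mcvg (fun N => expmx_part (x%:C%C *: A) N *m B) (expM A B x).
Proof.
have e N i j : (expmx_part (x%:C%C *: A) N *m B) i j =
    \sum_(0 <= k < N) exp_coef A B i j k * (x ^+ k)%:C%C.
  rewrite /expmx_part mulmx_suml summxE; apply: eq_bigr => k _.
  rewrite exprmxZ scalerA -scalemxAl mxE /exp_coef rmorphXn /=.
  by rewrite [RHS]mulrAC fmorphV rmorph_nat.
move=> i j; split.
- under eq_fun do rewrite e Re_sum; rewrite mxE /=.
  apply: cvg_trans (@cvg_exp_coefRe _ _ A B i j x).
  apply: near_eq_cvg; apply: nearW => N; apply: eq_bigr => k _.
  by rewrite ReM !(ReC, ImC) mulr0 subr0.
- under eq_fun do rewrite e Im_sum; rewrite mxE /=.
  apply: cvg_trans (@cvg_exp_coefIm _ _ A B i j x).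
  apply: near_eq_cvg; apply: nearW => N; apply: eq_bigr => k _.
  by rewrite ImM !(ReC, ImC) mulr0 add0r.
Qed.

Lemma mcvg_expmx n (A : 'M[R[i]]_n) : mcvg (expmx_part A) (expmx A).
Proof.
have := @mcvg_expM _ _ A 1%:M 1; rewrite -expmxE scale1r.
by apply: mcvg_ext => N; rewrite mulmx1.
Qed.

Lemma expmx_part_comm n (A : 'M[R[i]]_n) x N :
  expmx_part (x%:C%C *: A) N *m A = A *m expmx_part (x%:C%C *: A) N.
Proof.
rewrite /expmx_part mulmx_suml mulmx_sumr; apply: eq_bigr => k _.
rewrite exprmxZ scalerA -scalemxAl -scalemxAr; congr (_ *: _).
by rewrite -[LHS]/(_ * _) -exprSr exprS.
Qed.

Lemma expM_A n (A : 'M[R[i]]_n) x : expM A A x = A *m expmx (x%:C%C *: A).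
Proof.
apply: mcvg_uniq (@mcvg_expM _ _ A A x) _.
apply: (@mcvg_ext _ _ _ (fun N => A *m expmx_part (x%:C%C *: A) N)).
  by move=> N; rewrite expmx_part_comm.
by apply: mcvgMl; exact: mcvg_expmx.
Qed.

Lemma mder_expmx n (A : 'M[R[i]]_n) x :
  is_mder (fun y => expmx (y%:C%C *: A)) x (A *m expmx (x%:C%C *: A)).
Proof.
apply: (mder_ext (F := expM A 1%:M)) => [y|]; first by rewrite expmxE.
by rewrite -expM_A; have := mder_expM A 1%:M x; rewrite mulmx1.
Qed.

Lemma mder_expmxN n (A : 'M[R[i]]_n) x :
  is_mder (fun y => expmx ((- y)%:C%C *: A)) x (- (A *m expmx ((- x)%:C%C *: A))).
Proof.
apply: (mder_ext (F := fun y => expmx (y%:C%C *: (- A)))) => [y|].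
  by rewrite scalerN -scaleNr rmorphN.
by apply: mder_eq (mder_expmx _ _) _; rewrite mulNmx scalerN -scaleNr -rmorphN.
Qed.

Lemma expmx0 n : expmx (0 : 'M[R[i]]_n) = 1%:M.
Proof.
apply: mcvg_uniq (mcvg_expmx 0) _ => i j.
have e : \forall N \near \oo, expmx_part (0 : 'M[R[i]]_n) N = 1%:M.
  exists 1%N => // -[//|N] _; rewrite /expmx_part big_nat_recl//.
  rewrite fact0 invr1 scale1r big1 ?addr0// => k _.
  by rewrite exprS mul0r scaler0.
split; apply: cvg_near_cst; apply: filterS e => N -> //.
Qed.

Lemma expmx_comm n (A : 'M[R[i]]_n) x :
  expmx (x%:C%C *: A) *m A = A *m expmx (x%:C%C *: A).
Proof.
(* Limits have been shown to commute with left multiplication; right multiplication follows by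
   taking adjoints before and after. *)
have h (f : nat -> 'M[R[i]]_n) L : mcvg f L -> mcvg (fun N => f N *m A) (L *m A).
  move=> hf i j.
  have := mcvgMl (A^t*) (mcvg_adj hf) => /mcvg_adj /(_ i j).
  have e (B C : 'M[R[i]]_n) : ((B^t*) *m (C^t*))^t* = C *m B.
    rewrite -map_mxM /= -trmx_mul map_trmx trmxK -map_mx_comp.
    by apply/matrixP => ? ?; rewrite mxE /= conjCK.
  by under eq_fun do rewrite e; under [X in _ /\ X @ _ --> _]eq_fun do rewrite e; rewrite e.
apply: mcvg_uniq (h _ _ (mcvg_expmx _)) _.
apply: mcvg_ext (mcvgMl A (mcvg_expmx (x%:C%C *: A))) => N.
by rewrite expmx_part_comm.
Qed.

Opaque expmx.

Lemma comm_cancel n q (A E : 'M[R[i]]_n) (F : 'M[R[i]]_(n, q)) :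
  E *m A = A *m E -> - (A *m E) *m F + E *m (A *m F) = 0.
Proof. by move=> <-; rewrite mulNmx -mulmxA addNr. Qed.

Lemma expmxNK n (A : 'M[R[i]]_n) x :
  expmx ((- x)%:C%C *: A) *m expmx (x%:C%C *: A) = 1%:M.
Proof.
have -> : 1%:M = expmx ((- 0)%:C%C *: A) *m expmx (0%:C%C *: A).
  by rewrite oppr0 scale0r expmx0 mulmx1.
apply: (@mder0_cst _ _ _ (fun x => expmx ((- x)%:C%C *: A) *m expmx (x%:C%C *: A))).
move=> t; apply: mder_eq (mderM (mder_expmxN A t) (mder_expmx A t)) _.
exact: comm_cancel (expmx_comm A (- t)).
Qed.

Lemma expmxKN n (A : 'M[R[i]]_n) x :
  expmx (x%:C%C *: A) *m expmx ((- x)%:C%C *: A) = 1%:M.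
Proof. by have := expmxNK A (- x); rewrite opprK. Qed.

Lemma expmx_unit n (A : 'M[R[i]]_n) x : expmx (x%:C%C *: A) \in unitmx.
Proof. exact: (mulmx1_unit (expmxKN A x)).1. Qed.

(** Uniqueness for Y' = A Y: the derivative of e^(-xA) Y vanishes. The addition formula and the
    block and diagonal forms of the exponential are then obtained by exhibiting a solution with the
    right initial value. *)
Lemma expmx_ode n q (A : 'M[R[i]]_n) (Y : R -> 'M[R[i]]_(n, q)) x :
  (forall t, is_mder Y t (A *m Y t)) -> Y x = expmx (x%:C%C *: A) *m Y 0.
Proof.
move=> hY.
have h : expmx ((- x)%:C%C *: A) *m Y x = expmx ((- 0)%:C%C *: A) *m Y 0.
  apply: (@mder0_cst _ _ _ (fun x => expmx ((- x)%:C%C *: A) *m Y x)) => t.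
  apply: mder_eq (mderM (mder_expmxN A t) (hY t)) _.
  exact: comm_cancel (expmx_comm A (- t)).
move: h; rewrite oppr0 scale0r expmx0 mul1mx => <-.
by rewrite mulmxA expmxKN mul1mx.
Qed.

Lemma expmxD n (A : 'M[R[i]]_n) x y :
  expmx ((x + y)%:C%C *: A) = expmx (x%:C%C *: A) *m expmx (y%:C%C *: A).
Proof.
have := @expmx_ode _ _ A (fun x => expmx ((x + y)%:C%C *: A)) x.
rewrite add0r; apply => t.
apply: (mder_ext (F := fun x => expmx ((1 * x + y)%:C%C *: A))) => [u|].
  by rewrite mul1r.
have := @mder_affine _ _ _ (fun x => expmx (x%:C%C *: A)) t _ 1 y (mder_expmx A _).
by rewrite mul1r scale1r.
Qed.

Lemma expmx_adj n (A : 'M[R[i]]_n) : (expmx A)^t* = expmx (A^t*).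
Proof.
apply: mcvg_uniq (mcvg_adj (mcvg_expmx A)) _.
apply: mcvg_ext (mcvg_expmx (A^t*)) => N.
rewrite /expmx_part raddf_sum /= raddf_sum /=; apply: eq_bigr => k _.
rewrite linearZ /= map_mxZ /= fmorphV rmorph_nat; congr (_ *: _).
elim: k => [|k ih]; first by rewrite !expr0 trmx1 map_mx1.
by rewrite exprSr ih exprS -[LHS]/(_ *m _) -map_mxM -trmx_mul.
Qed.

Lemma expmx_block n1 n2 (A : 'M[R[i]]_n1) (B : 'M[R[i]]_n2) x :
  expmx (x%:C%C *: block_mx A 0 0 B) =
  block_mx (expmx (x%:C%C *: A)) 0 0 (expmx (x%:C%C *: B)).
Proof.
have := @expmx_ode _ _ (block_mx A 0 0 B) (fun x =>
  col_mx (row_mx (expmx (x%:C%C *: A)) 0) (row_mx 0 (expmx (x%:C%C *: B)))) x.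
move=> h; rewrite [RHS]block_mxEv h.
  by rewrite !scale0r !expmx0 -block_mxEv -scalar_mx_block mulmx1.
move=> t; apply: mder_eq (mder_col_mx (mder_row_mx (mder_expmx _ _) (mder_cst 0 t))
  (mder_row_mx (mder_cst 0 t) (mder_expmx _ _))) _.
by rewrite -!block_mxEv mulmx_block !mulmx0 !mul0mx !addr0 !add0r.
Qed.

Lemma expmx_diag n (v : 'rV[R[i]]_n) :
  expmx (diag_mx v) = diag_mx (\row_j cexp (v ord0 j)).
Proof.
have := @expmx_ode _ _ (diag_mx v) (fun x => diag_mx (\row_j cexp (x%:C%C * v ord0 j))) 1.
rewrite scale1r => h.
have -> : \row_j cexp (v ord0 j) = \row_j cexp (1%:C%C * v ord0 j).
  by apply/rowP => j; rewrite !mxE mul1r.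
rewrite h; last first.
  move=> t i j; rewrite mulmx_diag [X in is_cder _ _ X]mxE.
  apply: (cder_ext (f := fun y => cexp (y%:C%C * v ord0 i) * (i == j)%:R)) => [y|].
    by rewrite !mxE mulr_natr; case: eqP => [->|].
  apply: cder_eq (cderZr _ (cder_cexp (cderZr _ (cder_id t)))) _.
  by rewrite mul1r mulr_natr !mxE; case: eqP => [->|].
rewrite (_ : \row_j _ = const_mx 1) ?diag_const_mx ?mulmx1//.
by apply/rowP => j; rewrite !mxE mul0r cexp0.
Qed.
End MatrixExponential.

(** * Integrals of complex and matrix functions *)

Section ComplexIntegral.
Context {R : realType}.
Local Notation mu := (@lebesgue_measure R).
Implicit Types (D : set R) (f g : R -> R[i]).

Definition rint D (h : R -> R) := mu.-integrable D (EFin \o h).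

Definition cintegrable D f :=
  rint D (fun x => complex.Re (f x)) /\ rint D (fun x => complex.Im (f x)).

Definition cint D f : R[i] :=
  Complex (\int[mu]_(x in D) complex.Re (f x)) (\int[mu]_(x in D) complex.Im (f x)).

Lemma mxintE q r D (F : R -> 'M[R[i]]_(q, r)) i j :
  mxint D F i j = cint D (fun x => F x i j).
Proof. by rewrite mxE. Qed.

Lemma rint_ext D h1 h2 : {in D, h1 =1 h2} -> rint D h1 -> measurable D -> rint D h2.
Proof.
move=> h12 hi mD; apply: eq_integrable hi => // x xD /=.
by rewrite h12.
Qed.

Lemma rintD D h1 h2 : measurable D -> rint D h1 -> rint D h2 ->
  rint D (fun x => h1 x + h2 x).
Proof.
by move=> mD i1 i2; have := @integrableD _ _ _ mu D mD _ _ i1 i2; apply: eq_integrable.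
Qed.

Lemma rintZ D (a : R) h : measurable D -> rint D h -> rint D (fun x => a * h x).
Proof.
by move=> mD hi; have := @integrableZl _ _ _ mu D mD a _ hi; apply: eq_integrable.
Qed.

Lemma rintB D h1 h2 : measurable D -> rint D h1 -> rint D h2 ->
  rint D (fun x => h1 x - h2 x).
Proof.
by move=> mD i1 i2; have := @integrableB _ _ _ mu D mD _ _ i1 i2; apply: eq_integrable.
Qed.

Lemma rint0 D : rint D (fun=> 0).
Proof. exact: integrable0. Qed.

Lemma cintegrable_ext D f g : measurable D -> {in D, f =1 g} ->
  cintegrable D f -> cintegrable D g.
Proof.
by move=> mD fg [i1 i2]; split; [apply: rint_ext i1 mD|apply: rint_ext i2 mD] => x xD;
  rewrite fg.
Qed.

Lemma cintegrableD D f g : measurable D -> cintegrable D f -> cintegrable D g ->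
  cintegrable D (fun x => f x + g x).
Proof.
move=> mD [f1 f2] [g1 g2]; split.
- by apply: rint_ext (rintD mD f1 g1) mD => x _; rewrite ReD.
- by apply: rint_ext (rintD mD f2 g2) mD => x _; rewrite ImD.
Qed.

Lemma cintegrableZ D (a : R[i]) f : measurable D -> cintegrable D f ->
  cintegrable D (fun x => a * f x).
Proof.
move=> mD [f1 f2]; split.
- by apply: rint_ext (rintB mD (rintZ (complex.Re a) mD f1) (rintZ (complex.Im a) mD f2)) mD => x _; rewrite ReM.
- by apply: rint_ext (rintD mD (rintZ (complex.Re a) mD f2) (rintZ (complex.Im a) mD f1)) mD => x _; rewrite ImM.
Qed.

Lemma cintegrable0 D : cintegrable D (fun=> 0).
Proof. by split; exact: rint0. Qed.

Lemma cintegrable_sum D (I : Type) (s : seq I) (P : pred I) (F : I -> R -> R[i]) :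
  measurable D -> (forall i, P i -> cintegrable D (F i)) ->
  cintegrable D (fun x => \sum_(i <- s | P i) F i x).
Proof.
move=> mD h; elim: s => [|i s ih].
  by apply: cintegrable_ext (cintegrable0 D) => // x _; rewrite big_nil.
case Pi : (P i).
  by apply: cintegrable_ext (cintegrableD mD (h _ Pi) ih) => // x _; rewrite big_cons Pi.
by apply: cintegrable_ext ih => // x _; rewrite big_cons Pi.
Qed.

Lemma cint_ext D f g : {in D, f =1 g} -> cint D f = cint D g.
Proof.
by move=> fg; rewrite /cint; congr Complex; apply: eq_Rintegral => x xD; rewrite fg.
Qed.

Lemma cintD D f g : measurable D -> cintegrable D f -> cintegrable D g ->
  cint D (fun x => f x + g x) = cint D f + cint D g.
Proof.
move=> mD [f1 f2] [g1 g2]; apply: complex_ext; rewrite ReImE /cint /=.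
- by rewrite -RintegralD//; apply: eq_Rintegral => x _; rewrite ReD.
- by rewrite -RintegralD//; apply: eq_Rintegral => x _; rewrite ImD.
Qed.

Lemma cintZ D (a : R[i]) f : measurable D -> cintegrable D f ->
  cint D (fun x => a * f x) = a * cint D f.
Proof.
move=> mD [f1 f2]; apply: complex_ext.
- rewrite ReM /cint /= -!RintegralZl// -RintegralB//; try exact: rintZ.
  by apply: eq_Rintegral => x _; rewrite ReM.
- rewrite ImM /cint /= -!RintegralZl// -RintegralD//; try exact: rintZ.
  by apply: eq_Rintegral => x _; rewrite ImM.
Qed.

Lemma cint0 D : cint D (fun=> 0) = 0.
Proof. by rewrite /cint /Rintegral /= integral0. Qed.

Lemma cint_sum D (I : Type) (s : seq I) (P : pred I) (F : I -> R -> R[i]) :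
  measurable D -> (forall i, P i -> cintegrable D (F i)) ->
  cint D (fun x => \sum_(i <- s | P i) F i x) = \sum_(i <- s | P i) cint D (F i).
Proof.
move=> mD h; elim: s => [|i s ih].
  by rewrite big_nil -[RHS](cint0 D); apply: cint_ext => x _; rewrite big_nil.
rewrite big_cons -ih; case Pi : (P i); last first.
  by apply: cint_ext => x _; rewrite big_cons Pi.
rewrite -cintD//; [|exact: h|exact: cintegrable_sum].
by apply: cint_ext => x _; rewrite big_cons Pi.
Qed.

Lemma mxint_ext q r D (F G : R -> 'M[R[i]]_(q, r)) :
  {in D, F =1 G} -> mxint D F = mxint D G.
Proof.
by move=> FG; apply/matrixP => i j; rewrite !mxintE; apply: cint_ext => x xD; rewrite FG.
Qed.

Lemma mx_integrable_ext q r D (F G : R -> 'M[R[i]]_(q, r)) : measurable D ->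
  {in D, F =1 G} -> mx_integrable D F -> mx_integrable D G.
Proof.
move=> mD FG h i j.
by apply: (cintegrable_ext mD _ (h i j : cintegrable D (fun x => F x i j))) => x xD; rewrite FG.
Qed.

Lemma mx_integrableMl q r s D (A : 'M[R[i]]_(q, r)) (F : R -> 'M[R[i]]_(r, s)) :
  measurable D -> mx_integrable D F -> mx_integrable D (fun x => A *m F x).
Proof.
move=> mD hF i j.
apply: (cintegrable_ext (f := fun x => \sum_k A i k * F x k j) mD).
  by move=> x _; rewrite mxE.
by apply: cintegrable_sum => // k _; apply: cintegrableZ => //; exact: hF.
Qed.

Lemma mx_integrableMr q r s D (A : 'M[R[i]]_(r, s)) (F : R -> 'M[R[i]]_(q, r)) :
  measurable D -> mx_integrable D F -> mx_integrable D (fun x => F x *m A).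
Proof.
move=> mD hF i j.
apply: (cintegrable_ext (f := fun x => \sum_k A k j * F x i k) mD).
  by move=> x _; rewrite mxE; apply: eq_bigr => k _; rewrite mulrC.
by apply: cintegrable_sum => // k _; apply: cintegrableZ => //; exact: hF.
Qed.

Lemma mxintD q r D (F G : R -> 'M[R[i]]_(q, r)) : measurable D ->
  mx_integrable D F -> mx_integrable D G ->
  mxint D (fun x => F x + G x) = mxint D F + mxint D G.
Proof.
move=> mD hF hG; apply/matrixP => i j; rewrite [in RHS]mxE !mxintE -cintD//; [|exact: hF|exact: hG].
by apply: cint_ext => x _; rewrite mxE.
Qed.

Lemma mxintZ q r D (a : R[i]) (F : R -> 'M[R[i]]_(q, r)) : measurable D ->
  mx_integrable D F -> mxint D (fun x => a *: F x) = a *: mxint D F.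
Proof.
move=> mD hF; apply/matrixP => i j; rewrite [in RHS]mxE !mxintE -cintZ//; last exact: hF.
by apply: cint_ext => x _; rewrite mxE.
Qed.

Lemma mxintMl q r s D (A : 'M[R[i]]_(q, r)) (F : R -> 'M[R[i]]_(r, s)) :
  measurable D -> mx_integrable D F -> mxint D (fun x => A *m F x) = A *m mxint D F.
Proof.
move=> mD hF; apply/matrixP => i j; rewrite [in RHS]mxE !mxintE.
transitivity (\sum_k cint D (fun x => A i k * F x k j)); last first.
  by apply: eq_bigr => k _; rewrite mxintE cintZ//; exact: hF.
rewrite -cint_sum//; first by apply: cint_ext => x _; rewrite mxE.
by move=> k _; apply: cintegrableZ => //; exact: hF.
Qed.

Lemma mxintMr q r s D (A : 'M[R[i]]_(r, s)) (F : R -> 'M[R[i]]_(q, r)) :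
  measurable D -> mx_integrable D F -> mxint D (fun x => F x *m A) = mxint D F *m A.
Proof.
move=> mD hF; apply/matrixP => i j; rewrite [in RHS]mxE !mxintE.
transitivity (\sum_k cint D (fun x => A k j * F x i k)); last first.
  by apply: eq_bigr => k _; rewrite mxintE mulrC cintZ//; exact: hF.
rewrite -cint_sum//.
  by apply: cint_ext => x _; rewrite mxE; apply: eq_bigr => k _; rewrite mulrC.
by move=> k _; apply: cintegrableZ => //; exact: hF.
Qed.

Lemma rint_cont (a b : R) (h : R -> R) :
  (forall x, a <= x <= b -> {for x, continuous h}) -> rint `[a, b] h.
Proof.
move=> ch; apply: continuous_compact_integrable; first exact: segment_compact.
apply: continuous_in_subspaceT => x; rewrite inE /= in_itv /=; exact: ch.
Qed.

Lemma cintegrable_cont (a b : R) f :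
  (forall x, a <= x <= b -> ccont f x) -> cintegrable `[a, b] f.
Proof. by move=> cf; split; apply: rint_cont => x xab; case: (cf x xab). Qed.

Lemma fine_mu_itv (a b : R) : a <= b -> fine (mu `[a, b]) = b - a.
Proof.
move=> ab; rewrite lebesgue_measure_itv /= lte_fin.
by move: ab; rewrite le_eqVlt => /predU1P[->|->//]; rewrite ltxx subrr.
Qed.

Lemma rint_bound (a b M : R) (h : R -> R) : a <= b -> rint `[a, b] h ->
  (forall x, a <= x <= b -> `|h x| <= M) ->
  `|\int[mu]_(x in `[a, b]) h x| <= M * (b - a).
Proof.
move=> ab hi hM; have mI : measurable (`[a, b] : set R) by exact: measurable_itv.
apply: le_trans (@le_normr_Rintegral _ _ _ mu _ _ mI hi) _.
have cM : rint `[a, b] (fun=> M) by apply: rint_cont => x _; exact: cst_continuous.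
apply: (@le_trans _ _ (\int[mu]_(x in `[a, b]) M)).
  by apply: le_Rintegral => //; exact: integrable_norm hi.
by rewrite Rintegral_cst// -[X in _ <= _ * X](fine_mu_itv ab).
Qed.

Lemma cint_bound (a b M : R) f : a <= b -> cintegrable `[a, b] f ->
  (forall x, a <= x <= b -> c1 (f x) <= M) ->
  c1 (cint `[a, b] f) <= 2 * M * (b - a).
Proof.
move=> ab [f1 f2] hM.
have h1 := rint_bound ab f1 (fun x xab => le_trans (c1_Re _) (hM x xab)).
have h2 := rint_bound ab f2 (fun x xab => le_trans (c1_Im _) (hM x xab)).
rewrite /c1 /cint /=; lra.
Qed.

Lemma rint_FTC (a b : R) (h dh : R -> R) : a <= b ->
  (forall x, a <= x <= b -> is_derive x 1 h (dh x)) ->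
  (forall x, a <= x <= b -> {for x, continuous dh}) ->
  \int[mu]_(x in `[a, b]) dh x = h b - h a.
Proof.
rewrite le_eqVlt => /predU1P[-> _ _|ab hd cd].
  by rewrite set_itv1 Rintegral_set1 subrr.
rewrite /Rintegral (@continuous_FTC2 R dh h a b ab) //.
- by apply: continuous_in_subspaceT => x; rewrite inE /= in_itv /=; exact: cd.
- split.
  + move=> x; rewrite in_itv /= => /andP[ax xb].
    by have [] := hd x; rewrite ?(ltW ax) ?(ltW xb).
  + apply: cvg_at_right_filter; apply: is_derive_continuous (hd a _).
    by rewrite lexx ltW.
  + apply: cvg_at_left_filter; apply: is_derive_continuous (hd b _).
    by rewrite lexx ltW.
- move=> x; rewrite in_itv /= => /andP[ax xb]; rewrite derive1E.
  by have [_ ->] := hd x (introT andP (conj (ltW ax) (ltW xb))).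
Qed.

Lemma cint_FTC (a b : R) f (df : R -> R[i]) : a <= b ->
  (forall x, a <= x <= b -> is_cder f x (df x)) ->
  (forall x, a <= x <= b -> ccont df x) ->
  cint `[a, b] df = f b - f a.
Proof.
move=> ab hd cd; apply: complex_ext; rewrite !ReImE /cint /=.
- by apply: (rint_FTC (h := fun x => complex.Re (f x))) => // x xab; [case: (hd x xab)|case: (cd x xab)].
- by apply: (rint_FTC (h := fun x => complex.Im (f x))) => // x xab; [case: (hd x xab)|case: (cd x xab)].
Qed.

Lemma mxint_FTC q r (a b : R) (F DF : R -> 'M[R[i]]_(q, r)) : a <= b ->
  (forall x, a <= x <= b -> is_mder F x (DF x)) ->
  (forall x, a <= x <= b -> mcont DF x) ->
  mxint `[a, b] DF = F b - F a.
Proof.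
move=> ab hd cd; apply/matrixP => i j; rewrite mxintE !mxE.
apply: (cint_FTC (f := fun x => F x i j)) => // x xab; first exact: hd.
exact: cd.
Qed.

(** A constant can dominate because x ranges over a compact interval. [M] comes without a sign, so
    its absolute value is taken as the dominating function. *)
Lemma rder_under_integral (u v y0 a b M : R) (h dh : R -> R -> R) :
  u < y0 < v ->
  (forall y, u < y < v -> rint `[a, b] (h y)) ->
  (forall y x, u < y < v -> a <= x <= b -> is_derive y 1 (h ^~ x) (dh y x)) ->
  (forall y x, u < y < v -> a <= x <= b -> `|dh y x| <= M) ->
  is_derive y0 1 (fun y => \int[mu]_(x in `[a, b]) h y x)
    (\int[mu]_(x in `[a, b]) dh y0 x).
Proof.
move=> uyv hi hd hM.
have mI : measurable (`[a, b] : set R) by exact: measurable_itv.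
have y0I : [set` `]u, v[] y0 by rewrite /= in_itv.
have M1 : 0 <= `|M| by [].
have di y x : [set` `]u, v[] y -> [set` `[a, b]] x -> derivable (h ^~ x) y 1.
  by rewrite /= !in_itv /= => yI xI; case: (hd y x yI xI).
have i1 y : [set` `]u, v[] y -> mu.-integrable `[a, b] (EFin \o h y).
  by rewrite /= in_itv; exact: hi.
have iM : mu.-integrable `[a, b] (EFin \o (fun=> `|M|)).
  by apply: rint_cont => x _; exact: cst_continuous.
have ub y x : [set` `]u, v[] y -> [set` `[a, b]] x ->
    `|partial1of2 h y x| <= `|M|.
  rewrite /= !in_itv /= => yI xI; rewrite partial1of2E.
  by have [_ ->] := hd y x yI xI; apply: le_trans (hM y x yI xI) (ler_norm _).
have D := @derivable_under_integral R _ _ mu h _ mI y0 u v y0I i1 di (fun=> `|M|) (fun=> M1) iM ub.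
have E := @differentiation_under_integral R _ _ mu h _ mI y0 u v y0I i1 di (fun=> `|M|) (fun=> M1) iM ub.
apply: DeriveDef => //; rewrite -derive1E E; apply: eq_Rintegral => x.
rewrite inE /= in_itv /= => xI; rewrite partial1of2E.
by have [_ ->] := hd y0 x uyv xI.
Qed.

Lemma cder_under_integral (u v y0 a b M : R) (f df : R -> R -> R[i]) :
  u < y0 < v ->
  (forall y, u < y < v -> cintegrable `[a, b] (f y)) ->
  (forall y x, u < y < v -> a <= x <= b -> is_cder (f ^~ x) y (df y x)) ->
  (forall y x, u < y < v -> a <= x <= b -> c1 (df y x) <= M) ->
  is_cder (fun y => cint `[a, b] (f y)) y0 (cint `[a, b] (df y0)).
Proof.
move=> uyv hi hd hM; split.
- apply: (@rder_under_integral u v y0 a b M (fun y x => complex.Re (f y x))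
    (fun y x => complex.Re (df y x))) => //.
  + by move=> y yI; case: (hi y yI).
  + by move=> y x yI xI; case: (hd y x yI xI).
  + by move=> y x yI xI; apply: le_trans (c1_Re _) (hM y x yI xI).
- apply: (@rder_under_integral u v y0 a b M (fun y x => complex.Im (f y x))
    (fun y x => complex.Im (df y x))) => //.
  + by move=> y yI; case: (hi y yI).
  + by move=> y x yI xI; case: (hd y x yI xI).
  + by move=> y x yI xI; apply: le_trans (c1_Im _) (hM y x yI xI).
Qed.
End ComplexIntegral.

(** * Cauchy's theorem on rectangles *)

Section CauchyTheorem.
Context {R : realType}.
Implicit Types (h : R[i] -> R[i]) (lam w p : R[i]) (a eta rho : R).

(* Complex differentiability, tested along every real line so that it composes
   with the calculus of one real variable. *)
Definition holo h lam (z : R[i]) := forall p w (s : R), p + s%:C%C * w = lam ->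
  is_cder (fun s => h (p + s%:C%C * w)) s (w * z).

Lemma cder_line p w (s : R) : is_cder (fun s => p + s%:C%C * w) s w.
Proof.
apply: cder_eq (cderD (cder_cst p s) (cderZr w (cder_id s))) _.
by rewrite mul1r add0r.
Qed.

Lemma holo_ext h k lam z : h =1 k -> holo h lam z -> holo k lam z.
Proof. by move=> /funext ->. Qed.

Lemma holo_cst (z : R[i]) lam : holo (fun=> z) lam 0.
Proof. by move=> p w s _; rewrite mulr0; exact: cder_cst. Qed.

Lemma holo_inv (mu : R[i]) lam : lam - mu != 0 ->
  holo (fun l => (l - mu)^-1) lam (- ((lam - mu)^-1 * (lam - mu)^-1)).
Proof.
move=> h p w s e.
have d : is_cder (fun s => p + s%:C%C * w - mu) s w.
  by apply: cder_eq (cderB (cder_line p w s) (cder_cst mu s)) _; rewrite subr0.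
apply: cder_eq (cderV _ d) _; rewrite e//.
by rewrite expr2 invfM mulrN mulNr.
Qed.

Lemma holo_cexp (b : R[i]) lam : holo (fun l => cexp (b * l)) lam (b * cexp (b * lam)).
Proof.
move=> p w s e; apply: cder_eq (cder_cexp (cderZl b (cder_line p w s))) _.
by rewrite e; ring.
Qed.

Lemma holoM h1 h2 lam z1 z2 : holo h1 lam z1 -> holo h2 lam z2 ->
  holo (fun l => h1 l * h2 l) lam (z1 * h2 lam + h1 lam * z2).
Proof.
move=> d1 d2 p w s e; apply: cder_eq (cderM (d1 p w s e) (d2 p w s e)) _.
by rewrite e; ring.
Qed.

Lemma holoD h1 h2 lam z1 z2 : holo h1 lam z1 -> holo h2 lam z2 ->
  holo (fun l => h1 l + h2 l) lam (z1 + z2).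
Proof.
move=> d1 d2 p w s e; apply: cder_eq (cderD (d1 p w s e) (d2 p w s e)) _.
by rewrite mulrDr.
Qed.

(* The bounds on [h] and [h'] give the domination needed to differentiate line
   integrals with respect to the height of the line. *)
Definition tame rho h := exists h' : R[i] -> R[i], exists2 K : R, 0 <= K &
  forall lam, complex.Im lam < rho ->
    [/\ holo h lam (h' lam), c1 (h lam) <= K, c1 (h' lam) <= K &
        exists z, holo h' lam z].

Lemma tame_ext rho h k : h =1 k -> tame rho h -> tame rho k.
Proof. by move=> /funext ->. Qed.

Lemma tame_cst rho (z : R[i]) : tame rho (fun=> z).
Proof.
exists (fun=> 0), (c1 z); first exact: c1_ge0.
move=> lam _; split; rewrite ?c10 ?c1_ge0//; first exact: holo_cst.
by exists 0; exact: holo_cst.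
Qed.

Lemma tameM rho h1 h2 : tame rho h1 -> tame rho h2 -> tame rho (fun l => h1 l * h2 l).
Proof.
move=> [d1 [K1 K1p H1]] [d2 [K2 K2p H2]].
exists (fun l => d1 l * h2 l + h1 l * d2 l), (2 * (K1 * K2)).
  by rewrite !mulr_ge0.
move=> lam lr; have [a1 b1 e1 [z1 f1]] := H1 lam lr; have [a2 b2 e2 [z2 f2]] := H2 lam lr.
have M : forall x y, c1 x <= K1 -> c1 y <= K2 -> c1 (x * y) <= K1 * K2.
  by move=> x y hx hy; apply: le_trans (c1M _ _) _; apply: ler_pM => //; exact: c1_ge0.
split.
- exact: holoM.
- apply: le_trans (M _ _ b1 b2) _; have := mulr_ge0 K1p K2p; lra.
- apply: le_trans (c1D _ _) _.
  by have := M _ _ e1 b2; have := M _ _ b1 e2; lra.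
- by eexists; apply: holoD; apply: holoM; eassumption.
Qed.

Lemma c1_sub_ge (mu lam : R[i]) : complex.Im mu - complex.Im lam <= c1 (lam - mu).
Proof.
by apply: le_trans (c1_Im _); rewrite !ReImE distrC ler_norm.
Qed.

Lemma tame_inv rho (mu : R[i]) : rho < complex.Im mu -> tame rho (fun l => (l - mu)^-1).
Proof.
move=> mr; set e := complex.Im mu - rho; have e0 : 0 < e by rewrite subr_gt0.
have b lam : complex.Im lam < rho -> c1 (lam - mu)^-1 <= 2 / e.
  move=> lr; apply: le_trans (c1V _) _; rewrite ler_wpM2l// lef_pV2 ?posrE//.
    by apply: le_trans (c1_sub_ge _ _); rewrite /e; lra.
  by apply: lt_le_trans (c1_sub_ge _ _); rewrite subr_gt0 (lt_trans lr).
have n lam : complex.Im lam < rho -> lam - mu != 0.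
  move=> lr; apply/eqP => z; have := c1_sub_ge mu lam.
  by rewrite z c10 => h; lra.
exists (fun lam => - ((lam - mu)^-1 * (lam - mu)^-1)), (2 / e + (2 / e) ^+ 2).
  by rewrite addr_ge0 ?sqr_ge0// divr_ge0// ltW.
move=> lam lr; split.
- exact: holo_inv (n _ lr).
- by apply: le_trans (b _ lr) _; rewrite lerDl sqr_ge0.
- rewrite c1N; apply: le_trans (c1M _ _) _; rewrite -expr2.
  apply: (@le_trans _ _ ((2 / e) ^+ 2)); last by rewrite lerDr divr_ge0// ltW.
  by rewrite lerXn2r ?nnegrE ?c1_ge0 ?b// divr_ge0// ltW.
- have d := holo_inv (n _ lr); have := holoM (@holo_cst (-1) lam) (holoM d d).
  by move=> d2; eexists; apply: holo_ext d2 => l; rewrite mulN1r.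
Qed.

Lemma tame_cexp rho (t : R) : rho <= 0 -> t <= 0 ->
  tame rho (fun l => cexp (ii * t%:C%C * l)).
Proof.
move=> r0 t0.
have b lam : complex.Im lam < rho -> c1 (cexp (ii * t%:C%C * lam)) <= 2.
  move=> lr; apply: le_trans (c1_cexp _) _.
  rewrite -[leRHS]mulr1 ler_wpM2l// -[X in _ <= X]expR0 ler_expR !ReImE.
  have : 0 <= t * complex.Im lam by rewrite mulr_le0// ltW// (lt_le_trans lr).
  by lra.
exists (fun l => ii * t%:C%C * cexp (ii * t%:C%C * l)), (2 + 2 * c1 (ii * t%:C%C)).
  by rewrite addr_ge0// mulr_ge0// c1_ge0.
move=> lam lr; split.
- exact: holo_cexp.
- by apply: le_trans (b _ lr) _; rewrite lerDl mulr_ge0// c1_ge0.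
- apply: le_trans (c1M _ _) _; apply: (@le_trans _ _ (2 * c1 (ii * t%:C%C))).
    by rewrite mulrC ler_wpM2r ?c1_ge0 ?b.
  by rewrite lerDr.
- have d := holoM (@holo_cst (ii * t%:C%C) lam) (@holo_cexp (ii * t%:C%C) lam).
  by eexists; exact: d.
Qed.

Lemma tame_prod rho (s : seq R[i]) : (forall mu, mu \in s -> rho < complex.Im mu) ->
  tame rho (fun l => \prod_(mu <- s) (l - mu)^-1).
Proof.
elim: s => [|mu s ih] h.
  by apply: tame_ext (tame_cst rho 1) => l; rewrite big_nil.
apply: tame_ext (tameM (tame_inv (h mu (mem_head _ _))) (ih _)) => [l|nu nus].
  by rewrite big_cons.
by apply: h; rewrite inE nus orbT.
Qed.

(** Quadratic decay is what Cauchy's theorem needs: the sides and the base of a rectangle of size a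
    have length O(a), so they contribute O(1 / a). *)
Definition decays h (D A : R) := [/\ 0 <= D, 1 <= A &
  forall lam, A <= c1 lam -> complex.Im lam <= 0 -> c1 (h lam) <= D / c1 lam ^+ 2].

Lemma decay_prod_size (s : seq R[i]) : exists2 A : R, 1 <= A &
  forall lam, A <= c1 lam ->
  c1 (\prod_(mu <- s) (lam - mu)^-1) <= (4 / c1 lam) ^+ size s.
Proof.
elim: s => [|mu s [A A1 ih]].
  by exists 1 => // lam _; rewrite big_nil c1_1.
exists (A + 2 * c1 mu) => [|lam lA].
  by rewrite (le_trans A1)// lerDl mulr_ge0// c1_ge0.
have m0 := c1_ge0 mu.
have l1 : 0 < c1 lam by lra.
(* Since c1 lam is at least 2 c1 mu, the difference keeps half of c1 lam; with the factor 2 of [c1V]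
   this accounts for the 4. *)
have l2 : c1 lam / 2 <= c1 (lam - mu).
  have := c1D (lam - mu) mu; rewrite subrK; lra.
rewrite big_cons exprS; apply: le_trans (c1M _ _) _.
apply: ler_pM; rewrite ?c1_ge0//; last by apply: ih; lra.
apply: le_trans (c1V _) _; rewrite ler_pdivrMr; last by lra.
by rewrite mulrAC ler_pdivlMr//; lra.
Qed.

Lemma decay_prod (s : seq R[i]) : (2 <= size s)%N ->
  exists D A, decays (fun l => \prod_(mu <- s) (l - mu)^-1) D A.
Proof.
move=> s2; have [A A1 h] := decay_prod_size s.
exists 16, (A + 4); split => [//||lam lA _]; first lra.
apply: le_trans (h lam _) _; first lra.
have x0 : 0 < c1 lam by lra.
have x4 : 4 / c1 lam <= 1 by rewrite ler_pdivrMr//; lra.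
apply: (@le_trans _ _ ((4 / c1 lam) ^+ 2)).
  by apply: ler_wiXn2l => //; rewrite divr_ge0// ltW.
by rewrite expr_div_n; rewrite ler_wpM2r ?invr_ge0 ?exprn_ge0 ?c1_ge0//; lra.
Qed.

Lemma decays_cexpM (t : R) h D A : t <= 0 -> decays h D A ->
  decays (fun l => cexp (ii * t%:C%C * l) * h l) (2 * D) A.
Proof.
move=> t0 [D0 A1 H]; split => // [|lam lA l0]; first lra.
have -> : 2 * D / c1 lam ^+ 2 = 2 * (D / c1 lam ^+ 2) by rewrite mulrA.
apply: le_trans (c1M _ _) _; apply: ler_pM; rewrite ?c1_ge0 ?H//.
apply: le_trans (c1_cexp _) _.
rewrite -[leRHS]mulr1 ler_wpM2l// -[X in _ <= X]expR0 ler_expR !ReImE.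
have : 0 <= t * complex.Im lam by rewrite mulr_le0.
by lra.
Qed.

Definition line_int h a eta := cint `[- a, a] (fun xi => h (Complex xi eta)).

Lemma ComplexE_re (xi eta : R) : Complex 0 eta + xi%:C%C * 1 = Complex xi eta.
Proof. by rewrite mulr1; apply: complex_ext; rewrite !ReImE /= ?add0r ?addr0. Qed.

Lemma ComplexE_im (xi eta : R) : xi%:C%C + eta%:C%C * ii = Complex xi eta.
Proof. by apply: complex_ext; rewrite !ReImE; ring. Qed.

Lemma holo_re h z (xi eta : R) : holo h (Complex xi eta) z ->
  is_cder (fun xi => h (Complex xi eta)) xi z.
Proof.
move=> H; have := H (Complex 0 eta) 1 xi (ComplexE_re xi eta); rewrite mul1r.
by apply: cder_ext => s; rewrite ComplexE_re.
Qed.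

Lemma holo_im h z (xi eta : R) : holo h (Complex xi eta) z ->
  is_cder (fun eta => h (Complex xi eta)) eta (ii * z).
Proof.
move=> H; have := H xi%:C%C ii eta (ComplexE_im xi eta).
by apply: cder_ext => s; rewrite ComplexE_im.
Qed.

(** The derivative in eta is the integral of i h' along the segment, and h' is also the derivative
    along the segment, so only the end values remain. This is Cauchy's theorem in infinitesimal
    form: lowering the line costs only the two vertical sides. *)
Lemma cder_line_int rho h a eta : tame rho h -> 0 <= a -> eta < rho ->
  is_cder (line_int h a) eta (ii * (h (Complex a eta) - h (Complex (- a) eta))).
Proof.
move=> [h' [K K0 H]] a0 er.
have c e xi : e < rho -> ccont (fun xi => h (Complex xi e)) xi.
  by move=> e1; have [d _ _ _] := H (Complex xi e) e1; exact: cder_ccont (holo_re d).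
have c' xi : ccont (fun xi => h' (Complex xi eta)) xi.
  by have [_ _ _ [z d]] := H (Complex xi eta) er; exact: cder_ccont (holo_re d).
have aa : - a <= a by lra.
apply: cder_eq (@cder_under_integral _ (eta - 1) rho eta (- a) a K
  (fun e xi => h (Complex xi e)) (fun e xi => ii * h' (Complex xi e)) _ _ _ _) _.
- by rewrite er andbT; lra.
- by move=> e /andP[_ e1]; apply: cintegrable_cont => xi _; exact: c.
- move=> e xi /andP[_ e1] _; have [d _ _ _] := H (Complex xi e) e1.
  exact: holo_im.
- move=> e xi /andP[_ e1] _; have [_ _ b _] := H (Complex xi e) e1.
  by apply: le_trans (c1M _ _) _; rewrite c1_i mul1r.
- rewrite cintZ//; last by apply: cintegrable_cont => xi _; exact: c'.
  rewrite (cint_FTC (f := fun xi => h (Complex xi eta)))//.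
  by move=> xi _; have [d _ _ _] := H (Complex xi eta) er; exact: holo_re.
Qed.

(* Cauchy's theorem on the rectangle with vertices [+-a + i eta], [+-a - i a]. *)
Lemma line_int_decay rho h D A a eta : tame rho h -> decays h D A ->
  eta < rho -> eta <= 0 -> - eta <= a -> A <= a ->
  c1 (line_int h a eta) <= 8 * D / a.
Proof.
move=> th [D0 A1 H] er e0 ea Aa.
have a0 : 0 < a by lra.
have side e xi : `|xi| = a -> e <= 0 -> c1 (h (Complex xi e)) <= D / a ^+ 2.
  move=> xa e1; have x1 : a <= c1 (Complex xi e) by rewrite /c1 /= xa lerDl.
  apply: le_trans (H _ _ _) _ => //; first exact: le_trans Aa x1.
  rewrite ler_wpM2l// lef_pV2 ?posrE ?exprn_gt0//; last exact: lt_le_trans x1.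
  by rewrite lerXn2r ?nnegrE ?c1_ge0 ?(ltW a0).
have na : `|- a| = a by rewrite normrN gtr0_norm.
have pa : `|a| = a by rewrite gtr0_norm.
have h1 : c1 (line_int h a eta - line_int h a (- a)) <=
    2 * (2 * (D / a ^+ 2)) * (eta - - a).
  apply: (@cder_bound _ _ (fun e => ii * (h (Complex a e) - h (Complex (- a) e)))).
  - by lra.
  - by move=> e /andP[_ e1]; apply: cder_line_int th _ _; lra.
  - move=> e /andP[_ e1]; apply: le_trans (c1M _ _) _; rewrite c1_i mul1r.
    apply: le_trans (c1B _ _) _.
    by have := side e a pa (le_trans e1 e0); have := side e (- a) na (le_trans e1 e0); lra.
have h2 : c1 (line_int h a (- a)) <= 2 * (D / a ^+ 2) * (a - - a).
  apply: cint_bound; first lra.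
    apply: cintegrable_cont => xi _; case: th => h' [K K0 th].
    by have [|d _ _ _] := th (Complex xi (- a)); [rewrite /=; lra|exact: cder_ccont (holo_re d)].
  move=> xi _; have x1 : a <= c1 (Complex xi (- a)) by rewrite /c1 /= na lerDr.
  apply: le_trans (H _ _ _) _; [exact: le_trans Aa x1|by rewrite /=; lra|].
  rewrite ler_wpM2l// lef_pV2 ?posrE ?exprn_gt0//; last exact: lt_le_trans x1.
  by rewrite lerXn2r ?nnegrE ?c1_ge0 ?(ltW a0).
(* The vertical sides give at most 4 D / a because eta + a is at most a; the base, of length 2 a,
   gives another 4 D / a. *)
have h3 := c1D (line_int h a eta - line_int h a (- a)) (line_int h a (- a)).
rewrite subrK in h3; apply: le_trans h3 _.
have d0 : 0 <= D / a ^+ 2 by rewrite divr_ge0// exprn_ge0// ltW.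
have -> : 8 * D / a = 8 * (D / a ^+ 2) * a by field; rewrite gt_eqF.
by nra.
Qed.
End CauchyTheorem.

(** * The scalar integral of e^(i lambda t) lambda^-2 over a horizontal line *)

Section ScalarFourier.
Context {R : realType}.
Implicit Types (a c t y eta xi T : R) (q : R -> R[i]).

Definition Fint eta q a y :=
  cint `[- a, a] (fun xi => cexp (ii * y%:C%C * Complex xi eta) * q xi).

Lemma cder_Complex eta xi : is_cder (fun xi => Complex xi eta) xi 1.
Proof.
have := cder_line (Complex 0 eta) 1 xi.
by apply: cder_ext => s; rewrite ComplexE_re.
Qed.

Lemma ccont_Fint eta q y xi : ccont q xi ->
  ccont (fun xi => cexp (ii * y%:C%C * Complex xi eta) * q xi) xi.
Proof.
move=> cq; apply: ccontM cq.
exact: cder_ccont (cder_cexp (cderZl _ (cder_Complex eta xi))).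
Qed.

Lemma cintegrable_Fint eta q a y : (forall xi, ccont q xi) ->
  cintegrable `[- a, a] (fun xi => cexp (ii * y%:C%C * Complex xi eta) * q xi).
Proof. by move=> cq; apply: cintegrable_cont => xi _; exact: ccont_Fint. Qed.

Lemma FintD eta q1 q2 a y : (forall xi, ccont q1 xi) -> (forall xi, ccont q2 xi) ->
  Fint eta (fun xi => q1 xi + q2 xi) a y = Fint eta q1 a y + Fint eta q2 a y.
Proof.
move=> h1 h2; rewrite /Fint -cintD//; try exact: cintegrable_Fint.
by apply: cint_ext => xi _; rewrite mulrDr.
Qed.

Lemma FintZ eta q (b : R[i]) a y : (forall xi, ccont q xi) ->
  Fint eta (fun xi => b * q xi) a y = b * Fint eta q a y.
Proof.
move=> h; rewrite /Fint -cintZ//; last exact: cintegrable_Fint.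
by apply: cint_ext => xi _; rewrite mulrCA.
Qed.

Lemma eq_Fint eta q1 q2 a y : q1 =1 q2 -> Fint eta q1 a y = Fint eta q2 a y.
Proof. by move=> /funext ->. Qed.

Lemma Fint_der eta q a y K : 0 <= a -> (forall xi, ccont q xi) ->
  (forall xi, c1 (q xi) <= K) ->
  is_cder (Fint eta q a) y (Fint eta (fun xi => ii * Complex xi eta * q xi) a y).
Proof.
move=> a0 cq qK.
have K0 : 0 <= K := le_trans (c1_ge0 (q 0)) (qK 0).
apply: (@cder_under_integral _ (y - 1) (y + 1) y (- a) a
  ((a + `|eta|) * K * (2 * expR (`|eta| * (`|y| + 1))))
  (fun y xi => cexp (ii * y%:C%C * Complex xi eta) * q xi)
  (fun y xi => cexp (ii * y%:C%C * Complex xi eta) * (ii * Complex xi eta * q xi))).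
- by apply/andP; split; lra.
- by move=> z _; exact: cintegrable_Fint.
- move=> z xi _ _.
  have d : is_cder (fun z => ii * z%:C%C * Complex xi eta) z (ii * Complex xi eta).
    by apply: cder_eq (cderZr _ (cderZl _ (cder_id z))) _; rewrite mulr1.
  by apply: cder_eq (cderZr _ (cder_cexp d)) _; ring.
- move=> z xi /andP[z1 z2] /andP[x1 x2].
  have ex : c1 (cexp (ii * z%:C%C * Complex xi eta)) <= 2 * expR (`|eta| * (`|y| + 1)).
    apply: le_trans (c1_cexp _) _; rewrite ler_wpM2l// ler_expR !ReImE.
    have zy : `|z| <= `|y| + 1.
      by rewrite ler_norml; have := ler_norm y; have := ler_norm (- y); rewrite normrN; lra.
    apply: (@le_trans _ _ (`|eta| * `|z|)); last by rewrite ler_wpM2l.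
    have := ler_norm (- (eta * z)); rewrite normrN normrM; lra.
  have lx : c1 (Complex xi eta) <= a + `|eta|.
    by rewrite /c1 /= lerD2r ler_norml x1.
  apply: le_trans (c1M _ _) _; rewrite mulrC.
  apply: ler_pM; rewrite ?c1_ge0//.
  apply: le_trans (c1M _ _) _; apply: ler_pM; rewrite ?c1_ge0//.
  by apply: le_trans (c1M _ _) _; rewrite c1_i mul1r.
Qed.

Lemma cint_conj (D : set R) q : measurable D -> cintegrable D q ->
  cint D (fun x => (q x)^*) = (cint D q)^*.
Proof.
move=> mD [q1 q2]; apply: complex_ext; rewrite ?Re_conj ?Im_conj /cint /=.
  by apply: eq_Rintegral => x _; rewrite Re_conj.
rewrite -mulN1r -RintegralZl//; apply: eq_Rintegral => x _.
by rewrite Im_conj mulN1r.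
Qed.

Section Inversion.
Context (c : R).
Hypothesis c0 : 0 < c.

Definition l1 xi : R[i] := (Complex xi (- c))^-1.
Definition l2 xi : R[i] := (Complex xi c)^-1.

Lemma Complex_neq0 xi (e : R) : e != 0 -> Complex xi e != 0 :> R[i].
Proof. by move=> e0; apply/eqP => -[_ e1]; rewrite e1 eqxx in e0. Qed.

Lemma nc0 : - c != 0. Proof. by rewrite oppr_eq0 gt_eqF. Qed.
Lemma pc0 : c != 0. Proof. by rewrite gt_eqF. Qed.

Lemma ccont_l1 xi : ccont l1 xi.
Proof. exact: cder_ccont (cderV (Complex_neq0 xi nc0) (cder_Complex _ _)). Qed.
Lemma ccont_l2 xi : ccont l2 xi.
Proof. exact: cder_ccont (cderV (Complex_neq0 xi pc0) (cder_Complex _ _)). Qed.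

Lemma c1_Complex xi (e : R) : `|e| = c -> c1 (Complex xi e)^-1 <= 2 / c.
Proof.
move=> ec; apply: le_trans (c1V _) _; rewrite ler_wpM2l//.
have h : c <= c1 (Complex xi e) by rewrite /c1 /= ec lerDr.
by rewrite lef_pV2 ?posrE//; exact: lt_le_trans h.
Qed.

Lemma c1_l1 xi : c1 (l1 xi) <= 2 / c.
Proof. by apply: c1_Complex; rewrite normrN gtr0_norm. Qed.
Lemma c1_l2 xi : c1 (l2 xi) <= 2 / c.
Proof. by apply: c1_Complex; rewrite gtr0_norm. Qed.

Lemma l1_sub_l2 xi : l1 xi = l2 xi + 2 * ii * c%:C%C * (l1 xi * l2 xi).
Proof.
have n1 := Complex_neq0 xi nc0; have n2 := Complex_neq0 xi pc0.
have e : Complex xi c = Complex xi (- c) + 2 * ii * c%:C%C.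
  by rewrite (_ : 2 = 2%:R%:C%C) ?rmorph_nat//; apply: complex_ext; rewrite !ReImE; ring.
have e1 : l1 xi * Complex xi (- c) = 1 by rewrite mulVf.
have e2 : l2 xi * Complex xi c = 1 by rewrite mulVf.
rewrite -[LHS]mulr1 -[X in _ * X]e2 e.
transitivity (l2 xi * (l1 xi * Complex xi (- c)) + 2 * ii * c%:C%C * (l1 xi * l2 xi)); first ring.
by rewrite e1 mulr1.
Qed.

Lemma l1_xi xi : ii * xi%:C%C * l1 xi = ii - c%:C%C * l1 xi.
Proof.
have e1 : l1 xi * Complex xi (- c) = 1 by rewrite mulVf// Complex_neq0// nc0.
have e : ii * xi%:C%C = ii * Complex xi (- c) - c%:C%C.
  by apply: complex_ext; rewrite !ReImE; ring.
rewrite e mulrBl; congr (_ - _).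
by rewrite -mulrA [_ * l1 _]mulrC e1 mulr1.
Qed.

(** The weights have poles at ic (from [l1]) and at -ic (from [l2]). Only [bv] has no pole in the
    upper half-plane, so it is negligible for t > 0; partial fractions and first-order equations in
    t lead from it through [hv], [wv] and [jv] to [vv]. [Vv] is the same integral as [vv] with the
    exponential taken on the line Im lambda = -c, where [l1] is lambda^-1. *)
Definition bv a t := Fint 0 (fun xi => l2 xi * l2 xi) a t.
Definition hv a t := Fint 0 (fun xi => l1 xi * (l2 xi * l2 xi)) a t.
Definition wv a t := Fint 0 (fun xi => l1 xi * l2 xi) a t.
Definition jv a t := Fint 0 (fun xi => l1 xi * (l1 xi * l2 xi)) a t.
Definition vv a t := Fint 0 (fun xi => l1 xi * l1 xi) a t.
Definition Vv a t := Fint (- c) (fun xi => l1 xi * l1 xi) a t.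

Local Ltac cont := repeat lazymatch goal with
  | |- ccont (fun _ => ?z) _ => exact: ccont_cst
  | |- ccont l1 _ => exact: ccont_l1
  | |- ccont l2 _ => exact: ccont_l2
  | |- ccont (fun x => _ * _) _ => refine (ccontM _ _)
  end.

Lemma c1M_le (z w : R[i]) (x y : R) : c1 z <= x -> c1 w <= y -> c1 (z * w) <= x * y.
Proof.
by move=> h1 h2; apply: le_trans (c1M _ _) _; apply: ler_pM; rewrite ?c1_ge0.
Qed.

Lemma ii_Complex0 xi : ii * Complex xi 0 = ii * xi%:C%C. Proof. by []. Qed.

(** Differentiation in t multiplies the weight by i xi, and i xi [l1] = i - c [l1] removes one pole
    at ic. *)
Lemma hv_der a t : 0 <= a -> is_cder (hv a) t (ii * bv a t - c%:C%C * hv a t).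
Proof.
move=> a0; have cq xi : ccont (fun xi => l1 xi * (l2 xi * l2 xi)) xi by cont.
have qK xi := c1M_le (c1_l1 xi) (c1M_le (c1_l2 xi) (c1_l2 xi)).
apply: cder_eq (Fint_der 0 t a0 cq qK) _.
rewrite /bv /hv -mulNr -!FintZ; try by move=> xi; cont.
rewrite -FintD; try by move=> xi; cont.
by apply: eq_Fint => xi; rewrite ii_Complex0 mulrA l1_xi; ring.
Qed.

Lemma jv_der a t : 0 <= a -> is_cder (jv a) t (ii * wv a t - c%:C%C * jv a t).
Proof.
move=> a0; have cq xi : ccont (fun xi => l1 xi * (l1 xi * l2 xi)) xi by cont.
have qK xi := c1M_le (c1_l1 xi) (c1M_le (c1_l1 xi) (c1_l2 xi)).
apply: cder_eq (Fint_der 0 t a0 cq qK) _.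
rewrite /wv /jv -mulNr -!FintZ; try by move=> xi; cont.
rewrite -FintD; try by move=> xi; cont.
by apply: eq_Fint => xi; rewrite ii_Complex0 mulrA l1_xi; ring.
Qed.

Lemma wvE a t : wv a t = bv a t + 2 * ii * c%:C%C * hv a t.
Proof.
rewrite /bv /wv /hv -FintZ; last by move=> xi; cont.
rewrite -FintD; try by move=> xi; cont.
by apply: eq_Fint => xi; rewrite {1}l1_sub_l2; ring.
Qed.

Lemma vvE a t : vv a t = wv a t + 2 * ii * c%:C%C * jv a t.
Proof.
rewrite /vv /wv /jv -FintZ; last by move=> xi; cont.
rewrite -FintD; try by move=> xi; cont.
by apply: eq_Fint => xi; rewrite {2}l1_sub_l2; ring.
Qed.

Lemma VvE a t : Vv a t = (expR (c * t))%:C%C * vv a t.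
Proof.
rewrite /Vv /vv /Fint -cintZ//; last by apply: cintegrable_Fint => xi; cont.
apply: cint_ext => xi _; rewrite [RHS]mulrA -cexpR -cexpD; congr (cexp _ * _).
by apply: complex_ext; rewrite !ReImE; ring.
Qed.

(** Conjugation exchanges [l1] with [l2] and reverses t. In this way the bound obtained for negative
    t in the lower half-plane also serves positive t. *)
Lemma bvE a t : bv a t = (vv a (- t))^*.
Proof.
rewrite /bv /vv /Fint -cint_conj//; last by apply: cintegrable_Fint => xi; cont.
apply: cint_ext => xi _; rewrite !rmorphM /=; congr (_ * _).
  by rewrite /cexp; apply: complex_ext; rewrite !ReImE !(mul0r, mulr0, mul1r, addr0, add0r, subr0, oppr0, expR0) ?mulNr ?cosN ?sinN ?opprK.
have e : (l1 xi)^* = l2 xi.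
  rewrite /l1 /l2; apply: complex_ext; rewrite !(ReImE, ReV, ImV) sqrrN //.
  by ring.
by rewrite e.
Qed.

Lemma Vv_neg : exists D A : R, [/\ 0 <= D, 0 < A &
  forall a t, A <= a -> t <= 0 -> c1 (Vv a t) <= D / a].
Proof.
have c0' := c0.
have r0 : - c / 2 <= 0 by lra.
have r1 : - c < - c / 2 by lra.
have r2 : - c / 2 < 0 by lra.
have [D [A [D0 A1 dec]]] := @decay_prod R [:: 0; 0] isT.
(* The 8 comes from [line_int_decay], the 2 from the exponential; adding c to A makes the rectangle
   reach below the line Im lambda = -c. *)
exists (8 * (2 * D)), (A + c); split; [by rewrite !mulr_ge0|by rewrite addr_gt0// (lt_le_trans ltr01)|move=> a t Aa t0].
have tm : tame (- c / 2) (fun l : R[i] => cexp (ii * t%:C%C * l) *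
    \prod_(mu <- [:: 0; 0]) (l - mu)^-1).
  apply: tameM (tame_cexp r0 t0) (tame_prod _) => mu.
  by rewrite !inE => /orP[] /eqP ->.
have := line_int_decay tm (decays_cexpM t0 (And3 D0 A1 dec)) (eta := - c) (a := a).
rewrite (_ : line_int _ _ _ = Vv a t); last first.
  apply: cint_ext => xi _ /=; rewrite !big_cons big_nil mulr1 subr0 //.
apply=> //; first by rewrite oppr_le0 ltW.
  by rewrite opprK (le_trans _ Aa)// lerDr (le_trans ler01).
by rewrite (le_trans _ Aa)// lerDl ltW.
Qed.

(** At t = 0 the weights are xi - ic and xi + ic divided by (xi^2 + c^2)^2. The odd parts integrate
    to zero, the others are opposite, and [Q] is a primitive of (xi^2 + c^2)^-2. *)
Lemma hj0 a : 0 <= a ->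
  hv a 0 + jv a 0 = 0 /\
  hv a 0 = - ii * c%:C%C * (a / (c ^+ 2 * (a ^+ 2 + c ^+ 2)) + atan (a / c) / c ^+ 3)%:C%C.
Proof.
move=> a0; have aa : - a <= a by lra.
pose s xi := xi ^+ 2 + c ^+ 2.
have s0 xi : s xi != 0 by rewrite gt_eqF// ltr_wpDl ?sqr_ge0// exprn_gt0.
have cn := pc0.
pose Q xi := xi / (2 * c ^+ 2) * (s xi)^-1 + (2 * c ^+ 3)^-1 * atan (c^-1 * xi + 0).
have ds xi : is_derive xi 1 s (2 * xi).
  apply: is_derive_eq (is_derive_ext _ (is_deriveD (is_deriveM (is_derive_id xi 1)
    (is_derive_id xi 1)) (is_derive_cst (c ^+ 2) xi 1))) _.
    by move=> y; rewrite /s expr2.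
  by rewrite /GRing.scale /=; ring.
have dsV xi : is_derive xi 1 (fun xi => (s xi)^-1) (- (s xi) ^- 2 * (2 * xi)).
  exact: is_deriveV (s0 xi) (ds xi).
have dQ xi : is_derive xi 1 Q ((s xi) ^- 2).
  have da := is_derive_shiftN (is_derive1_atan (c^-1 * xi + 0)).
  have dl : is_derive xi 1 (fun xi => xi / (2 * c ^+ 2)) (2 * c ^+ 2)^-1.
    apply: is_derive_eq (is_derive_ext _ (is_deriveZ (2 * c ^+ 2)^-1 (is_derive_id xi 1))) _.
      by move=> y; exact: mulrC.
    exact: mulr1.
  apply: is_derive_eq (is_derive_ext _ (is_deriveD (is_deriveM dl (dsV xi))
    (is_deriveZ (2 * c ^+ 3)^-1 da))) _ => //.
  rewrite /GRing.scale /= addr0; have := s0 xi; rewrite /s => e.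
  have -> : 1 + (c^-1 * xi) ^+ 2 = (xi ^+ 2 + c ^+ 2) / c ^+ 2 by field.
  field; rewrite cn /= e //.
have sE xi : sqnorm (Complex xi c) = s xi by [].
have ll xi : l1 xi * l2 xi = (s xi)^-1%:C%C.
  have e : xi ^+ 2 + c ^+ 2 != 0 := s0 xi.
  rewrite /l1 /l2; apply: complex_ext.
    by rewrite [RHS]ReC ReM !ReV !ImV !ReComplex !ImComplex sqrrN /s; field.
  by rewrite [RHS]ImC ImM !ReV !ImV !ReComplex !ImComplex sqrrN /s; field.
have l1E xi : l1 xi = Complex (xi / s xi) (c / s xi).
  by rewrite /l1; apply: complex_ext; [rewrite ReV|rewrite ImV]; rewrite !ReComplex !ImComplex sqrrN ?opprK.
have l2E xi : l2 xi = Complex (xi / s xi) (- c / s xi).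
  by rewrite /l2; apply: complex_ext; [rewrite ReV|rewrite ImV]; rewrite !ReComplex !ImComplex.
have cs (r x y : R) : r%:C%C * Complex x y = Complex (r * x) (r * y).
  by apply: complex_ext => /=; rewrite mul0r ?subr0 ?addr0.
have F1 (e : R) xi : is_cder (fun xi => Complex (- 2^-1 * (s xi)^-1) (e * Q xi)) xi
    (Complex (xi / s xi ^+ 2) (e / s xi ^+ 2)).
  split.
  - apply: is_derive_eq (is_derive_ext _ (is_deriveZ (- 2^-1) (dsV xi))) _ => //.
    by rewrite /GRing.scale /=; field; exact: s0.
  - by apply: is_derive_ext (is_deriveZ e (dQ xi)).
have hE : hv a 0 = Complex 0 (- c * (Q a - Q (- a))).
  rewrite /hv /Fint (cint_ext (g := fun xi => Complex (xi / s xi ^+ 2) (- c / s xi ^+ 2))).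
    rewrite (cint_FTC (f := fun xi => Complex (- 2^-1 * (s xi)^-1) (- c * Q xi)))//.
      by apply: complex_ext; rewrite !ReImE /s ?sqrrN; ring.
    move=> xi _; apply: (ccont_ext (f := fun xi => l1 xi * (l2 xi * l2 xi))) => [y|].
      by rewrite mulrA ll l2E cs; congr Complex; rewrite mulrCA -invfM -expr2.
    by cont.
  move=> xi _; rewrite mulr0 mul0r cexp0 mul1r mulrA ll l2E cs.
  by congr Complex; rewrite mulrCA -invfM -expr2.
have jE : jv a 0 = Complex 0 (c * (Q a - Q (- a))).
  rewrite /jv /Fint (cint_ext (g := fun xi => Complex (xi / s xi ^+ 2) (c / s xi ^+ 2))).
    rewrite (cint_FTC (f := fun xi => Complex (- 2^-1 * (s xi)^-1) (c * Q xi)))//.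
      by apply: complex_ext; rewrite !ReImE /s ?sqrrN; ring.
    move=> xi _; apply: (ccont_ext (f := fun xi => l1 xi * (l1 xi * l2 xi))) => [y|].
      by rewrite [l1 _ * (_ * _)]mulrC ll l1E cs; congr Complex; rewrite mulrCA -invfM -expr2.
    by cont.
  move=> xi _; rewrite mulr0 mul0r cexp0 mul1r [l1 _ * (_ * _)]mulrC ll l1E cs.
  by congr Complex; rewrite mulrCA -invfM -expr2.
have QN : Q (- a) = - Q a.
  by rewrite /Q /s !addr0 mulrN atanN sqrrN; ring.
rewrite hE jE; split; apply: complex_ext; rewrite !ReImE; try ring.
rewrite QN opprK /Q /s addr0 [c^-1 * a]mulrC; have := s0 a; rewrite /s => e.
by field; rewrite cn e.
Qed.

(** With e^(ct) as integrating factor, H = e^(ct) h has derivative i e^(ct) b, and J = e^(ct) j has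
    derivative i e^(ct) b - 2 c H. As b is O(1 / a), both H and J + 2 c t H(0) are nearly constant.
    So [Vv] is close to 2 i c (H(0) + J(0)) - 4 i c^2 t H(0), which by [hj0] is -4 c^3 q t, and q
    tends to pi / (2 c^3). *)
Lemma Vv_pos T : 0 <= T -> exists C A : R, [/\ 0 <= C, 0 < A &
  forall a t, A <= a -> 0 <= t <= T ->
  c1 (Vv a t + (2 * pi * t)%:C%C) <= C / a + 4 * T * (pi / 2 - atan (a / c))].
Proof.
move=> T0; have [D [A [D0 A0 HV]]] := Vv_neg; have cp := c0.
pose E := expR (c * T); have E0 : 0 < E := expR_gt0 _.
(* Sum of the bounds [t1] to [t4] below, multiplied by a, without the arctangent term. *)
pose C := E ^+ 2 * D * (1 + 8 * c * T + 16 * c ^+ 2 * T ^+ 2) + 4 * T * c.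
have C0 : 0 <= C.
  by rewrite /C !(addr_ge0, mulr_ge0, exprn_ge0) ?(ltW E0) ?(ltW cp).
exists C, A; split => // a t Aa /andP[t0 tT].
have a0 : 0 < a := lt_le_trans A0 Aa.
pose g (t : R) : R[i] := (expR (c * t))%:C%C.
have gE u : 0 <= u <= T -> c1 (g u) <= E.
  move=> /andP[u0 uT]; rewrite c1_real ger0_norm ?expR_ge0// ler_expR.
  by rewrite ler_wpM2l// ltW.
have dg u : is_cder g u (c%:C%C * g u).
  have := cder_affine (c := c) (e := 0) (cder_real (is_derive_expR (c * u + 0))).
  by rewrite addr0; apply: cder_ext => y; rewrite addr0.
pose M := E ^+ 2 * D / a.
have M0 : 0 <= M by rewrite /M divr_ge0 ?(ltW a0)// mulr_ge0// exprn_ge0// ltW.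
(* The bound [E] of the exponential enters twice: once through [g], once when [vv] at -u is
   expressed by [Vv]. *)
have bE u : 0 <= u <= T -> c1 (g u * bv a u) <= M.
  move=> uT; have -> : M = E * (E * (D / a)) by rewrite /M; ring.
  apply: c1M_le; first exact: gE.
  rewrite bvE c1_conj (_ : vv a (- u) = g u * Vv a (- u)).
    apply: c1M_le; first exact: gE.
    by apply: HV => //; rewrite oppr_le0; case/andP: uT.
  by rewrite VvE /g mulrA -rmorphM /= -expRD mulrN subrr expR0 mul1r.
pose H u := g u * hv a u; pose J u := g u * jv a u.
pose K u := J u + (2 * c * u)%:C%C * H 0.
have g0 : g 0 = 1 by rewrite /g mulr0 expR0.
have a1 := ltW a0.
have dH u : is_cder H u (ii * (g u * bv a u)).
  by apply: cder_eq (cderM (dg u) (hv_der u a1)) _; ring.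
have dHt u : 0 <= u <= T -> c1 (H u - H 0) <= 2 * M * T.
  move=> /andP[u0 uT]; apply: (@le_trans _ _ (2 * M * (u - 0))); last first.
    by rewrite subr0 ler_wpM2l// mulr_ge0.
  apply: (cder_bound (df := fun u => ii * (g u * bv a u))) => // x /andP[x0 xu].
  by apply: le_trans (c1M _ _) _; rewrite c1_i mul1r bE// x0 (le_trans xu).
have two : (2 : R[i]) = 2%:C%C by rewrite rmorph_nat.
have dK u : is_cder K u (ii * (g u * bv a u) - 2 * c%:C%C * (H u - H 0)).
  have dJ := cderM (dg u) (jv_der u a1).
  have dl : is_cder (fun u : R => (2 * c * u)%:C%C * H 0) u (2 * c%:C%C * H 0).
    have := cderZr (H 0) (cderZl (2 * c)%:C%C (cder_id u)).
    rewrite mulr1 rmorphM /= -two; apply: cder_ext => y.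
    by rewrite !rmorphM /= -two.
  apply: cder_eq (cderD dJ dl) _; rewrite wvE /H.
  have i2 : ii * ii = -1 :> R[i] by rewrite -expr2 sqr_i.
  transitivity (ii * (g u * bv a u) + (ii * ii) * (2 * c%:C%C * (g u * hv a u)) +
     2 * c%:C%C * (g 0 * hv a 0)); first by ring.
  by rewrite i2; ring.
have dKt : c1 (K t - K 0) <= 2 * (M + 4 * c * T * M) * T.
  apply: (@le_trans _ _ (2 * (M + 4 * c * T * M) * (t - 0))); last first.
    rewrite subr0; apply: ler_wpM2l => //.
    have n4 : 0 <= 4 * c * T * M by apply: mulr_ge0 => //; rewrite !mulr_ge0 ?(ltW cp).
    by rewrite mulr_ge0// addr_ge0.
  apply: (cder_bound (df := fun u => ii * (g u * bv a u) - 2 * c%:C%C * (H u - H 0))) => // x /andP[x0 xt].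
  have xT : 0 <= x <= T by rewrite x0 (le_trans xt).
  apply: le_trans (c1B _ _) _; apply: lerD.
    by apply: le_trans (c1M _ _) _; rewrite c1_i mul1r bE.
  apply: le_trans (c1M _ _) _; rewrite two -rmorphM c1_real ger0_norm ?mulr_ge0 ?(ltW cp)//.
  have := ler_wpM2l (mulr_ge0 (ler0n R 2) (ltW cp)) (dHt x xT).
  by rewrite (_ : 2 * c * (2 * M * T) = 4 * c * T * M)//; ring.
have [hj h0] := hj0 a1.
set q := (_ + atan _ / _ : R) in h0.
have VE : Vv a t + (2 * pi * t)%:C%C = g t * bv a t + (2 * c)%:C%C * ii * (H t - H 0) +
    (2 * c)%:C%C * ii * (K t - K 0) + (t * (2 * pi - 4 * c ^+ 3 * q))%:C%C.
  have hj' : J 0 = - H 0 by rewrite /J /H -mulrN; congr (_ * _); apply/eqP; rewrite -addr_eq0 addrC hj.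
  have H0 : H 0 = - ii * c%:C%C * q%:C%C by rewrite /H g0 mul1r.
  rewrite VvE -/(g t) vvE wvE /K hj' /J H0 /H mulr0 mul0r addr0.
  have i2 : ii * ii = -1 :> R[i] by rewrite -expr2 sqr_i.
  have e4 : (t * (2 * pi - 4 * c ^+ 3 * q))%:C%C = (2 * pi * t)%:C%C +
      (ii * ii) * (4 * c ^+ 3 * q * t)%:C%C.
    by rewrite i2 mulN1r -rmorphB; congr (_%:C%C); ring.
  have e5 : (4 * c ^+ 3 * q * t)%:C%C = 2 * 2 * (c%:C%C * c%:C%C * c%:C%C) * q%:C%C * t%:C%C.
    by rewrite two -!rmorphM; congr (_%:C%C); ring.
  have e6 : (2 * c)%:C%C = 2 * c%:C%C by rewrite two -rmorphM.
  have e7 : (2 * c * t)%:C%C = 2 * c%:C%C * t%:C%C by rewrite two -!rmorphM.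
  rewrite e4 e5 e6 e7; ring.
have qb : `|2 * pi - 4 * c ^+ 3 * q| <= 4 * (pi / 2 - atan (a / c)) + 4 * c / a.
  have cn := pc0; have sn : a ^+ 2 + c ^+ 2 != 0.
    by rewrite gt_eqF// addr_gt0 ?exprn_gt0.
  have -> : 2 * pi - 4 * c ^+ 3 * q = 4 * (pi / 2 - atan (a / c)) - 4 * (c * (a / (a ^+ 2 + c ^+ 2))).
    by rewrite /q; field; rewrite cn sn.
  apply: le_trans (ler_normB _ _) _; rewrite ger0_norm; last first.
    by rewrite mulr_ge0// subr_ge0 ltW// atan_ltpi2.
  rewrite lerD2l ger0_norm; last by rewrite !mulr_ge0 ?(ltW cp)// invr_ge0 addr_ge0 ?sqr_ge0.
  rewrite -[4 * c / a]mulrA ler_wpM2l// ler_wpM2l ?(ltW cp)//.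
  rewrite ler_pdivrMr ?addr_gt0 ?exprn_gt0// mulrC ler_pdivlMr//.
  by rewrite -expr2 lerDl sqr_ge0.
rewrite VE.
have c2 : c1 ((2 * c)%:C%C * ii) <= 2 * c.
  apply: le_trans (c1M _ _) _; rewrite c1_i mulr1 c1_real ger0_norm//.
  by rewrite mulr_ge0// ltW.
have t1 := bE t (introT andP (conj t0 tT)).
have t2 := c1M_le c2 (dHt t (introT andP (conj t0 tT))).
have t3 := c1M_le c2 dKt.
have t4 : c1 (t * (2 * pi - 4 * c ^+ 3 * q))%:C%C <= T * (4 * (pi / 2 - atan (a / c)) + 4 * c / a).
  by rewrite c1_real normrM (ger0_norm t0); apply: ler_pM.
have -> : C / a + 4 * T * (pi / 2 - atan (a / c)) =
   M + 2 * c * (2 * M * T) + 2 * c * (2 * (M + 4 * c * T * M) * T) + T * (4 * (pi / 2 - atan (a / c)) + 4 * c / a).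
  by rewrite /C /M; field; rewrite gt_eqF.
apply: le_trans (c1D _ _) _; apply: lerD t4.
apply: le_trans (c1D _ _) _; apply: lerD t3.
by apply: le_trans (c1D _ _) _; apply: lerD t2.
Qed.

Lemma Vv_limit T (e : R) : 0 <= T -> 0 < e -> exists2 A : R, 0 < A &
  forall a t, A <= a -> `|t| <= T ->
  c1 (Vv a t + (2 * pi * Num.max t 0)%:C%C) <= e.
Proof.
move=> T0 e0; have cp := c0.
have [D [A1 [D0 A10 H1]]] := Vv_neg; have [C [A2 [C0 A20 H2]]] := Vv_pos T0.
(* With this tolerance the term 4 T (pi / 2 - atan (a / c)) stays below e / 2; T + 1 allows T =
   0. *)
have T8 : 0 < e / (8 * (T + 1)) by rewrite divr_gt0// mulr_gt0//; lra.
have /cvgrPdist_le/(_ _ T8)[N [_ HN]] := @cvgy_atan R.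
pose A := A1 + A2 + D / e + 2 * C / e + c * (`|N| + 1).
have n0 : 0 <= D / e by rewrite divr_ge0// ltW.
have n1 : 0 <= 2 * C / e by rewrite divr_ge0 ?mulr_ge0// ltW.
have n2 : 0 < c * (`|N| + 1) by rewrite mulr_gt0// ltr_wpDl.
exists A => [|a t Aa tT]; first by rewrite /A; lra.
have a0 : 0 < a by rewrite /A in Aa; lra.
have [tle|tge] := leP t 0.
  rewrite mulr0 addr0; apply: le_trans (H1 a t _ tle) _.
    by rewrite /A in Aa; lra.
  by rewrite ler_pdivrMr// mulrC -ler_pdivrMr//; rewrite /A in Aa; lra.
apply: le_trans (H2 a t _ _) _.
- by rewrite /A in Aa; lra.
- by rewrite (ltW tge) -(ger0_norm (ltW tge)).
have q1 : C / a <= e / 2.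
  rewrite ler_pdivrMr// mulrC -ler_pdivrMr ?divr_gt0//.
  have -> : C / (e / 2) = 2 * C / e by field; rewrite gt_eqF.
  by rewrite /A in Aa; lra.
have q2 : pi / 2 - atan (a / c) <= e / (8 * (T + 1)).
  apply: le_trans (ler_norm _) (HN (a / c) _).
  rewrite ltr_pdivlMr// mulrC; apply: lt_le_trans (_ : c * (`|N| + 1) <= a).
    by rewrite ltr_pM2l//; have := ler_norm N; lra.
  by rewrite /A in Aa; lra.
have q3 : 4 * T * (pi / 2 - atan (a / c)) <= e / 2.
  apply: (@le_trans _ _ (4 * T * (e / (8 * (T + 1))))).
    by rewrite ler_wpM2l// mulr_ge0.
  rewrite mulrA ler_pdivrMr; last by rewrite mulr_gt0//; lra.
  by nra.
by lra.
Qed.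
End Inversion.
End ScalarFourier.

(** * The Fourier transform of the resolvent *)

Section Boundedness.
Context {R : realType}.
Implicit Types (a b x y : R).

Lemma ccont_c1 (f : R -> R[i]) x : ccont f x -> ccont (fun y => (c1 (f y))%:C%C) x.
Proof.
move=> [f1 f2]; split; last exact: cst_continuous.
apply: (@continuousD R R R).
  exact: (@continuous_comp _ _ _ (fun y => complex.Re (f y)) Num.norm x f1 (@norm_continuous R R _)).
exact: (@continuous_comp _ _ _ (fun y => complex.Im (f y)) Num.norm x f2 (@norm_continuous R R _)).
Qed.

Lemma cont_mnorm q r (F : R -> 'M[R[i]]_(q, r)) x :
  mcont F x -> {for x, continuous (fun y => mnorm (F y))}.
Proof.
move=> cF.
have [h _] : ccont (fun y => \sum_i \sum_j (c1 (F y i j))%:C%C) x.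
  by apply: ccont_sum => i _; apply: ccont_sum => j _; apply: ccont_c1; exact: cF.
apply: cont_ext h => y; rewrite Re_sum; apply: eq_bigr => i _; rewrite Re_sum.
exact: eq_bigr.
Qed.

Lemma mcont_bounded q r (F : R -> 'M[R[i]]_(q, r)) a b :
  (forall x, a <= x <= b -> mcont F x) ->
  exists2 K : R, 0 <= K & forall x, a <= x <= b -> mnorm (F x) <= K.
Proof.
move=> cF; have [ab|ba] := leP a b; last first.
  by exists 0 => // x /andP[ax xb]; move: ba; rewrite ltNge (le_trans ax xb).
have cn : {within `[a, b], continuous (fun x => mnorm (F x))}.
  apply: continuous_in_subspaceT => x; rewrite inE /= in_itv /= => xab.
  exact/cont_mnorm/cF.
have [c _ H] := EVT_max ab cn.
exists (mnorm (F c)); first exact: mnorm_ge0.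
by move=> x xab; apply: H; rewrite in_itv.
Qed.
End Boundedness.

(** * Newton interpolation of the resolvent and its decay *)

Section Resolvent.
Context {R : realType} (n : nat) (B : 'M[R[i]]_n).
Implicit Types (s t : seq R[i]) (lam mu : R[i]) (rho : R) (h : R[i] -> R[i]).

(* Newton interpolation of the resolvent; it is exact at nodes [s] with [annih s = 0],
   which exist by the Cayley-Hamilton theorem. *)
Fixpoint newton_res s lam : 'M[R[i]]_n :=
  if s is mu :: s' then
    (lam - mu)^-1 *: (1%:M + (B - mu%:M) *m newton_res s' lam)
  else 0.

Definition annih s : 'M[R[i]]_n := foldr (fun mu M => (B - mu%:M) *m M) 1%:M s.

Lemma newton_resP s lam : (forall mu, mu \in s -> lam != mu) ->
  (lam%:M - B) *m newton_res s lam = 1%:M - (\prod_(mu <- s) (lam - mu)^-1) *: annih s.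
Proof.
elim: s => [|mu s ih] h /=; first by rewrite mulmx0 big_nil scale1r subrr.
have {}ih := ih (fun nu nus => h nu (mem_behead (s := mu :: s) nus)).
have n0 : lam - mu != 0 by rewrite subr_eq0 h// mem_head.
rewrite -scalemxAr mulmxDr mulmx1 mulmxA.
have -> : (lam%:M - B) *m (B - mu%:M) = (B - mu%:M) *m (lam%:M - B).
  have -> : lam%:M - B = (lam - mu)%:M - (B - mu%:M).
    by rewrite raddfB opprB addrA subrK.
  generalize (B - mu%:M) => M'.
  by rewrite mulmxBl mulmxBr scalar_mxC.
rewrite -mulmxA ih mulmxBr mulmx1 -scalemxAr big_cons.
have -> : lam%:M - B + (B - mu%:M - (\prod_(j <- s) (lam - j)^-1) *: ((B - mu%:M) *m annih s)) =
    (lam - mu)%:M - (\prod_(j <- s) (lam - j)^-1) *: ((B - mu%:M) *m annih s).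
  by rewrite !addrA subrK raddfB.
by rewrite scalerBr scalerA scale_scalar_mx mulVf.
Qed.

Lemma tameD rho h1 h2 : tame rho h1 -> tame rho h2 -> tame rho (fun l => h1 l + h2 l).
Proof.
move=> [d1 [K1 K1p H1]] [d2 [K2 K2p H2]].
exists (fun l => d1 l + d2 l), (K1 + K2); first exact: addr_ge0.
move=> lam lr; have [a1 b1 e1 [z1 f1]] := H1 lam lr; have [a2 b2 e2 [z2 f2]] := H2 lam lr.
split; [exact: holoD|exact: le_trans (c1D _ _) (lerD b1 b2)|
  exact: le_trans (c1D _ _) (lerD e1 e2)|].
by exists (z1 + z2); exact: holoD.
Qed.

Lemma decays_le h (D A D' A' : R) : decays h D A -> D <= D' -> A <= A' -> decays h D' A'.
Proof.
move=> [D0 A1 H] DD AA; split; [exact: le_trans DD|exact: le_trans AA|].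
move=> lam lA l0; apply: le_trans (H lam (le_trans AA lA) l0) _.
by rewrite ler_wpM2r// invr_ge0 exprn_ge0// c1_ge0.
Qed.

Lemma decaysD h1 h2 (D1 D2 A : R) : decays h1 D1 A -> decays h2 D2 A ->
  decays (fun l => h1 l + h2 l) (D1 + D2) A.
Proof.
move=> [D10 A1 H1] [D20 _ H2]; split => //; first exact: addr_ge0.
move=> lam lA l0; apply: le_trans (c1D _ _) _; rewrite mulrDl.
by apply: lerD; [exact: H1|exact: H2].
Qed.

Lemma decaysZ h (D A : R) (z : R[i]) : decays h D A -> decays (fun l => z * h l) (c1 z * D) A.
Proof.
move=> [D0 A1 H]; split => //; first by rewrite mulr_ge0// c1_ge0.
move=> lam lA l0; apply: le_trans (c1M _ _) _; rewrite -mulrA ler_wpM2l ?c1_ge0//.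
exact: H.
Qed.

Definition tame_decay rho h := tame rho h /\ exists D A : R, decays h D A.

Lemma tame_decay_ext rho h1 h2 : h1 =1 h2 -> tame_decay rho h1 -> tame_decay rho h2.
Proof. by move=> /funext ->. Qed.

Lemma tame_decay0 rho : tame_decay rho (fun=> 0).
Proof.
split; first exact: tame_cst.
by exists 0, 1; split => // lam _ _; rewrite c10 mul0r.
Qed.

Lemma tame_decayD rho h1 h2 : tame_decay rho h1 -> tame_decay rho h2 ->
  tame_decay rho (fun l => h1 l + h2 l).
Proof.
move=> [t1 [D1 [A1 d1]]] [t2 [D2 [A2 d2]]]; split; first exact: tameD.
exists (D1 + D2), (Num.max A1 A2); apply: decaysD.
  by apply: decays_le d1 _ _ => //; rewrite le_max lexx.
by apply: decays_le d2 _ _ => //; rewrite le_max lexx orbT.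
Qed.

Lemma tame_decayZ rho h (z : R[i]) : tame_decay rho h -> tame_decay rho (fun l => z * h l).
Proof.
move=> [t [D [A d]]]; split; first exact: tameM (tame_cst rho z) t.
by exists (c1 z * D), A; exact: decaysZ.
Qed.

Lemma tame_decay_sum rho (I : Type) (r : seq I) (P : pred I) (F : I -> R[i] -> R[i]) :
  (forall i, P i -> tame_decay rho (F i)) ->
  tame_decay rho (fun l => \sum_(i <- r | P i) F i l).
Proof.
move=> H; elim: r => [|i r ih].
  by apply: tame_decay_ext (tame_decay0 rho) => l; rewrite big_nil.
case Pi : (P i).
  by apply: tame_decay_ext (tame_decayD (H i Pi) ih) => l; rewrite big_cons Pi.
by apply: tame_decay_ext ih => l; rewrite big_cons Pi.
Qed.

(** The list [t] is general because each step of the recursion moves one factor (l - mu)^-1 out of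
    [newton_res] into the product, which therefore always keeps the two factors needed for quadratic
    decay. *)
Lemma newton_res_tame rho s t i j :
  (forall mu, mu \in s ++ t -> rho < complex.Im mu) -> (2 <= size t)%N ->
  tame_decay rho (fun l => (\prod_(mu <- t) (l - mu)^-1) * newton_res s l i j).
Proof.
elim: s t i j => [|mu s ih] t i j H t2 /=.
  by apply: tame_decay_ext (tame_decay0 rho) => l; rewrite mxE mulr0.
have Ht : forall nu, nu \in mu :: t -> rho < complex.Im nu.
  move=> nu; rewrite inE => h; apply: H.
  by rewrite inE mem_cat orbA; case/orP: h => ->; rewrite ?orbT.
have Hs : forall nu, nu \in s ++ mu :: t -> rho < complex.Im nu.
  move=> nu; rewrite mem_cat inE => h; apply: H; rewrite inE mem_cat.
  by case/or3P: h => ->; rewrite ?orbT.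
have t3 : (2 <= size (mu :: t))%N by rewrite ltnW.
apply: (tame_decay_ext (h1 := fun l => (i == j)%:R * (\prod_(nu <- mu :: t) (l - nu)^-1) +
   \sum_k (B - mu%:M) i k * ((\prod_(nu <- mu :: t) (l - nu)^-1) * newton_res s l k j))).
  move=> l; rewrite [in RHS]mxE [X in _ = _ * (_ * X)]mxE [X in _ * (_ * (X + _))]mxE big_cons.
  rewrite [X in _ = _ * (_ * (_ + X))]mxE.
  rewrite !mulrDr !mulr_sumr; congr (_ + _); first by ring.
  by apply: eq_bigr => k _; ring.
apply: tame_decayD.
  apply: tame_decayZ; split; first exact: tame_prod.
  exact: decay_prod.
by apply: tame_decay_sum => k _; apply: tame_decayZ; exact: ih.
Qed.
End Resolvent.

Section ResolventExists.
Context {R : realType} (n : nat) (B : 'M[R[i]]_n).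

Lemma annih_horner (s : seq R[i]) m (C : 'M[R[i]]_m.+1) :
  annih C s = horner_mx C (\prod_(z <- s) ('X - z%:P)).
Proof.
elim: s => [|z s ih] /=; first by rewrite big_nil (rmorph1 (horner_mx C)).
by rewrite big_cons rmorphM rmorphB /= horner_mx_X horner_mx_C ih.
Qed.

Lemma char_roots : exists2 s : seq R[i], (forall z, z \in s -> eigenvalue B z) &
  annih B s = 0.
Proof.
case: n B => [|m] C; first by exists [::] => //; apply/matrixP => -[].
have [s e] := closed_field_poly_normal (char_poly C).
rewrite (monicP (char_poly_monic C)) scale1r in e.
exists s => [z zs|]; last by rewrite annih_horner -e Cayley_Hamilton.
by rewrite eigenvalue_root_char e root_prod_XsubC.
Qed.
End ResolventExists.

(** * The limit of the matrix Fourier integral *)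

Section MatrixFourier.
Context {R : realType} (n : nat) (B : 'M[R[i]]_n) (c : R).
Hypothesis c0 : 0 < c.
Hypothesis Bc : forall z, eigenvalue B z -> - c < complex.Im z.
Implicit Types (a y xi T : R).

(** Finitely many imaginary parts leave a gap above -c, and taking midpoints keeps the inequalities
    strict. The line also stays below 0, where lambda^-1 has its pole. *)
Lemma low_line (s : seq R[i]) : (forall z, z \in s -> - c < complex.Im z) ->
  exists2 rho, - c < rho & rho < 0 /\ forall z, z \in s -> rho < complex.Im z.
Proof.
elim: s => [|z s ih] H.
  by have cp := c0; exists (- c / 2); [lra|split; [lra|]].
have [rho r1 [r2 r3]] := ih (fun w ws => H w (mem_behead (s := z :: s) ws)).
have zc := H z (mem_head _ _).
have m0 : - c < Num.min rho (complex.Im z) by rewrite lt_min r1 zc.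
exists ((- c + Num.min rho (complex.Im z)) / 2); first lra.
have m1 : Num.min rho (complex.Im z) <= rho by rewrite ge_min lexx.
have m2 : Num.min rho (complex.Im z) <= complex.Im z by rewrite ge_min lexx orbT.
have cp := c0; split; first lra.
move=> w; rewrite inE => /orP[/eqP ->|ws]; first lra.
by have := r3 w ws; lra.
Qed.

Lemma resolvent_line : exists Rs : R[i] -> 'M[R[i]]_n, exists2 rho, - c < rho & [/\ rho < 0,
  (forall lam, complex.Im lam < rho -> (lam%:M - B) *m Rs lam = 1%:M) &
  forall i j, tame_decay rho (fun l => (\prod_(mu <- [:: 0; 0]) (l - mu)^-1) * Rs l i j)].
Proof.
have [s se s0] := char_roots B.
have [rho r1 [r2 r3]] := low_line (fun z zs => Bc (se z zs)).
exists (newton_res B s), rho => //; split => //.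
  move=> lam lr; rewrite newton_resP ?s0 ?scaler0 ?subr0// => mu mus.
  by apply/eqP => e; have := r3 mu mus; rewrite -e; lra.
move=> i j; apply: newton_res_tame => // mu; rewrite mem_cat => /orP[/r3//|].
by rewrite !inE => /orP[] /eqP ->.
Qed.

Definition Fmx a y : 'M[R[i]]_n := mxint `[- a, a] (fun xi =>
  (cexp (ii * y%:C%C * Complex xi (- c)) * (Complex xi (- c))^-1) *:
    invmx ((Complex xi (- c))%:M - B)).

Section Line.
Context (Rs : R[i] -> 'M[R[i]]_n) (rho : R).
Hypothesis cr : - c < rho.
Hypothesis rho0 : rho < 0.
Hypothesis RsP : forall lam, complex.Im lam < rho -> (lam%:M - B) *m Rs lam = 1%:M.
Hypothesis Rs_tame :
  forall i j, tame_decay rho (fun l => (\prod_(mu <- [:: 0; 0]) (l - mu)^-1) * Rs l i j).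

Let q2 i j xi := l1 c xi * l1 c xi * Rs (Complex xi (- c)) i j.

Lemma q2E i j xi : (\prod_(mu <- [:: 0; 0]) (Complex xi (- c) - mu)^-1) * Rs (Complex xi (- c)) i j = q2 i j xi.
Proof. by rewrite !big_cons big_nil mulr1 subr0. Qed.

Lemma q2_cont i j xi : ccont (q2 i j) xi.
Proof.
have [[h' [K K0 H]] _] := Rs_tame i j.
have [d _ _ _] := H (Complex xi (- c)) cr.
by apply: ccont_ext (cder_ccont (holo_re d)) => y; rewrite q2E.
Qed.

Lemma q2_bound i j : exists K : R, forall xi, c1 (q2 i j xi) <= K.
Proof.
have [[h' [K K0 H]] _] := Rs_tame i j; exists K => xi.
by have [_ b _ _] := H (Complex xi (- c)) cr; rewrite -q2E.
Qed.

(** The additional 1 / lambda closes the system: the y-derivative is i [Fmx], and lambda (lambda -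
    B)^-1 = 1 + B (lambda - B)^-1 expresses [Fmx] by [Gmx] and the scalar integral [Vv]. *)
Definition Gmx a y : 'M[R[i]]_n := \matrix_(i, j) Fint (- c) (q2 i j) a y.

Lemma q2_mul i j xi : Complex xi (- c) * q2 i j xi =
  (i == j)%:R * (l1 c xi * l1 c xi) + \sum_k B i k * q2 k j xi.
Proof.
have := RsP (lam := Complex xi (- c)) cr => /matrixP/(_ i j).
rewrite mulmxBl mul_scalar_mx !mxE => /eqP; rewrite subr_eq => /eqP e.
rewrite /q2 mulrCA e mulrDr mulrC; congr (_ + _); rewrite mulr_sumr.
by apply: eq_bigr => k _; ring.
Qed.

Lemma ccont_l1l1 xi : ccont (fun xi => l1 c xi * l1 c xi) xi.
Proof. by apply: ccontM; exact: ccont_l1. Qed.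

Lemma Fint_q2 i j a y : Fint (- c) (fun xi => Complex xi (- c) * q2 i j xi) a y =
  ((Vv c a y)%:M + B *m Gmx a y) i j.
Proof.
rewrite (eq_Fint _ _ _ (q2_mul i j)) FintD.
- rewrite FintZ; last exact: ccont_l1l1.
  rewrite [in RHS]mxE [X in _ = X + _]mxE mulr_natl [X in _ = _ + X]mxE; congr (_ + _).
  rewrite /Fint.
  under cint_ext => xi _ do rewrite mulr_sumr.
  rewrite cint_sum//.
    apply: eq_bigr => k _; rewrite mxE -FintZ; last exact: q2_cont.
    by [].
  move=> k _; apply: cintegrable_Fint => xi; apply: ccontM (ccont_cst _ _) _.
  exact: q2_cont.
- by move=> xi; apply: ccontM (ccont_cst _ _) _; exact: ccont_l1l1.
- move=> xi; apply: ccont_sum => k _; apply: ccontM (ccont_cst _ _) _.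
  exact: q2_cont.
Qed.

Lemma Gmx_der a y : 0 <= a ->
  is_mder (Gmx a) y ((ii *: B) *m Gmx a y + (ii * Vv c a y)%:M).
Proof.
move=> a0 i j; have [K HK] := q2_bound i j.
have d := Fint_der (- c) y a0 (q2_cont i j) HK.
apply: (cder_ext (f := Fint (- c) (q2 i j) a)) => [z|]; first by rewrite mxE.
apply: cder_eq d _.
under eq_Fint => xi do rewrite -mulrA.
rewrite FintZ; last first.
  move=> xi; apply: ccontM (q2_cont _ _ _).
  exact: cder_ccont (cder_Complex _ _).
rewrite Fint_q2 -scalemxAl -scale_scalar_mx -scalerDr [RHS]mxE; congr (_ * _).
by rewrite addrC.
Qed.

Lemma FmxE a y : Fmx a y = (Vv c a y)%:M + B *m Gmx a y.
Proof.
apply/matrixP => i j; rewrite mxintE -Fint_q2; apply: cint_ext => xi _.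
rewrite mxE -[LHS]mulrA; congr (_ * _).
have u : (Complex xi (- c))%:M - B \in unitmx by case: (mulmx1_unit (RsP (lam := Complex xi (- c)) cr)).
have -> : invmx ((Complex xi (- c))%:M - B) = Rs (Complex xi (- c)).
  by rewrite -[RHS]mul1mx -(mulVmx u) -mulmxA RsP// mulmx1.
rewrite /q2 /l1 !mulrA divff ?mul1r//.
by apply: Complex_neq0; apply: nc0.
Qed.

(** Cauchy's theorem at y = 0. It supplies the initial value of the equation in y, so that Cauchy's
    theorem for the matrix integral is needed at this single point only. *)
Lemma Gmx0 : forall e : R, 0 < e -> \forall a \near +oo, mnorm (Gmx a 0) <= e.
Proof.
move=> e e0.
have h i j : \forall a \near +oo, c1 (Gmx a 0 i j) <= e / (n * n)%:R.
  have [tm [D [A dec]]] := Rs_tame i j.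
  have D0 : 0 <= D by case: dec.
  have A1 : 1 <= A by case: dec.
  have n0 : 0 < (n * n)%:R :> R by rewrite ltr0n muln_gt0 andbb (leq_ltn_trans (leq0n i) (ltn_ord i)).
  near=> a.
  have a1 : c <= a by near: a; apply: nbhs_pinfty_ge; exact: num_real.
  have a2 : A <= a by near: a; apply: nbhs_pinfty_ge; exact: num_real.
  have a3 : 8 * (2 * D) * (n * n)%:R / e <= a by near: a; apply: nbhs_pinfty_ge; exact: num_real.
  have a0 : 0 < a by rewrite (lt_le_trans _ a2)// (lt_le_trans ltr01).
  have tm' := tameM (tame_cexp (ltW rho0) (lexx 0)) tm.
  have := line_int_decay tm' (decays_cexpM (lexx 0) dec) (eta := - c) (a := a) cr.
  rewrite (_ : line_int _ _ _ = Gmx a 0 i j); last first.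
    by rewrite mxE; apply: cint_ext => xi _; rewrite q2E.
  rewrite opprK oppr_le0 (ltW c0) => /(_ isT a1 a2) h; apply: le_trans h _.
  have a4 : 8 * (2 * D) * (n * n)%:R <= a * e by rewrite -ler_pdivrMr.
  by rewrite ler_pdivrMr// mulrAC ler_pdivlMr// [e * a]mulrC.
have h2 : \forall a \near +oo, forall ij : 'I_n * 'I_n, c1 (Gmx a 0 ij.1 ij.2) <= e / (n * n)%:R.
  by apply: filter_forall => -[i j]; exact: h.
apply: filterS h2 => a H.
apply: (@le_trans _ _ (\sum_(i < n) \sum_(j < n) (e / (n * n)%:R))).
  by apply: ler_sum => i _; apply: ler_sum => j _; exact: (H (i, j)).
rewrite !sumr_const !card_ord -mulrnA -[leLHS]mulr_natr.
have [->|n0] := posnP (n * n)%N; first by rewrite mulr0 ltW.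
by rewrite divfK// pnatr_eq0 -lt0n.
Unshelve. all: by end_near. Qed.
End Line.

Lemma mder_usubmx q1 q2 r (F : R -> 'M[R[i]]_(q1 + q2, r)) y D :
  is_mder F y D -> is_mder (fun y => usubmx (F y)) y (usubmx D).
Proof. by move=> h i j; rewrite mxE; apply: cder_ext (h _ _) => z; rewrite mxE. Qed.

Lemma mder_dsubmx q1 q2 r (F : R -> 'M[R[i]]_(q1 + q2, r)) y D :
  is_mder F y D -> is_mder (fun y => dsubmx (F y)) y (dsubmx D).
Proof. by move=> h i j; rewrite mxE; apply: cder_ext (h _ _) => z; rewrite mxE. Qed.

Lemma mder_scalar_id y : is_mder (fun y => (y%:C%C)%:M : 'M[R[i]]_n) y 1%:M.
Proof.
move=> i j; rewrite mxE; apply: (cder_ext (f := fun y => y%:C%C * (i == j)%:R)).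
  by move=> z; rewrite mxE mulr_natr.
by apply: cder_eq (cderZr _ (cder_id y)) _; rewrite mul1r.
Qed.

(* The solution is read off the exponential of the block matrix of the
   system W' = M W + Y, Y' = 1. *)
Lemma linear_forcing (M : 'M[R[i]]_n) : exists W : R -> 'M[R[i]]_n, W 0 = 0 /\ forall y, is_mder W y (M *m W y + (y%:C%C)%:M).
Proof.
pose P := block_mx 0 1%:M 0 0 : 'M[R[i]]_(n + n).
pose A := block_mx M (row_mx 1%:M 0) 0 P : 'M[R[i]]_(n + (n + n)).
pose Z0 := col_mx 0 1%:M : 'M[R[i]]_(n + n, n).
pose Y y := expmx (y%:C%C *: A) *m col_mx (0 : 'M[R[i]]_n) Z0.
have dY y : is_mder Y y (A *m Y y).
  by apply: mder_eq (mderMr _ (mder_expmx A y)) _; rewrite mulmxA.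
have AY y : A *m Y y = col_mx (M *m usubmx (Y y) + row_mx 1%:M 0 *m dsubmx (Y y))
    (P *m dsubmx (Y y)).
  by rewrite -{1}(vsubmxK (Y y)) mul_block_col mul0mx add0r.
have Y0 : Y 0 = col_mx 0 Z0 by rewrite /Y scale0r expmx0 mul1mx.
have dD y : is_mder (fun y => dsubmx (Y y)) y (P *m dsubmx (Y y)).
  by apply: mder_eq (mder_dsubmx (dY y)) _; rewrite AY col_mxKd.
have dE y : is_mder (fun y => col_mx (y%:C%C)%:M 1%:M : 'M[R[i]]_(n + n, n)) y
    (P *m col_mx (y%:C%C)%:M 1%:M).
  apply: mder_eq (mder_col_mx (mder_scalar_id y) (mder_cst 1%:M y)) _.
  by rewrite mul_block_col !mul0mx mul1mx !add0r.
have E y : dsubmx (Y y) = col_mx (y%:C%C)%:M 1%:M.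
  rewrite (expmx_ode y dD) (expmx_ode y dE) Y0 col_mxKd; congr (_ *m _).
  by rewrite /Z0 raddf0.
exists (fun y => usubmx (Y y)); split; first by rewrite Y0 col_mxKu.
move=> y; apply: mder_eq (mder_usubmx (dY y)) _.
by rewrite AY col_mxKu E mul_row_col mul1mx mul0mx addr0.
Qed.

(** The derivative of e^(-tM) [Dl] is r(t) e^(-tM), and the mean value bound integrates it. The
    bound on [r] is asked only between 0 and y, because the forcing term is compared with different
    limits on the two half-lines. *)
Lemma gronwall (M : 'M[R[i]]_n) T : 0 <= T -> exists2 K : R, 0 <= K &
  forall (Dl : R -> 'M[R[i]]_n) (r : R -> R[i]) (e y : R), `|y| <= T ->
  (forall t, is_mder Dl t (M *m Dl t + (r t)%:M)) ->
  (forall t, `|t| <= T -> (0 <= t <= y) || (y <= t <= 0) -> c1 (r t) <= e) -> mnorm (Dl 0) <= e ->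
  mnorm (Dl y) <= K * e.
Proof.
move=> T0.
have [K1 K10 HK] : exists2 K, 0 <= K & forall x, - T <= x <= T -> mnorm (expmx (x%:C%C *: M)) <= K.
  by apply: mcont_bounded => x _; exact: mder_mcont (mder_expmx M x).
exists (K1 * (1 + 2 * n%:R * n%:R * K1 * T)).
  by rewrite mulr_ge0// addr_ge0// !mulr_ge0.
move=> Dl r e y yT dDl hr D0.
have e0 : 0 <= e := le_trans (mnorm_ge0 _) D0.
pose E t := expmx ((- t)%:C%C *: M) *m Dl t.
have dE t : is_mder E t (r t *: expmx ((- t)%:C%C *: M)).
  apply: mder_eq (mderM (mder_expmxN M t) (dDl t)) _.
  rewrite mulmxDr addrA (comm_cancel _ (expmx_comm M (- t))) add0r.
  by rewrite scalar_mxC mul_scalar_mx.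
have bd t : `|t| <= T -> (0 <= t <= y) || (y <= t <= 0) -> mnorm (r t *: expmx ((- t)%:C%C *: M)) <= e * K1.
  move=> tT ty; apply: le_trans (mnormZ _ _) _.
  apply: ler_pM; rewrite ?c1_ge0 ?mnorm_ge0 ?hr//.
  by apply: HK; rewrite -ler_norml normrN.
have E0 : E 0 = Dl 0 by rewrite /E oppr0 scale0r expmx0 mul1mx.
have EE : mnorm (E y - E 0) <= 2 * n%:R * n%:R * (e * K1) * T.
  have [y0|y0] := leP 0 y.
    apply: (@le_trans _ _ (2 * n%:R * n%:R * (e * K1) * (y - 0))).
      apply: mder_bound y0 (fun t _ => dE t) _ => t /andP[t0 ty]; apply: bd.
        by rewrite ger0_norm// (le_trans ty)// (le_trans _ yT)// ler_norm.
      by rewrite t0 ty.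
    apply: ler_wpM2l; first by rewrite !mulr_ge0.
    by rewrite subr0 (le_trans _ yT)// ler_norm.
  rewrite -mnormN opprB.
  apply: (@le_trans _ _ (2 * n%:R * n%:R * (e * K1) * (0 - y))).
    apply: mder_bound (ltW y0) (fun t _ => dE t) _ => t /andP[ty t0]; apply: bd.
      by rewrite ler0_norm// (le_trans _ yT)// ltr0_norm// lerN2.
    by rewrite ty t0 orbT.
  apply: ler_wpM2l; first by rewrite !mulr_ge0.
  by rewrite sub0r (le_trans _ yT)// -normrN ler_norm.
have Ey : mnorm (E y) <= e + 2 * n%:R * n%:R * (e * K1) * T.
  rewrite -[E y](subrK (E 0)) addrC; apply: le_trans (mnormD _ _) (lerD _ EE).
  by rewrite E0.
have -> : Dl y = expmx (y%:C%C *: M) *m E y by rewrite /E mulmxA expmxKN mul1mx.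
apply: le_trans (mnormM _ _) _.
apply: le_trans (ler_pM (mnorm_ge0 _) (mnorm_ge0 _) (HK y _) Ey) _.
  by rewrite -ler_norml.
by rewrite le_eqVlt; apply/orP; left; apply/eqP; ring.
Qed.

Lemma Fmx_limit : exists F : R -> 'M[R[i]]_n, [/\ F 0 = 0,
  forall y, is_mder F y ((- 2 * pi)%:C%C *: expmx (y%:C%C *: (ii *: B))) &
  forall T e, 0 <= T -> 0 < e -> \forall a \near +oo, forall y, `|y| <= T ->
    mnorm (Fmx a y - F (Num.max y 0)) <= e].
Proof.
have [Rs [rho cr [rho0 RsP Rs_tame]]] := resolvent_line.
have [W [W0 dW]] := linear_forcing (ii *: B).
(* For y > 0 the forcing tends to -2 pi i y, so G tends to -2 pi i W and V + B G to this function.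
   Its derivative [D] solves D' = i B D with D(0) = -2 pi, which makes it an exponential. *)
pose F y := (- 2 * pi)%:C%C *: ((y%:C%C)%:M + (ii *: B) *m W y).
have F0 : F 0 = 0 by rewrite /F W0 mulmx0 addr0 raddf0 scaler0.
pose D y := (ii *: B) *m F y + (- 2 * pi)%:C%C%:M.
have dF y : is_mder F y (D y).
  apply: mder_eq (mderZl _ (mderD (mder_scalar_id y) (mderMl (ii *: B) (dW y)))) _.
  rewrite /D /F -scalemxAr [RHS]addrC -[(- 2 * pi)%:C%C%:M]scalemx1 -scalerDr.
  by congr (_ *: (_ + _ *m _)); exact: addrC.
have DE y : D y = (- 2 * pi)%:C%C *: expmx (y%:C%C *: (ii *: B)).
  have dD t : is_mder D t ((ii *: B) *m D t).
    apply: mder_eq (mderD (mderMl (ii *: B) (dF t)) (mder_cst _ t)) _.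
    by rewrite addr0.
  by rewrite (expmx_ode y dD) /D F0 mulmx0 add0r scalar_mxC mul_scalar_mx.
exists F; split => // [y|T e T0 e0]; first by rewrite -DE.
have [K K0 HK] := gronwall (ii *: B) T0.
(* Total weight of the errors of V and of B G; the added 1 makes it positive. *)
pose N := n%:R + mnorm B * K + 1 : R.
have N0 : 0 < N by rewrite /N ltr_wpDl// addr_ge0// mulr_ge0// mnorm_ge0.
pose e1 := e / N; have e10 : 0 < e1 by rewrite divr_gt0.
have [A A0 HA] := Vv_limit c0 T0 e10.
near=> a; move=> y yT.
have a1 : A <= a by near: a; apply: nbhs_pinfty_ge; exact: num_real.
have a0 : 0 <= a by rewrite (le_trans (ltW A0)).
have G0 : mnorm (Gmx Rs a 0) <= e1 by near: a; exact: Gmx0 cr rho0 Rs_tame e1 e10.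
have ns (z : R[i]) : c1 z <= e1 -> mnorm (z%:M : 'M[R[i]]_n) <= n%:R * e1.
  move=> ze; rewrite /mnorm.
  have -> : n%:R * e1 = \sum_(i < n) e1 by rewrite sumr_const card_ord mulr_natl.
  apply: ler_sum => i _; rewrite (bigD1 i)//= big1 => [|j ji].
    by rewrite mxE eqxx mulr1n addr0.
  by rewrite mxE eq_sym (negbTE ji) mulr0n c10.
have fin (z : R[i]) (G : 'M[R[i]]_n) : c1 z <= e1 -> mnorm G <= K * e1 ->
    mnorm (z%:M + B *m G) <= e.
  move=> hz hG; apply: le_trans (mnormD _ _) _.
  have -> : e = n%:R * e1 + mnorm B * (K * e1) + e1.
    by rewrite -[LHS](divfK (lt0r_neq0 N0)) -/e1 /N; ring.
  rewrite ler_wpDr ?(ltW e10)//; apply: lerD; first exact: ns.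
  by apply: le_trans (mnormM _ _) _; rewrite ler_wpM2l ?mnorm_ge0.
rewrite (FmxE cr RsP Rs_tame).
have dG t := Gmx_der cr RsP Rs_tame t a0.
have [y0|y0] := leP y 0.
  rewrite F0 subr0; apply: fin.
    by have := HA a y a1 yT; rewrite (max_r y0) mulr0 addr0.
  apply: HK yT dG _ G0 => t tT ty.
  apply: le_trans (c1M _ _) _; rewrite c1_i mul1r.
  have t0 : t <= 0 by case/orP: ty => /andP[]// _ /le_trans; apply.
  by have := HA a t a1 tT; rewrite (max_r t0) mulr0 addr0.
pose Gp t := ((- 2 * pi)%:C%C * ii) *: W t.
have two x : (2 * pi * x)%:C%C = - ((- 2 * pi)%:C%C * x%:C%C) :> R[i].
  by rewrite -rmorphM -rmorphN; congr (_%:C%C); ring.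
have sB (u v : R[i]) : (u - v)%:M = u%:M - v%:M :> 'M[R[i]]_n by exact: raddfB.
have -> : (Vv c a y)%:M + B *m Gmx Rs a y - F y =
    (Vv c a y + (2 * pi * y)%:C%C)%:M + B *m (Gmx Rs a y - Gp y).
  rewrite /F /Gp mulmxBr -scalemxAr -scalemxAl scalerDr scalerA opprD addrACA.
  by rewrite two sB scale_scalar_mx.
have Gp0 : Gp 0 = 0 by rewrite /Gp W0 scaler0.
apply: fin.
  by have := HA a y a1 yT; rewrite (max_l (ltW y0)).
have dD t : is_mder (fun t => Gmx Rs a t - Gp t) t
    ((ii *: B) *m (Gmx Rs a t - Gp t) + (ii * (Vv c a t + (2 * pi * t)%:C%C))%:M).
  apply: mder_eq (mderB (dG t) (mderZl _ (dW t))) _.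
  rewrite mulmxBr /Gp -[(ii *: B) *m (_ *: W t)]scalemxAr scalerDr opprD addrACA.
  congr (_ + _); rewrite scale_scalar_mx -sB; congr (_%:M).
  by rewrite two; ring.
apply: (HK (fun t => Gmx Rs a t - Gp t) _ _ _ yT dD); last by rewrite Gp0 subr0.
move=> t tT ty; apply: le_trans (c1M _ _) _; rewrite c1_i mul1r.
have t0 : 0 <= t by case/orP: ty => /andP[]// h1 _; rewrite (le_trans (ltW y0)).
by have := HA a t a1 tT; rewrite (max_l t0).
Unshelve. all: by end_near. Qed.
End MatrixFourier.

(** * The Fourier integral of phi *)

Section FourierIdentification.
Context {R : realType} (n p : nat) (th1 th2 : 'M[R[i]]_(n, p)) (beta : 'M[R[i]]_n)
  (Ru : 'M[R[i]]_p) (dd : 'I_p -> R) (c : R).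
Hypothesis c0 : 0 < c.
Hypothesis Bc : forall z, eigenvalue (2 *: beta) z -> - c < complex.Im z.
Local Notation mu := (@lebesgue_measure R).
Implicit Types (a x y xi T : R).

Local Notation B := (2 *: beta).
Local Notation D := (diag_mx (\row_m (dd m)%:C%C)).

Definition columns (E : 'I_p -> 'M[R[i]]_n) : 'M[R[i]]_(n, p) :=
  \matrix_(i, m) (E m *m col m th2) i ord0.

Definition Fker xi y : 'M[R[i]]_n :=
  (cexp (ii * y%:C%C * Complex xi (- c)) * (Complex xi (- c))^-1) *:
    invmx ((Complex xi (- c))%:M - B).

Lemma Fker_mcont y xi : mcont (fun xi => Fker xi y) xi.
Proof.
have [Rs [rho cr [rho0 RsP Rs_tame]]] := resolvent_line c0 Bc.
move=> i j; apply: (ccont_ext (f := fun xi => cexp (ii * y%:C%C * Complex xi (- c)) *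
   (Complex xi (- c) * (l1 c xi * l1 c xi * Rs (Complex xi (- c)) i j)))) => [z|].
  have nz : Complex z (- c) != 0 by apply: Complex_neq0; apply: nc0.
  rewrite /Fker mxE -[RHS]mulrA; congr (_ * _).
  have u : (Complex z (- c))%:M - B \in unitmx.
    by case: (mulmx1_unit (RsP (Complex z (- c)) cr)).
  have -> : invmx ((Complex z (- c))%:M - B) = Rs (Complex z (- c)).
    by rewrite -[RHS]mul1mx -(mulVmx u) -mulmxA RsP// mulmx1.
  by rewrite /l1 !mulrA divff ?mul1r.
apply: ccont_Fint; apply: ccontM; first exact: cder_ccont (cder_Complex _ _).
exact: q2_cont cr Rs_tame i j xi.
Qed.

Lemma Fmx_mcont a y : 0 <= a -> mcont (Fmx B c a) y.
Proof.
move=> a0.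
have [Rs [rho cr [rho0 RsP Rs_tame]]] := resolvent_line c0 Bc.
apply: (mcont_ext (F := fun y => (Vv c a y)%:M + B *m Gmx c Rs a y)) => [z|].
  by rewrite (FmxE c0 cr RsP).
apply: mcontD; last first.
  apply: mcontM; first exact: mcont_cst.
  exact: mder_mcont (Gmx_der c0 cr RsP Rs_tame y a0).
move=> i j; apply: (ccont_ext (f := fun y => Vv c a y * (i == j)%:R)) => [z|].
  by rewrite mxE mulr_natr.
apply: ccontM (ccont_cst _ _).
apply: cder_ccont (Fint_der (- c) y a0 (ccont_l1l1 c0) (K := 2 / c * (2 / c)) _).
by move=> xi; apply: c1M_le; exact: c1_l1.
Qed.

(** The factor e^(-i lambda d_m) on the m-th column is a shift of x by d_m, so each column is
    evaluated at its own argument. *)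
Definition profile (E : R -> 'M[R[i]]_n) x : 'M[R[i]]_p :=
  th1^t* *m columns (fun m => E (x - dd m)) *m Ru.

(** Halving lambda turns beta into 2 beta and brings a factor 2. Replacing e^(i xi x) by e^(i lambda
    x) on the line Im lambda = -c brings e^(-cx). *)
Lemma fourier_integrand xi x :
  (cexp (ii * (xi * x)%:C%C) * (Complex xi (- c))^-1) *:
    phi th1 th2 beta D Ru (Complex xi (- c) / 2%:R) =
  (2 * ii * (expR (- c * x))%:C%C) *: profile (Fker xi) x.
Proof.
set lam := Complex xi (- c).
have two0 : (2 : R[i]) != 0 by rewrite pnatr_eq0.
have -> : phi th1 th2 beta D Ru (lam / 2%:R) = (2 * ii) *: (th1^t* *m
    (invmx (lam%:M - B) *m th2 *m diag_mx (\row_m cexp (- ii * lam * (dd m)%:C%C))) *m Ru).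
  rewrite /phi.
  have -> : (lam / 2%:R)%:M - beta = 2^-1 *: (lam%:M - B).
    by rewrite scalerBr scalerA mulVf// scale1r scale_scalar_mx mulrC.
  have -> : (- 2%:R * ii * (lam / 2%:R)) *: D = diag_mx (\row_m (- ii * lam * (dd m)%:C%C)).
    apply/matrixP => i j; rewrite !mxE -mulrnAr; congr (_ * _).
    by field.
  rewrite expmx_diag.
  have u : lam%:M - B \in unitmx.
    have [Rs [rho cr [rho0 RsP Rs_tame]]] := resolvent_line c0 Bc.
    by case: (mulmx1_unit (RsP lam cr)).
  rewrite invmxZ; last first.
    by rewrite unitmxZ// unitfE invr_eq0.
  rewrite invrK -!scalemxAr -!scalemxAl scalerA [ii * 2]mulrC !mulmxA.
  have -> : \row_j cexp ((\row_m (- ii * lam * (dd m)%:C%C)) ord0 j) =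
      \row_m cexp (- ii * lam * (dd m)%:C%C) :> 'rV_p.
    by apply/rowP => j; rewrite !mxE.
  by [].
have -> : profile (Fker xi) x = th1^t* *m ((expR (c * x))%:C%C *: ((cexp (ii * (xi * x)%:C%C) * lam^-1) *:
    (invmx (lam%:M - B) *m th2 *m diag_mx (\row_m cexp (- ii * lam * (dd m)%:C%C))))) *m Ru.
  rewrite /profile; apply: (f_equal (fun z => th1^t* *m z *m Ru)); apply/matrixP => i m.
  rewrite mul_mx_diag scalerA [LHS]mxE mxE [in RHS]mxE [in RHS]mxE [in RHS]mxE [in RHS]mxE.
  rewrite mulr_suml mulr_sumr; apply: eq_bigr => k _; rewrite 2!mxE -/lam.
  have -> : cexp (ii * (x - dd m)%:C%C * lam) = (expR (c * x))%:C%C * cexp (ii * (xi * x)%:C%C) *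
      cexp (- ii * lam * (dd m)%:C%C).
    rewrite -cexpR -!cexpD; congr cexp; rewrite /lam; apply: complex_ext; rewrite !ReImE; ring.
  ring.
rewrite -scalemxAr -scalemxAl -[in RHS]scalemxAr -[in RHS]scalemxAl !scalerA; congr (_ *: _).
have e1 : (expR (- c * x))%:C%C * (expR (c * x))%:C%C = 1 :> R[i].
  by rewrite -rmorphM -expRD mulNr addNr expR0.
by transitivity (2 * ii * (cexp (ii * (xi * x)%:C%C) * lam^-1) * ((expR (- c * x))%:C%C * (expR (c * x))%:C%C)); [rewrite e1 mulr1; ring|ring].
Qed.

Lemma columns_mcont (E : 'I_p -> R -> 'M[R[i]]_n) x :
  (forall m, mcont (E m) x) -> mcont (fun x => columns (fun m => E m x)) x.
Proof.
move=> cE i m; apply: (ccont_ext (f := fun x => \sum_k E m x i k * th2 k m)) => [y|].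
  by rewrite [RHS]mxE mxE; apply: eq_bigr => k _; rewrite [in RHS]mxE.
by apply: ccont_sum => k _; apply: ccontM (ccont_cst _ _); exact: cE.
Qed.

Lemma mcont_mx_integrable q r a b (F : R -> 'M[R[i]]_(q, r)) :
  (forall x, mcont F x) -> mx_integrable `[a, b] F.
Proof.
by move=> cF i j; apply: cintegrable_cont => x _; exact: cF.
Qed.

Lemma profile_mxint a x : mxint `[- a, a] (fun xi => profile (Fker xi) x) =
  profile (Fmx B c a) x.
Proof.
have cc xi : mcont (fun xi => columns (fun m => Fker xi (x - dd m))) xi.
  by apply: columns_mcont => m; exact: Fker_mcont.
have i1 := mcont_mx_integrable (- a) a cc.
have mI : measurable (`[- a, a] : set R) by [].
transitivity (th1^t* *m mxint `[- a, a] (fun xi => columns (fun m => Fker xi (x - dd m))) *m Ru).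
  rewrite -(mxintMl _ mI i1) -(mxintMr _ mI (mx_integrableMl _ mI i1)).
  by apply: mxint_ext => xi _.
rewrite /profile; apply: (f_equal (fun z => th1^t* *m z *m Ru)); apply/matrixP => i m; rewrite mxintE [RHS]mxE mxE.
have ci k xi : ccont (fun xi => Fker xi (x - dd m) i k) xi by exact: Fker_mcont.
transitivity (\sum_k cint `[- a, a] (fun xi => th2 k m * Fker xi (x - dd m) i k)).
  rewrite -cint_sum//; last by move=> k _; apply: cintegrableZ => //; apply: cintegrable_cont => xi _; exact: ci.
  apply: cint_ext => xi _; rewrite [LHS]mxE mxE; apply: eq_bigr => k _.
  by rewrite mulrC [in LHS]mxE.
apply: eq_bigr => k _; rewrite cintZ//; last by apply: cintegrable_cont => xi _; exact: ci.
by rewrite mulrC -mxintE; congr (_ * _); rewrite mxE.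
Qed.

Lemma fourier_partE a x :
  fourier_part (phi th1 th2 beta D Ru) (- c) a x =
  (2 * ii * (expR (- c * x))%:C%C) *: profile (Fmx B c a) x.
Proof.
have cc xi : mcont (fun xi => columns (fun m => Fker xi (x - dd m))) xi.
  by apply: columns_mcont => m; exact: Fker_mcont.
have mI : measurable (`[- a, a] : set R) by [].
have i2 := mx_integrableMr Ru mI (mx_integrableMl (th1^t* ) mI (mcont_mx_integrable (- a) a cc)).
rewrite -profile_mxint -(mxintZ _ mI i2).
by apply: mxint_ext => xi _; exact: fourier_integrand.
Qed.

Lemma profile_bound : exists2 K : R, 0 <= K & forall (E : R -> 'M[R[i]]_n) x (e : R),
  (forall m, mnorm (E (x - dd m)) <= e) -> mnorm (profile E x) <= K * e.
Proof.
pose K0 := \sum_(m < p) mnorm (col m th2).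
have K00 : 0 <= K0 by apply: sumr_ge0 => m _; exact: mnorm_ge0.
exists (mnorm (th1^t* ) * K0 * mnorm Ru); first by rewrite !mulr_ge0// mnorm_ge0.
move=> E x e He; apply: le_trans (mnormM _ _) _.
rewrite [leRHS]mulrAC ler_wpM2r ?mnorm_ge0//; apply: le_trans (mnormM _ _) _.
rewrite -mulrA ler_wpM2l ?mnorm_ge0//.
rewrite /mnorm exchange_big /= mulr_suml; apply: ler_sum => m _.
apply: (@le_trans _ _ (mnorm (E (x - dd m) *m col m th2))).
  apply: ler_sum => i _; rewrite big_ord1.
  suff -> : columns (fun m => E (x - dd m)) i m = (E (x - dd m) *m col m th2) i ord0 by [].

  by rewrite mxE.
by apply: le_trans (mnormM _ _) _; rewrite mulrC ler_wpM2l ?mnorm_ge0.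
Qed.

Lemma profileB (E F : R -> 'M[R[i]]_n) x :
  profile E x - profile F x = profile (fun y => E y - F y) x.
Proof.
rewrite /profile -mulmxBl -mulmxBr; apply: (f_equal (fun z => th1^t* *m z *m Ru)); apply/matrixP => i m.
by rewrite !mxE -sumrB; apply: eq_bigr => k _; rewrite !mxE mulrBl.
Qed.

Lemma fourier_part_limit : exists F : R -> 'M[R[i]]_n, [/\ F 0 = 0,
  forall y, is_mder F y ((- 2 * pi)%:C%C *: expmx (y%:C%C *: (ii *: B))) &
  forall l e, 0 < l -> 0 < e -> \forall a \near +oo, forall x, 0 < x < l ->
    mnorm (fourier_part (phi th1 th2 beta D Ru) (- c) a x -
     (2 * ii * (expR (- c * x))%:C%C) *: profile (fun y => F (Num.max y 0)) x) <= e].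
Proof.
have [F [F0 dF HF]] := Fmx_limit c0 Bc; exists F; split => // l e l0 e0.
have [K K0 HK] := profile_bound.
(* This range contains every shifted argument x - d_m with 0 < x < l. *)
pose T := l + \sum_m `|dd m|.
have Td m : `|dd m| <= \sum_m `|dd m|.
  by rewrite (bigD1 m)//= lerDl; apply: sumr_ge0 => j _; exact: normr_ge0.
have T0 : 0 <= T by rewrite addr_ge0// ?(ltW l0)//; apply: sumr_ge0 => j _; exact: normr_ge0.
pose e1 := e / (2 * (K + 1)).
have K1 : 0 < K + 1 by rewrite ltr_wpDl.
have e10 : 0 < e1 by rewrite divr_gt0// mulr_gt0.
apply: filterS (HF T e1 T0 e10) => a Ha x /andP[x0 xl].
rewrite fourier_partE -scalerBr profileB; apply: le_trans (mnormZ _ _) _.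
have b1 : c1 (2 * ii * (expR (- c * x))%:C%C) <= 2 :> R.
  have -> : 2 * ii * (expR (- c * x))%:C%C = Complex 0 (2 * expR (- c * x)) :> R[i].
    by apply: complex_ext; rewrite !ReImE /=; ring.
  rewrite /c1 /= normr0 add0r ger0_norm ?mulr_ge0 ?expR_ge0//.
  by rewrite ler_piMr// expR_le1 mulNr oppr_le0 mulr_ge0// ltW.
have b2 : mnorm (profile (fun y => Fmx B c a y - F (Num.max y 0)) x) <= K * e1.
  apply: HK => m; apply: Ha; apply: le_trans (ler_normB _ _) _.
  by rewrite /T lerD// ger0_norm ltW.
apply: le_trans (ler_pM _ _ b1 b2) _; rewrite ?c1_ge0 ?mnorm_ge0//.
have -> : 2 * (K * e1) = e * (K / (K + 1)).
  by rewrite /e1; field; rewrite gt_eqF.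
by rewrite ler_piMr ?(ltW e0)// ler_pdivrMr// mul1r lerDl.
Qed.

Lemma profile_mcont (E : R -> 'M[R[i]]_n) x : (forall y, mcont E y) -> mcont (profile E) x.
Proof.
move=> cE; apply: mcontM (mcont_cst _ _); apply: mcontM (mcont_cst _ _) _.
apply: columns_mcont => m; apply: (mcont_comp (h := fun x => x - dd m)); last exact: cE.
by apply: (@continuousB R R R _ _ x) => //; exact: cst_continuous.
Qed.

Lemma cexp_part_mcont x : ccont (fun x => 2 * ii * (expR (- c * x))%:C%C) x.
Proof.
apply: ccontM (ccont_cst _ _) _; apply: ccont_ext (cder_ccont (cder_cexp (cderZl (- c)%:C%C (cder_id x)))) => y.
by rewrite -cexpR rmorphM.
Qed.

Lemma fourier_part_mcont a x : 0 <= a ->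
  mcont (fun x => fourier_part (phi th1 th2 beta D Ru) (- c) a x) x.
Proof.
move=> a0; apply: (mcont_ext (F := fun x => (2 * ii * (expR (- c * x))%:C%C) *: profile (Fmx B c a) x)) => [y|].
  by rewrite fourier_partE.
have h := profile_mcont x (fun y => Fmx_mcont y a0).
move=> i j; apply: ccont_ext (ccontM (cexp_part_mcont x) (h i j)) => y.
by rewrite [RHS]mxE.
Qed.

End FourierIdentification.

(** * The kernel k in closed form *)

Section MeasureLemmas.
Context {R : realType}.
Local Notation mu := (@lebesgue_measure R).
Implicit Types (h : R -> R) (x l e : R).

Lemma mcont_measurable q r (F : R -> 'M[R[i]]_(q, r)) (D : set R) : measurable D ->
  (forall x, mcont F x) -> mx_measurable D F.
Proof.
move=> mD cF i j; split; apply: measurable_funS (measurableT : measurable setT) _ _ => //;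
  by apply: continuous_measurable_fun => x; case: (cF x i j).
Qed.

Lemma sqnormD_le (z w : R[i]) : sqnorm (z + w) <= 2 * (sqnorm z + sqnorm w).
Proof.
rewrite /sqnorm !ReImE.
have := sqr_ge0 (complex.Re z - complex.Re w); have := sqr_ge0 (complex.Im z - complex.Im w); nra.
Qed.

Lemma measurable_sqnorm (D : set R) (f : R -> R[i]) :
  measurable_fun D (fun x => complex.Re (f x)) -> measurable_fun D (fun x => complex.Im (f x)) ->
  measurable_fun D (fun x => (sqnorm (f x))%:E).
Proof.
move=> m1 m2; apply/measurable_EFinP.
by apply: measurable_funD; apply: measurable_funX.
Qed.

Lemma negligible_itv_ex (A : set R) (a b : R) : a < b -> mu.-negligible A ->
  exists2 y, a < y < b & ~ A y.
Proof.
move=> ab [N [mN N0 AN]]; apply: contrapT => H.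
have sub : `]a, b[%classic `<=` N.
  move=> y /=; rewrite in_itv /= => yab; apply: AN; apply: contrapT => nA.
  by apply: H; exists y.
have h := le_measure mu (mem_set (measurable_itv `]a, b[)) (mem_set mN) sub.
have e : mu `]a, b[ = (b - a)%:E by rewrite lebesgue_measure_itv /= lte_fin ab.
suff : ((b - a)%:E <= 0 :> \bar R)%E by rewrite lee_fin subr_le0 leNgt ab.
apply: (@le_trans _ _ (mu `]a, b[)); first by rewrite e.
by apply: le_trans h _; rewrite le_eqVlt; apply/orP; left; apply/eqP; exact: N0.
Qed.

(** A null set contains no interval, so zeros of h accumulate at x from the right. Continuity gives
    h(x) = 0, and the difference quotients along these zeros vanish. *)
Lemma ae_zero_derive h x (w : R) : 0 < x ->
  {ae mu, forall y, 0 < y -> h y = 0} -> is_derive x 1 h w -> w = 0.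
Proof.
move=> x0 h0 dh.
have key e : 0 < e -> exists2 y, x < y < x + e & h y = 0.
  move=> e0; have xe : x < x + e by rewrite ltrDl.
  have [y /andP[y1 y2] Hy] := negligible_itv_ex xe h0.
  exists y; first by rewrite y1.
  by apply: contrapT => hy; apply: Hy => H; apply: hy; apply: H; exact: lt_trans y1.
have hx : h x = 0.
  apply: contrapT => /eqP hx.
  have ch := is_derive_continuous dh.
  have /cvgrPdist_lt/(_ `|h x|) := ch; rewrite normr_gt0 => /(_ hx) [e /= e0 H].
  have [y /andP[y1 y2] hy] := key e e0.
  have yb : `|x - y| < e by rewrite ltr0_norm ?subr_lt0// opprB ltrBlDl.
  by have := H y yb; rewrite hy subr0 ltxx.
apply: contrapT => /eqP w0.
have [dd ww] := dh.
have /cvgrPdist_lt/(_ `|w|) := dd; rewrite normr_gt0 => /(_ w0) [e /= e0 H].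
have [y /andP[y1 y2] hy] := key e e0.
have yx : y - x != 0 by rewrite subr_eq0 gt_eqF.
have yb : `|0 - (y - x)| < e by rewrite sub0r normrN gtr0_norm ?subr_gt0// ltrBlDl.
have e1 : (y - x)%:A + x = y :> R by rewrite -[X in X + _]/((y - x) * 1) mulr1 subrK.
have lw : lim (h0^-1 *: (h (h0%:A + x) - h x) @[h0 --> 0^']) = w by exact: ww.
by have := H (y - x) yb yx; rewrite lw e1 hy hx subrr scaler0 subr0 ltxx.
Qed.

Lemma mean_limit_unique l (fa : R -> R -> R[i]) (g g0 : R -> R[i]) : 0 < l ->
  (forall a, 0 <= a -> forall x, ccont (fa a) x) -> (forall x, ccont g0 x) ->
  measurable_fun `]0, l[ (fun x => complex.Re (g x)) ->
  measurable_fun `]0, l[ (fun x => complex.Im (g x)) ->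
  (forall e, 0 < e -> \forall a \near +oo, forall x, 0 < x < l -> c1 (fa a x - g0 x) <= e) ->
  (\int[mu]_(x in `]0%R, l[) (sqnorm (fa a x - g x))%:E)%E @[a --> +oo] --> 0%E ->
  {ae mu, forall x, 0 < x < l -> g x = g0 x}.
Proof.
move=> l0 cfa cg0 mg1 mg2 unif lim0.
have mD : measurable (`]0, l[ : set R) by [].
have mc (f : R -> R[i]) : (forall x, ccont f x) ->
    measurable_fun `]0, l[ (fun x => complex.Re (f x)) /\ measurable_fun `]0, l[ (fun x => complex.Im (f x)).
  move=> cf; split; apply: measurable_funS (measurableT : measurable setT) _ _ => //;
    by apply: continuous_measurable_fun => x; case: (cf x).
have mB (f1 f2 : R -> R[i]) :
    measurable_fun `]0, l[ (fun x => complex.Re (f1 x)) /\ measurable_fun `]0, l[ (fun x => complex.Im (f1 x)) ->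
    measurable_fun `]0, l[ (fun x => complex.Re (f2 x)) /\ measurable_fun `]0, l[ (fun x => complex.Im (f2 x)) ->
    measurable_fun `]0, l[ (fun x => (sqnorm (f1 x - f2 x))%:E).
  move=> [a1 a2] [b1 b2]; apply: measurable_sqnorm.
    by apply: eq_measurable_fun (measurable_funB a1 b1) => x _; rewrite /= !ReImE.
  by apply: eq_measurable_fun (measurable_funB a2 b2) => x _; rewrite /= !ReImE.
have m0 := mB g g0 (conj mg1 mg2) (mc g0 cg0).
have I0 : (\int[mu]_(x in `]0%R, l[) (sqnorm (g x - g0 x))%:E = 0)%E.
  apply/eqP; rewrite eq_le; apply/andP; split; last first.
    by apply: integral_ge0 => x _; rewrite lee_fin sqnorm_ge0.
  apply/lee_addgt0Pr => e e0; rewrite add0e.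
  (* As d is at most 1, d^2 is at most d, and the two halves of the estimate add up to at most 2 d +
     2 d l. *)
  pose d := Num.min 1 (e / (2 + 2 * l)).
  have ll : 0 < 2 + 2 * l by lra.
  have d0 : 0 < d by rewrite lt_min ltr01 divr_gt0.
  have N1 : \forall a \near +oo, (\int[mu]_(x in `]0%R, l[) (sqnorm (fa a x - g x))%:E < d%:E)%E.
    have nb : nbhs (0%E : \bar R) [set y | (y < d%:E)%E].
      by apply: open_nbhs_nbhs; split; [exact: open_ereal_lt_ereal|rewrite /= lte_fin].
    exact: (lim0 _ nb).
  have [a [a0 Ha1 Ha2]] : exists a, [/\ 0 <= a, (\int[mu]_(x in `]0%R, l[) (sqnorm (fa a x - g x))%:E < d%:E)%E &
      forall x, 0 < x < l -> c1 (fa a x - g0 x) <= d].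
    near +oo_R => a; exists a; split; near: a.
    - by apply: nbhs_pinfty_ge; exact: num_real.
    - exact: N1.
    - exact: unif.
  have m1 := mB (fa a) g (mc _ (cfa a a0)) (conj mg1 mg2).
  apply: (@le_trans _ _ (\int[mu]_(x in `]0%R, l[) (2%:E * (sqnorm (fa a x - g x))%:E + (2 * d)%:E))%E).
    apply: ge0_le_integral => //.
    - by move=> x _; rewrite lee_fin sqnorm_ge0.
    - apply: emeasurable_funD; last exact: measurable_cst.
      exact: measurable_funeM.
    - move=> x xD; rewrite -EFinM -EFinD lee_fin.
      have -> : g x - g0 x = - (fa a x - g x) + (fa a x - g0 x) by ring.
      apply: le_trans (sqnormD_le _ _) _; rewrite mulrDr lerD//.
        by rewrite /sqnorm !ReImE !sqrrN.
      rewrite ler_wpM2l//; apply: le_trans (sqnorm_le_c1 _) _.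
      have cd := Ha2 x xD; have d1 : d <= 1 by rewrite ge_min lexx.
      have := c1_ge0 (fa a x - g0 x); nra.
  rewrite ge0_integralD//; first last.
  - by move=> x _; rewrite lee_fin mulr_ge0// ltW.
  - exact: measurable_funeM.
  - by move=> x _; rewrite mule_ge0// lee_fin sqnorm_ge0.
  rewrite ge0_integralZl//; last by move=> x _; rewrite lee_fin sqnorm_ge0.
  have -> : (\int[mu]_(_ in `]0%R, l[) (2 * d)%:E = (2 * d * l)%:E)%E.
    transitivity ((2 * d)%:E * mu `]0%R, l[)%E; first exact: integral_cst.
    by rewrite lebesgue_measure_itv /= lte_fin l0 -EFinB -EFinM subr0.
  apply: (@le_trans _ _ (2%:E * d%:E + (2 * d * l)%:E)%E).
    by rewrite leeD2r// lee_pmul2l// ltW.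
  rewrite -EFinM -EFinD lee_fin.
  have : d <= e / (2 + 2 * l) by rewrite ge_min lexx orbT.
  by rewrite ler_pdivlMr//; lra.
have := (ae_eq_integral_abs mu mD m0).1.
have -> : (\int[mu]_(x in `]0%R, l[) `|(sqnorm (g x - g0 x))%:E| = 0)%E.
  by rewrite -[RHS]I0; apply: eq_integral => x _; rewrite gee0_abs// lee_fin sqnorm_ge0.
move=> /(_ erefl); apply: filterS => x H xl.
have xD : `]0, l[%classic x by rewrite /= in_itv.
have [] := H xD; move=> h0.
by apply/eqP; rewrite -subr_eq0; apply/eqP; exact: sqnorm_eq0.
Unshelve. all: by end_near.
Qed.

Lemma ae_imply (P Q : R -> Prop) : (forall x, P x -> Q x) ->
  {ae mu, forall x, P x} -> {ae mu, forall x, Q x}.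
Proof. by move=> PQ H; apply: (filterS (F := almost_everywhere mu) PQ). Qed.

Lemma ae_imply2 (P Q S : R -> Prop) : (forall x, P x -> Q x -> S x) ->
  {ae mu, forall x, P x} -> {ae mu, forall x, Q x} -> {ae mu, forall x, S x}.
Proof.
move=> PQ H1 H2; apply: negligibleS (negligibleU H1 H2) => x /= nS.
by apply: contrapT => /not_orP[/contrapT h1 /contrapT h2]; apply: nS; exact: PQ.
Qed.

Lemma ae_fin (I : finType) (P : I -> R -> Prop) :
  (forall i, {ae mu, forall x, P i x}) -> {ae mu, forall x, forall i, P i x}.
Proof. by move=> H; apply: filter_forall. Qed.

Lemma ae_neq (I : finType) (d : I -> R) : {ae mu, forall x i, x != d i}.
Proof.
apply: ae_fin => m; have h := @lebesgue_measure_set1 R (d m).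
exists [set d m]; split => //.
by move=> x /= /negP; rewrite negbK => /eqP.
Qed.

Lemma ae_pos (P : R -> Prop) :
  (forall l, 0 < l -> {ae mu, forall x, 0 < x < l -> P x}) ->
  {ae mu, forall x, 0 < x -> P x}.
Proof.
move=> H; have := ae_foralln (fun N => H N.+1%:R (ltr0Sn _ _)).
apply: filterS => x Hx x0; apply: (Hx (Num.truncn x)); rewrite x0 /=.
exact: truncnS_gt.
Qed.

End MeasureLemmas.

(** * The function k almost everywhere *)

Section KernelIdentification.
Context {R : realType} (n p : nat) (th1 th2 : 'M[R[i]]_(n, p)) (beta : 'M[R[i]]_n)
  (Ru : 'M[R[i]]_p) (dd : 'I_p -> R) (M eta : R).
Hypothesis M_gt0 : 0 < M.
Hypothesis M_spec : forall a : R[i], eigenvalue (beta + (ii * M%:C%C)%:M) a -> 0 < complex.Im a.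
Hypothesis eta_lt : eta < - 2%:R * M.
Local Notation mu := (@lebesgue_measure R).
Local Notation D := (diag_mx (\row_m (dd m)%:C%C)).
Implicit Types (x y : R).

(** If z is an eigenvalue of 2 beta, then z / 2 + i M is one of beta + i M; so Im z > -2 M > eta. *)
Lemma spectrum_bound z : eigenvalue (2 *: beta) z -> - - eta < complex.Im z.
Proof.
move=> /eigenvalueP[v vB v0].
have two0 : (2 : R[i]) != 0 by rewrite pnatr_eq0.
have e : eigenvalue (beta + (ii * M%:C%C)%:M) (2^-1 * z + ii * M%:C%C).
  apply/eigenvalueP; exists v => //; rewrite mulmxDr mul_mx_scalar scalerDl; congr (_ + _).
  by rewrite -scalerA -vB -scalemxAr scalerA mulVf// scale1r.
have := M_spec e.
have -> : complex.Im (2^-1 * z + ii * M%:C%C) = 2^-1 * complex.Im z + M.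
  have -> : 2^-1 * z + ii * M%:C%C = (2^-1)%:C%C * z + ii * M%:C%C.
    by congr (_ * _ + _); rewrite fmorphV rmorph_nat.
  by rewrite !ReImE; ring.
by move: eta_lt; rewrite opprK; lra.
Qed.

Lemma expR_phase x : expmx (x%:C%C *: (ii *: (2 *: beta))) = expmx ((2 * ii * x%:C%C) *: beta).
Proof. by congr expmx; rewrite !scalerA; congr (_ *: _); ring. Qed.

Lemma expmx_phaseD x y : expmx ((2 * ii * (x + y)%:C%C) *: beta) =
  expmx ((2 * ii * x%:C%C) *: beta) *m expmx ((2 * ii * y%:C%C) *: beta).
Proof.
by have := expmxD (ii *: (2 *: beta)) x y; rewrite !expR_phase.
Qed.

Definition below x : 'M[R[i]]_p := diag_mx (\row_m (dd m < x)%R%:R).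

Definition kexpl x : 'M[R[i]]_p :=
  2 *: (th1^t* *m (expmx ((2 * ii * x%:C%C) *: beta) *m nu th2 beta D *m below x) *m Ru).

Lemma columns_below x : columns th2 (fun m => if dd m < x then expmx ((x - dd m)%:C%C *: (ii *: (2 *: beta))) else 0) =
  expmx ((2 * ii * x%:C%C) *: beta) *m nu th2 beta D *m below x.
Proof.
apply/matrixP => i m; rewrite mul_mx_diag [LHS]mxE [RHS]mxE [X in _ = _ * X]mxE.
case: ifP => _; last by rewrite mulr0 mul0mx mxE.
rewrite mulr1 expR_phase expmx_phaseD -mulmxA [LHS]mxE [RHS]mxE; apply: eq_bigr => k _.
congr (_ * _); rewrite [RHS]mxE.
have -> : - 2%:R * ii * D m m = 2 * ii * (- dd m)%:C%C.
  by rewrite !mxE eqxx rmorphN mulr1n; ring.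
by [].
Qed.

Variables (g s k : R -> 'M[R[i]]_p).
Hypothesis g_lim : is_lim_in_mean (fourier_part (phi th1 th2 beta D Ru) eta) g.
Hypothesis s_def : forall x, 0 <= x ->
       s x = ('i%C / (2%:R * pi)%:C%C * (expR (- eta * x))%:C%C) *: g x.
Hypothesis k_def : is_ae_derivative s k.

Let c := - eta.
Let c_gt0 : 0 < c.
Proof. by have M0 := M_gt0; have := eta_lt; rewrite /c; lra. Qed.

(** The limit in mean identifies s only almost everywhere, with a continuous [s0], whereas k is the
    derivative of s itself. Where s and [s0] are both differentiable, [ae_zero_derive] applied to s
    - s0 makes their derivatives equal. The constants i / (2 pi), 2 i and -2 pi multiply to 2. *)
Lemma kernel_ae : {ae mu, forall x, 0 < x -> k x = kexpl x}.
Proof.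
have Bc : forall z, eigenvalue (2 *: beta) z -> - c < complex.Im z := spectrum_bound.
have ce : - c = eta by rewrite /c opprK.
have [F [F0 dF HF]] := fourier_part_limit th1 th2 Ru dd c_gt0 Bc.
pose g0 x := (2 * ii * (expR (- c * x))%:C%C) *: profile th1 th2 Ru dd (fun y => F (Num.max y 0)) x.
pose s0 x := (- pi^-1)%:C%C *: profile th1 th2 Ru dd (fun y => F (Num.max y 0)) x.
have ppi : (pi : R) != 0 by rewrite gt_eqF ?pi_gt0.
have Fmc y : mcont (fun y => F (Num.max y 0)) y.
  apply: (mcont_comp (h := fun y => Num.max y 0)); last exact: mder_mcont (dF _).
  by apply: (@continuous_max R R (fun y => y) (fun=> 0)) => //; exact: cst_continuous.
have cg0 x : mcont g0 x.
  move=> i j; apply: ccont_ext (ccontM (cexp_part_mcont c x) (profile_mcont th1 th2 Ru dd x Fmc i j)) => y.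
  by rewrite [RHS]mxE.
have aeg : {ae mu, forall x, 0 < x -> forall i j, g x i j = g0 x i j}.
  apply: ae_pos => l l0; have [gL gl] := g_lim l0.
  have h i j : {ae mu, forall x, 0 < x < l -> g x i j = g0 x i j}.
    apply: (mean_limit_unique (fa := fun a x => fourier_part (phi th1 th2 beta D Ru) eta a x i j) l0).
    - move=> a a0 x; have := fourier_part_mcont th1 th2 Ru dd c_gt0 Bc x a0.
      by rewrite ce; apply.
    - by move=> x; exact: cg0.
    - by case: (gL.1 i j).
    - by case: (gL.1 i j).
    - move=> e e0; apply: filterS (HF l e l0 e0) => a Ha x x0l.
      have := Ha x x0l; rewrite -/(g0 x) ce; apply: le_trans.
      have := c1_le_mnorm (fourier_part (phi th1 th2 beta D Ru) eta a x - g0 x) i j.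
      by rewrite mxE [X in _ + X]mxE.
    - exact: gl.
  have h3 : {ae mu, forall x, forall i j, 0 < x < l -> g x i j = g0 x i j}.
    by apply: ae_fin => i; apply: ae_fin => j; exact: h.
  by apply: ae_imply h3 => x H xl i j; exact: H.
have aes : {ae mu, forall x, 0 < x -> s x = s0 x}.
  apply: ae_imply aeg => x H x0; rewrite s_def ?ltW//.
  have -> : g x = g0 x by apply/matrixP => i j; exact: H.
  rewrite /g0 /s0 scalerA -/c; congr (_ *: _).
  have ecx : (expR (c * x))%:C%C * (expR (- c * x))%:C%C = 1 :> R[i].
    by rewrite -rmorphM -expRD (_ : c * x + - c * x = 0) ?expR0//; ring.
  have pi0 : (2 * pi : R) != 0 by rewrite mulf_neq0// ?pnatr_eq0// gt_eqF// pi_gt0.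
  transitivity (2 * (ii * ii) / (2 * pi)%:C%C * ((expR (c * x))%:C%C * (expR (- c * x))%:C%C)); first by ring.
  rewrite ecx mulr1; have -> : ii * ii = -1 :> R[i] by rewrite -expr2 sqr_i.
  rewrite -fmorphV -[2](rmorph_nat (real_complex R)) -[-1](rmorphN1 (real_complex R)) -!rmorphM; congr (_%:C%C).
  by rewrite mulrN1 mulNr invfM mulrA divff ?pnatr_eq0// mul1r.
(* Off the nodes each max(x - d_m, 0) is locally either x - d_m or 0. *)
have ds0 x : (forall m, x != dd m) -> is_mder s0 x (kexpl x).
  move=> xd.
  have dcol : is_mder (fun x => columns th2 (fun m => F (Num.max (x - dd m) 0))) x
     (columns th2 (fun m => (- 2 * pi)%:C%C *: if dd m < x then expmx ((x - dd m)%:C%C *: (ii *: (2 *: beta))) else 0)).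
    move=> i m; rewrite mxE.
    suff h : is_mder (fun x => F (Num.max (x - dd m) 0) *m col m th2) x
      (((- 2 * pi)%:C%C *: if dd m < x then expmx ((x - dd m)%:C%C *: (ii *: (2 *: beta))) else 0) *m col m th2).
      by apply: cder_ext (h i ord0) => y; rewrite [RHS]mxE.
    apply: mderMr => i' j'.
    have [dx|dx] := ltP (dd m) x.
      have h : is_mder (fun y => F (1 * y + (- dd m))) x
          (1%:C%C *: ((- 2 * pi)%:C%C *: expmx ((x - dd m)%:C%C *: (ii *: (2 *: beta))))).
        by apply: mder_affine; rewrite mul1r; exact: dF.
      move: h; rewrite scale1r => h.
      have [h1 h2] := h i' j'.
      have near1 : \forall y \near x, F (1 * y + - dd m) = F (Num.max (y - dd m) 0).
        apply: filterS (lt_nbhsr dx) => y yd; rewrite mul1r; congr F.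
        by apply/esym/max_idPl; rewrite subr_ge0 ltW.
      by split; [apply: near_eq_is_derive h1|apply: near_eq_is_derive h2];
        apply: filterS near1 => y ->.
    have {}dx : x < dd m by rewrite lt_neqAle xd.
    rewrite scaler0 mxE.
    have near1 : \forall y \near x, F 0 = F (Num.max (y - dd m) 0).
      apply: filterS (lt_nbhsl dx) => y yd; congr F.
      by apply/esym/max_idPr; rewrite subr_le0 ltW.
    have [h1 h2] := mder_cst (F 0) x i' j'.
    move: h1 h2; rewrite mxE => h1 h2.
    by split; [apply: near_eq_is_derive h1|apply: near_eq_is_derive h2];
        apply: filterS near1 => y ->.
  have := mderZl (- pi^-1)%:C%C (mderMr Ru (mderMl (th1^t* ) dcol)).
  move=> h; apply: (mder_eq h).
  rewrite /kexpl -columns_below.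
  have -> : columns th2 (fun m => (- 2 * pi)%:C%C *: if dd m < x then expmx ((x - dd m)%:C%C *: (ii *: (2 *: beta))) else 0) =
     (- 2 * pi)%:C%C *: columns th2 (fun m => if dd m < x then expmx ((x - dd m)%:C%C *: (ii *: (2 *: beta))) else 0).
    by apply/matrixP => i m; rewrite [LHS]mxE -scalemxAl [LHS]mxE [RHS]mxE; congr (_ * _); rewrite [RHS]mxE.
  rewrite -scalemxAr -scalemxAl scalerA; congr (_ *: _).
  rewrite -rmorphM -[2 in RHS](rmorph_nat (real_complex R)); congr (_%:C%C).
  by rewrite !mulNr mulrN opprK mulrCA mulVf ?mulr1.
have aed := ae_neq dd.
have [_ kd] := k_def.
have dif i j (pr : R[i] -> R) x : (pr = @complex.Re R \/ pr = @complex.Im R) ->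
   0 < x -> forall u v : R, is_derive x 1 (fun y => pr (s y i j)) u ->
   is_derive x 1 (fun y => pr (s0 y i j)) v -> u = v.
  move=> _ x0 u v du dv; apply/eqP; rewrite -subr_eq0; apply/eqP.
  have dB : is_derive x 1 (fun y => pr (s y i j) - pr (s0 y i j)) (u - v).
    by apply: is_derive_ext (is_deriveB du dv) => y.
  apply: (ae_zero_derive x0 _ dB).
  by apply: ae_imply aes => y H y0; rewrite H// subrr.
apply: ae_imply2 kd aed => x kx xd x0; apply/matrixP => i j.
have [k1 k2] := kx x0 i j; have [e1 e2] := ds0 x xd i j.
by apply: complex_ext; [apply: dif x0 _ _ k1 e1; left|apply: dif x0 _ _ k2 e2; right].
Qed.

End KernelIdentification.

(** * Null sets under affine maps *)

Section AffineNull.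
Context {R : realType}.
Local Notation mu := (@lebesgue_measure R).

(** The right-hand side is a measure in A with the correct values on half-open intervals, so
    uniqueness of Lebesgue measure applies. The purpose is to know k almost everywhere also at the
    arguments (r + x - t) / 2 and (r + t - x) / 2. *)
Lemma lebesgue_measure_affine (a b : R) (a0 : 0 < a) (A : set R) : measurable A ->
  mu A = (a%:E * mu ((fun x => (a * x + b)%R) @^-1` A))%E.
Proof.
move=> mA; pose f := fun x : R => (a * x + b : measurableTypeR R).
have mf : measurable_fun setT f.
  by apply: measurable_funD => //; apply: measurable_funM.
pose pm := measure_function_pushforward__canonical__measure_function_Measure mu mf.
apply: (@lebesgue_measure_unique R (mscale (NngNum (ltW a0)) pm)) => //= _ [[u v]] _ <-.
rewrite /mscale /= /pushforward.
have -> : f @^-1` `]u, v] = `]((u - b) / a), ((v - b) / a)]%classic.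
  apply/seteqP; split => x /=; rewrite !in_itv /= /f;
    by rewrite ltr_pdivrMr// ler_pdivlMr// ltrBlDr lerBrDr mulrC.
rewrite !lebesgue_measure_itv /= !lte_fin ltr_pM2r ?invr_gt0// ltrD2r.
case: ifP => _; last by rewrite mule0.
by rewrite -!EFinB -EFinM; congr (_%:E); field; rewrite gt_eqF.
Qed.

Lemma ae_affine (a b : R) (P : R -> Prop) : 0 < a ->
  {ae mu, forall x, P x} -> {ae mu, forall x, P (a * x + b)}.
Proof.
move=> a0 [N [mN N0 PN]]; exists ((fun x => a * x + b) @^-1` N); split.
- rewrite -[X in measurable X]setTI.
  have mf : measurable_fun setT (fun x : R => a * x + b : measurableTypeR R).
    by apply: measurable_funD => //; apply: measurable_funM.
  exact: mf.
- have := lebesgue_measure_affine b a0 mN; rewrite (N0 : mu N = 0%E) => /esym/eqP.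
  rewrite mule_eq0 => /orP[/eqP[a00]|/eqP //].
  by move: a0; rewrite a00 ltxx.
- by move=> x /= nP; apply: PN.
Qed.

End AffineNull.

(** * Integrals of functions cut off below a threshold *)

Section StepIntegral.
Context {R : realType}.
Local Notation mu := (@lebesgue_measure R).
Implicit Types (a b c r : R).

Lemma rint_step a b c (h : R -> R) : (forall r, {for r, continuous h}) ->
  rint `[a, b] (fun r => if c < r then h r else 0).
Proof.
move=> ch; have i0 : rint `[a, b] h by apply: rint_cont => r _.
apply: (le_integrable _ _ _ i0) => //.
  apply/measurable_EFinP/measurable_funTS; apply: measurable_fun_ifT => //.
  - by apply: measurable_fun_ltr => //; exact: measurable_cst.
  - exact: continuous_measurable_fun.
by move=> r _ /=; case: ifP => _; rewrite lee_fin// normr0.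
Qed.

Lemma Rintegral_step a b c (h : R -> R) : a <= c -> (forall r, {for r, continuous h}) ->
  \int[mu]_(r in `[a, b]) (if c < r then h r else 0) =
  if c < b then \int[mu]_(r in `[c, b]) h r else 0.
Proof.
move=> ac ch.
transitivity (\int[mu]_(r in `[a, b] `&` `]c, +oo[) h r).
  rewrite Rintegral_mkcondr; apply: eq_Rintegral => r _.
  by rewrite patchE mem_setE in_itv /= andbT.
have e : `[a, b] `&` `]c, +oo[ = `]c, b]%classic :> set R.
  apply/seteqP; split => r /=; rewrite !in_itv /= ?andbT.
    by move=> [/andP[_ ->] ->].
  by move=> /andP[cr ->]; rewrite cr andbT (le_trans ac (ltW cr)).
rewrite e; have [cb|bc] := ltP c b.
  rewrite Rintegral_itv_obnd_cbnd//; have i0 : rint `[c, b] h by apply: rint_cont => r _.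
  apply: integrableS i0 => //; by move=> r; rewrite /= !in_itv /= => /andP[/ltW -> ->].
rewrite (_ : `]c, b]%classic = set0) ?Rintegral_set0//.
by apply/seteqP; split => r //=; rewrite in_itv /= => /andP[/lt_le_trans h1 /h1]; rewrite ltNge bc.
Qed.

Lemma mxint_step q m a b c (G g : R -> 'M[R[i]]_(q, m)) : a <= c ->
  (forall y, is_mder G y (g y)) -> (forall y, mcont g y) ->
  mx_integrable `[a, b] (fun y => if c < y then g y else 0) /\
  mxint `[a, b] (fun y => if c < y then g y else 0) = if c < b then G b - G c else 0.
Proof.
move=> ac dG cg.
have e y i j : (if c < y then g y else 0) i j = if c < y then g y i j else 0.
  by case: ifP => _; rewrite ?mxE.
split=> [i j|].
  split.
    apply: (rint_ext (h1 := fun y => if c < y then complex.Re (g y i j) else 0)) => //.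
      by move=> y _; rewrite e; case: ifP.
    by apply: rint_step => y; case: (cg y i j).
  apply: (rint_ext (h1 := fun y => if c < y then complex.Im (g y i j) else 0)) => //.
    by move=> y _; rewrite e; case: ifP.
  by apply: rint_step => y; case: (cg y i j).
transitivity (if c < b then mxint `[c, b] g else 0).
  apply/matrixP => i j; rewrite mxintE /cint.
  under eq_Rintegral do rewrite e (fun_if (@complex.Re R)).
  under [X in Complex _ X]eq_Rintegral do rewrite e (fun_if (@complex.Im R)).
  rewrite (Rintegral_step _ ac (fun y => (cg y i j).1)) (Rintegral_step _ ac (fun y => (cg y i j).2)).
  by case: ifP => _; rewrite ?mxE.
case: ifP => // cb.
by apply: mxint_FTC => [|y _|y _]; [exact: ltW|exact: dG|exact: cg].
Qed.

End StepIntegral.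

Section Adjoint.
Context {R : realType}.

Lemma ctM q r s (A : 'M[R[i]]_(q, r)) (B : 'M[R[i]]_(r, s)) : (A *m B)^t* = B^t* *m A^t*.
Proof. by rewrite trmx_mul map_mxM. Qed.

Lemma ctD q r (A B : 'M[R[i]]_(q, r)) : (A + B)^t* = A^t* + B^t*.
Proof. by rewrite linearD map_mxD. Qed.

Lemma ctN q r (A : 'M[R[i]]_(q, r)) : (- A)^t* = - A^t*.
Proof. by rewrite linearN map_mxN. Qed.

Lemma ctB q r (A B : 'M[R[i]]_(q, r)) : (A - B)^t* = A^t* - B^t*.
Proof. by rewrite ctD ctN. Qed.

Lemma ctZ q r (a : R[i]) (A : 'M[R[i]]_(q, r)) : (a *: A)^t* = a^* *: A^t*.
Proof. by rewrite linearZ map_mxZ. Qed.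

Lemma ct1 q : (1%:M : 'M[R[i]]_q)^t* = 1%:M.
Proof. by rewrite trmx1 map_mx1. Qed.

Lemma ct0 q r : (0 : 'M[R[i]]_(q, r))^t* = 0.
Proof. by rewrite trmx0 map_mx0. Qed.

Lemma ct_sum q r (I : Type) (s : seq I) (P : pred I) (F : I -> 'M[R[i]]_(q, r)) :
  (\sum_(i <- s | P i) F i)^t* = \sum_(i <- s | P i) (F i)^t*.
Proof. by elim/big_rec2: _ => [|i A B _ <-]; rewrite ?ct0// ctD. Qed.

Lemma ct_col_mx q r s (A : 'M[R[i]]_(q, s)) (B : 'M[R[i]]_(r, s)) :
  (col_mx A B)^t* = row_mx (A^t* ) (B^t* ).
Proof. by rewrite tr_col_mx map_row_mx. Qed.

End Adjoint.

(** * The group e^(2 i x beta) and the matrices Lambda_j *)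

Section Phase.
Context {R : realType} (n : nat) (beta : 'M[R[i]]_n).
Implicit Types (x y s t : R) (Y Q : 'M[R[i]]_n).

Definition phase x : 'M[R[i]]_n := expmx ((2 * ii * x%:C%C) *: beta).

Lemma phaseE x : phase x = expmx (x%:C%C *: ((2 * ii) *: beta)).
Proof. by rewrite /phase; congr expmx; rewrite scalerA mulrC. Qed.

Lemma phase_neg x : expmx ((- 2%:R * ii * x%:C%C) *: beta) = phase (- x).
Proof. by rewrite /phase; congr expmx; congr (_ *: _); rewrite rmorphN !mulNr mulrN. Qed.

Lemma phase_adj x : (phase x)^t* = expmx ((- 2%:R * ii * x%:C%C) *: beta^t* ).
Proof.
rewrite /phase expmx_adj; congr expmx; apply/matrixP => i j; rewrite !mxE rmorphM /=; congr (_ * _).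
by apply: complex_ext; rewrite !ReImE /=; ring.
Qed.

Lemma phase_adjN x : (phase (- x))^t* = expmx ((2%:R * ii * x%:C%C) *: beta^t* ).
Proof.
rewrite phase_adj; congr expmx; congr (_ *: _).
by rewrite rmorphN !mulNr mulrN opprK.
Qed.

Lemma phase0 : phase 0 = 1%:M.
Proof. by rewrite phaseE scale0r expmx0. Qed.

Lemma phaseD x y : phase (x + y) = phase x *m phase y.
Proof. by rewrite !phaseE expmxD. Qed.

Lemma phaseK x : phase x *m phase (- x) = 1%:M.
Proof. by rewrite -phaseD subrr phase0. Qed.

Lemma phase_comm x : phase x *m beta = beta *m phase x.
Proof.
have := expmx_comm ((2 * ii) *: beta) x; rewrite -!phaseE -scalemxAr -scalemxAl => h.
have i0 : 2 * ii != 0 :> R[i] by rewrite mulf_neq0 ?pnatr_eq0// neq0Ci.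
by have := congr1 (fun z => (2 * ii)^-1 *: z) h; rewrite !scalerA mulVf// !scale1r.
Qed.

Lemma phase_der x : is_mder phase x ((2 * ii) *: (beta *m phase x)).
Proof.
apply: (mder_ext (F := fun x => expmx (x%:C%C *: ((2 * ii) *: beta)))) => [y|].
  by rewrite phaseE.
by apply: mder_eq (mder_expmx _ _) _; rewrite -phaseE -scalemxAl.
Qed.

Lemma phaseN_der x : is_mder (fun x => phase (- x)) x ((- (2 * ii)) *: (beta *m phase (- x))).
Proof.
apply: (mder_ext (F := fun x => expmx ((- x)%:C%C *: ((2 * ii) *: beta)))) => [y|].
  by rewrite phaseE.
by apply: mder_eq (mder_expmxN _ _) _; rewrite -phaseE -scalemxAl scaleNr.
Qed.

(* [Lam Y s = Y - e^(-2is beta) Y e^(2is beta^* )] has derivative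
   [2 e^(-2is beta) Q e^(2is beta^* )] when [i(beta Y - Y beta^* ) = Q]. *)
Definition Lam Y s : 'M[R[i]]_n := Y - phase (- s) *m Y *m (phase (- s))^t*.

Lemma Lam0 Y : Lam Y 0 = 0.
Proof. by rewrite /Lam oppr0 phase0 mul1mx ct1 mulmx1 subrr. Qed.

Lemma Lam_adj Y s : Y^t* = Y -> (Lam Y s)^t* = Lam Y s.
Proof. by move=> hY; rewrite /Lam ctB !ctM hY trmxCK mulmxA. Qed.

Definition dLam Q s : 'M[R[i]]_n := 2 *: (phase (- s) *m Q *m (phase (- s))^t* ).

Lemma Lam_der Y Q s : ii *: (beta *m Y - Y *m beta^t* ) = Q ->
  is_mder (Lam Y) s (dLam Q s).
Proof.
move=> YQ; have dP := phaseN_der s.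
have d := mderB (mder_cst Y s) (mderM (mderMr Y dP) (mder_adj dP)).
apply: mder_eq d _; rewrite sub0r /dLam -YQ.
have -> : ((- (2 * ii)) *: (beta *m phase (- s)))^t* =
    (2 * ii) *: ((phase (- s))^t* *m beta^t* ).
  by rewrite ctZ ctM; congr (_ *: _); apply: complex_ext; rewrite !ReImE /=; ring.
rewrite -phase_comm -!scalemxAl -!scalemxAr -!scalemxAl scalerA.
rewrite -ctM -(phase_comm (- s)) ctM; generalize (phase (- s)) => P; generalize (P^t* ) => P'.
by rewrite mulmxBr mulmxBl scaleNr scalerBr !mulmxA opprD opprK.
Qed.

Lemma dLam_mcont Q s : mcont (dLam Q) s.
Proof.
have dP := phaseN_der s.
exact: mder_mcont (mderZl 2 (mderM (mderMr Q dP) (mder_adj dP))).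
Qed.

End Phase.

(** * The semiseparable form of the kernel of S *)

Section MatrixMeasurability.
Context {R : realType}.
Local Notation mu := (@lebesgue_measure R).
Implicit Types (D : set R) (f g : R -> R[i]).

Definition cmeasurable D f := measurable_fun D (fun x => complex.Re (f x)) /\
  measurable_fun D (fun x => complex.Im (f x)).

Lemma cmeasurable_ext D f g : (forall x, D x -> f x = g x) -> cmeasurable D f -> cmeasurable D g.
Proof.
by move=> fg [h1 h2]; split; [apply: eq_measurable_fun h1|apply: eq_measurable_fun h2] => x;
  rewrite inE => xD /=; rewrite fg.
Qed.

Lemma cmeasurableD D f g : cmeasurable D f -> cmeasurable D g -> cmeasurable D (fun x => f x + g x).
Proof.
move=> [a1 a2] [b1 b2]; split.
- by apply: eq_measurable_fun (measurable_funD a1 b1) => x _; rewrite /= !ReImE.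
- by apply: eq_measurable_fun (measurable_funD a2 b2) => x _; rewrite /= !ReImE.
Qed.

Lemma cmeasurableM D f g : cmeasurable D f -> cmeasurable D g -> cmeasurable D (fun x => f x * g x).
Proof.
move=> [a1 a2] [b1 b2]; split.
- by apply: eq_measurable_fun (measurable_funB (measurable_funM a1 b1) (measurable_funM a2 b2)) => x _;
    rewrite /= !ReImE.
- by apply: eq_measurable_fun (measurable_funD (measurable_funM a1 b2) (measurable_funM a2 b1)) => x _;
    rewrite /= !ReImE.
Qed.

Lemma cmeasurable_conj D f : cmeasurable D f -> cmeasurable D (fun x => (f x)^* ).
Proof.
move=> [a1 a2]; split.
- by apply: eq_measurable_fun a1 => x _; rewrite /= !ReImE.
- by apply: eq_measurable_fun (measurable_funN a2) => x _; rewrite /= !ReImE.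
Qed.

Lemma cmeasurable_sum D (I : Type) (s : seq I) (F : I -> R -> R[i]) :
  (forall i, cmeasurable D (F i)) -> cmeasurable D (fun x => \sum_(i <- s) F i x).
Proof.
move=> hF; elim: s => [|i s ih].
  by apply: (cmeasurable_ext (f := fun=> 0)) => [x _|]; [rewrite big_nil|split; exact: measurable_cst].
by apply: cmeasurable_ext (cmeasurableD (hF i) ih) => x _; rewrite big_cons.
Qed.

Lemma mx_measurable_ext q r D (F G : R -> 'M[R[i]]_(q, r)) :
  (forall x, D x -> F x = G x) -> mx_measurable D F -> mx_measurable D G.
Proof.
by move=> FG mF i j; apply: cmeasurable_ext (mF i j : cmeasurable D (fun x => F x i j)) => x xD; rewrite FG.
Qed.

Lemma mx_measurableM q r s D (F : R -> 'M[R[i]]_(q, r)) (G : R -> 'M[R[i]]_(r, s)) :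
  mx_measurable D F -> mx_measurable D G -> mx_measurable D (fun x => F x *m G x).
Proof.
move=> mF mG i j; apply: (cmeasurable_ext (f := fun x => \sum_k F x i k * G x k j)) => [x _|].
  by rewrite [RHS]mxE.
by apply: cmeasurable_sum => k; apply: cmeasurableM; [exact: mF|exact: mG].
Qed.

Lemma mx_measurableD q r D (F G : R -> 'M[R[i]]_(q, r)) :
  mx_measurable D F -> mx_measurable D G -> mx_measurable D (fun x => F x + G x).
Proof.
move=> mF mG i j; apply: (cmeasurable_ext _ (cmeasurableD (mF i j) (mG i j))) => x _.
by rewrite [RHS]mxE.
Qed.

Lemma mx_measurable_adj q r D (F : R -> 'M[R[i]]_(q, r)) :
  mx_measurable D F -> mx_measurable D (fun x => (F x)^t* ).
Proof.
by move=> mF i j; apply: (cmeasurable_ext _ (cmeasurable_conj (mF j i))) => x _; rewrite !mxE.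
Qed.

Lemma mx_measurable_cst q r D (A : 'M[R[i]]_(q, r)) : mx_measurable D (fun=> A).
Proof. by move=> i j; split; exact: measurable_cst. Qed.

Lemma mx_measurableS q r D D' (F : R -> 'M[R[i]]_(q, r)) : measurable D -> D' `<=` D ->
  mx_measurable D F -> mx_measurable D' F.
Proof. by move=> mD DD mF i j; have [a b] := mF i j; split; apply: measurable_funS a || apply: measurable_funS b. Qed.

Lemma mx_integrable_measurable q r D (F : R -> 'M[R[i]]_(q, r)) :
  mx_integrable D F -> mx_measurable D F.
Proof.
by move=> hF i j; have [a b] := hF i j; split; apply/measurable_EFinP; [exact: measurable_int a|exact: measurable_int b].
Qed.

Lemma mx_measurable_affine q r (D D' : set R) (a b : R) (F : R -> 'M[R[i]]_(q, r)) :
  measurable D -> (forall x, D' x -> D (a * x + b)) ->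
  mx_measurable D F -> mx_measurable D' (fun x => F (a * x + b)).
Proof.
move=> mD DD mF i j; have [m1 m2] := mF i j.
have mf : measurable_fun D' (fun x : R => a * x + b).
  by apply: measurable_funD => //; apply: measurable_funM.
have sub : (fun x : R => a * x + b) @` D' `<=` D by move=> _ [x xD <-]; exact: DD.
by split; [apply: measurable_comp mD sub m1 mf|apply: measurable_comp mD sub m2 mf].
Qed.

Lemma Rintegral_ae (a b : R) (f g : R -> R) :
  measurable_fun `]a, b] f -> measurable_fun `]a, b] g ->
  {ae mu, forall x, a < x <= b -> f x = g x} ->
  \int[mu]_(x in `[a, b]) f x = \int[mu]_(x in `[a, b]) g x.
Proof.
move=> mf mg fg; rewrite /Rintegral -!integral_itv_obnd_cbnd; [|exact/measurable_EFinP..].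
congr fine; apply: ae_eq_integral => //; [exact/measurable_EFinP..|].
by apply: ae_imply fg => x H xab; rewrite H//; move: xab; rewrite /= in_itv.
Qed.

Lemma mxint_ae q r (a b : R) (F G : R -> 'M[R[i]]_(q, r)) :
  mx_measurable `]a, b] F -> mx_measurable `]a, b] G ->
  {ae mu, forall x, a < x <= b -> F x = G x} ->
  mxint `[a, b] F = mxint `[a, b] G.
Proof.
move=> mF mG FG; apply/matrixP => i j; rewrite !mxE.
have [f1 f2] := mF i j; have [g1 g2] := mG i j.
by congr Complex; apply: Rintegral_ae => //; apply: ae_imply FG => x H xab; rewrite H.
Qed.

End MatrixMeasurability.

(** * The inner integral in the definition of S *)

Section KernelEvaluation.
Context {R : realType} (n p kappa : nat) (th1 th2 : 'M[R[i]]_(n, p)) (beta : 'M[R[i]]_n)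
  (Ru : 'M[R[i]]_p) (dd : 'I_p -> R) (d : 'I_kappa -> R) (X Q : 'I_kappa -> 'M[R[i]]_n).
Hypothesis Ru_unitary : Ru \is unitarymx.
Hypothesis d_ge0 : forall j, 0 <= d j.
Hypothesis X_sol : forall j, ii *: (beta *m X j - X j *m beta^t* ) = Q j.
Local Notation N := (nu th2 beta (diag_mx (\row_m (dd m)%:C%C))).
Hypothesis Q_sum : forall w, N *m below dd w *m N^t* = \sum_(j | d j < w) Q j.
Local Notation mu := (@lebesgue_measure R).
Local Notation kexp := (kexpl th1 th2 beta Ru dd).
Implicit Types (x t u v w r : R).

Definition Lx x : 'M[R[i]]_n := \sum_j Lam beta (X j) (Num.max (x - d j) 0).

Lemma below_adj u : (below dd u)^t* = below dd u.
Proof.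
apply/matrixP => i j; rewrite !mxE rmorphMn rmorph_nat eq_sym.
by case: eqVneq => [->|]//; rewrite !mulr0n.
Qed.

Lemma belowM u v : below dd u *m below dd v = below dd (Num.min u v).
Proof.
rewrite mulmx_diag; congr diag_mx; apply/rowP => i; rewrite !mxE lt_min.
by case: (dd i < u); case: (dd i < v); rewrite ?mulr1 ?mulr0.
Qed.

(** Unitarity removes [Ru] between the two factors, and the diagonal projections Pi(u) and Pi(v)
    multiply to Pi(min(u, v)). *)
Lemma kexpl_prod u v : kexp u *m (kexp v)^t* =
  4 *: (th1^t* *m phase beta u *m (\sum_(j | d j < Num.min u v) Q j) *m (phase beta v)^t* *m th1).
Proof.
rewrite -Q_sum -belowM /kexpl -!/(phase beta _).
generalize (phase beta u) (phase beta v) => E F; generalize (below dd u) (below_adj v) => P.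
generalize (below dd v) => P' P'E; generalize N => N0.
rewrite ctZ !ctM P'E trmxCK -!scalemxAl -!scalemxAr scalerA; congr (_ *: _).
  by rewrite rmorph_nat -natrM.
by rewrite !mulmxA; rewrite mulmxtVK.
Qed.

(** In terms of [sg] the two arguments are x - sg and t - sg, so the group property moves the
    dependence on x and t to the outer factors. What remains inside is the derivative of Lambda_j at
    [sg], present as soon as min(x - sg, t - sg) exceeds d_j. *)
Lemma kexpl_integrand x t r : let D := `|x - t| in
  kexp ((r + x - t) / 2) *m (kexp ((r + t - x) / 2))^t* =
  2 *: (th1^t* *m phase beta x *m (\sum_j (if D + 2 * d j < r then
     dLam beta (Q j) (Num.min x t - (r - D) / 2) else 0)) *m (phase beta t)^t* *m th1).
Proof.
move=> D; set sg := Num.min x t - (r - D) / 2.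
have [eu ev] : (r + x - t) / 2 = x - sg /\ (r + t - x) / 2 = t - sg.
  rewrite /sg /D; have [xt|tx] := leP x t.
    by rewrite (ler0_norm (x := x - t)) ?subr_le0//; split; field.
  by rewrite (gtr0_norm (x := x - t)) ?subr_gt0//; split; field.
have ew : Num.min (x - sg) (t - sg) = (r - D) / 2.
  rewrite /sg; have [xt|tx] := leP x t.
    by rewrite min_l ?lerD2r//; ring.
  by rewrite min_r ?lerD2r ?ltW//; ring.
have es : \sum_j (if D + 2 * d j < r then dLam beta (Q j) sg else 0) =
    2 *: (phase beta (- sg) *m (\sum_(j | d j < (r - D) / 2) Q j) *m (phase beta (- sg))^t* ).
  rewrite mulmx_sumr mulmx_suml scaler_sumr [RHS]big_mkcond /=; apply: eq_bigr => j _.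
  by rewrite ltr_pdivlMr// ltrBrDl mulrC.
rewrite eu ev kexpl_prod ew es !phaseD ctM.
generalize (\sum_(j | d j < (r - D) / 2) Q j) (phase beta x) (phase beta (- sg)) (phase beta t).
move=> S P1 P2 P3; rewrite -!scalemxAr -!scalemxAl scalerA -natrM.
by rewrite !mulmxA.
Qed.

Lemma kexpl_integral x t : 0 < x -> 0 < t ->
  mx_integrable `[`|x - t|, x + t] (fun r => kexp ((r + x - t) / 2) *m (kexp ((r + t - x) / 2))^t* ) /\
  mxint `[`|x - t|, x + t] (fun r => kexp ((r + x - t) / 2) *m (kexp ((r + t - x) / 2))^t* ) =
  4 *: (th1^t* *m phase beta x *m Lx (Num.min x t) *m (phase beta t)^t* *m th1).
Proof.
move=> x0 t0; set D := `|x - t|; set m := Num.min x t.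
have Db : x + t = D + 2 * m.
  rewrite /D /m; have [xt|tx] := leP x t.
    by rewrite (ler0_norm (x := x - t)) ?subr_le0//; ring.
  by rewrite (gtr0_norm (x := x - t)) ?subr_gt0//; ring.
pose f j r := if D + 2 * d j < r then dLam beta (Q j) (m - (r - D) / 2) else 0.
have fj j : mx_integrable `[D, x + t] (f j) /\
    mxint `[D, x + t] (f j) = 2 *: Lam beta (X j) (Num.max (m - d j) 0).
  (* The factor -2 undoes the inner derivative -1/2. At the upper end r = x + t the argument is 0,
     where Lambda_j vanishes; at the threshold D + 2 d_j it is m - d_j. *)
  pose G r := (- 2) *: Lam beta (X j) (- 2^-1 * r + (m + D / 2)).
  have e r : - 2^-1 * r + (m + D / 2) = m - (r - D) / 2 by field.
  have dG r : is_mder G r (dLam beta (Q j) (m - (r - D) / 2)).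
    apply: mder_eq (mderZl (- 2) (mder_affine (Lam_der _ (X_sol j)))) _.
    rewrite scalerA e -[RHS]scale1r; congr (_ *: _).
    by apply: complex_ext; rewrite !ReImE /=; field.
  have cg r : mcont (fun r => dLam beta (Q j) (m - (r - D) / 2)) r.
    apply: (mcont_ext (F := fun r => dLam beta (Q j) (- 2^-1 * r + (m + D / 2)))) => [y|].
      by rewrite e.
    apply: (mcont_comp (h := fun r => - 2^-1 * r + (m + D / 2))); last exact: dLam_mcont.
    by apply: (@continuousD R R R) => //; [apply: (@continuousM R R) => //|]; exact: cst_continuous.
  have ac : D <= D + 2 * d j by rewrite lerDl mulr_ge0.
  have [i1 i2] := mxint_step (x + t) ac dG cg.
  split; first exact: i1.
  rewrite /f i2 /G.
  have -> : - 2^-1 * (x + t) + (m + D / 2) = 0 by rewrite Db; field.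
  have -> : - 2^-1 * (D + 2 * d j) + (m + D / 2) = m - d j by field.
  rewrite Lam0 scaler0 sub0r Db ltrD2l ltr_pM2l//.
  have [dm|md] := ltP (d j) m.
    by rewrite scaleNr opprK; congr (_ *: Lam _ _ _); apply/esym/max_idPl; rewrite subr_ge0 ltW.
  have -> : Num.max (m - d j) 0 = 0 by apply/max_idPr; rewrite subr_le0.
  by rewrite Lam0 scaler0.
have mD : measurable (`[D, x + t] : set R) by [].
pose T1 := th1^t* *m phase beta x; pose T2 := (phase beta t)^t* *m th1.
have sI : mx_integrable `[D, x + t] (fun r => \sum_j f j r) /\
    mxint `[D, x + t] (fun r => \sum_j f j r) = 2 *: Lx m.
  split=> [a b|].
    apply: (cintegrable_ext (f := fun r => \sum_j f j r a b)) => //.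
      by move=> r _; rewrite summxE.
    by apply: cintegrable_sum => // j _; case: (fj j) => + _; apply.
  apply/matrixP => a b; rewrite mxintE /Lx scaler_sumr summxE.
  transitivity (cint `[D, x + t] (fun r => \sum_j f j r a b)).
    by apply: cint_ext => r _; rewrite summxE.
  rewrite cint_sum//; last by move=> j _; case: (fj j) => + _; apply.
  by apply: eq_bigr => j _; case: (fj j) => _ <-; rewrite mxintE.
have [sI1 sI2] := sI.
have eI r : 2 *: (T1 *m (\sum_j f j r) *m T2) =
    kexp ((r + x - t) / 2) *m (kexp ((r + t - x) / 2))^t*.
  by rewrite kexpl_integrand /T1 /T2 !mulmxA.
have i1 := mx_integrableMr T2 mD (mx_integrableMl T1 mD sI1).
have i2 : mx_integrable `[D, x + t] (fun r => 2 *: (T1 *m (\sum_j f j r) *m T2)).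
  by move=> a b; apply: (cintegrable_ext mD _ (cintegrableZ 2 mD (i1 a b))) => r _; rewrite [RHS]mxE.
split.
  by apply: mx_integrable_ext mD _ i2 => r _; exact: eI.
transitivity (mxint `[D, x + t] (fun r => 2 *: (T1 *m (\sum_j f j r) *m T2))).
  by apply: mxint_ext => r _; rewrite eI.
rewrite (mxintZ _ mD i1) (mxintMr _ mD (mx_integrableMl T1 mD sI1)) (mxintMl _ mD sI1) sI2.
by rewrite -scalemxAr -scalemxAl scalerA -natrM /T1 /T2 !mulmxA.
Qed.

Lemma kerS_kexpl (k : R -> 'M[R[i]]_p) x t : 0 < x -> 0 < t ->
  mx_measurable `]0, +oo[ k -> {ae mu, forall x, 0 < x -> k x = kexp x} ->
  kerS k x t = 2 *: (th1^t* *m phase beta x *m Lx (Num.min x t) *m (phase beta t)^t* *m th1).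
Proof.
move=> x0 t0 mk kk; have [i1 i2] := kexpl_integral x0 t0.
rewrite /kerS; set D := `|x - t| in i1 i2 *.
have D1 : x - t <= D by exact: ler_norm.
have D2 : t - x <= D by rewrite /D distrC ler_norm.
have a1 r : (r + x - t) / 2 = 2^-1 * r + (x - t) / 2 by field.
have a2 r : (r + t - x) / 2 = 2^-1 * r + (t - x) / 2 by field.
have p1 r : D < r -> 0 < (r + x - t) / 2 by move=> rD; rewrite divr_gt0//; lra.
have p2 r : D < r -> 0 < (r + t - x) / 2 by move=> rD; rewrite divr_gt0//; lra.
have half : 0 < 2^-1 :> R by rewrite invr_gt0.
have -> : mxint `[D, x + t] (fun r => k ((r + x - t) / 2) *m (k ((r + t - x) / 2))^t* ) =
    mxint `[D, x + t] (fun r => kexp ((r + x - t) / 2) *m (kexp ((r + t - x) / 2))^t* ).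
  (* The half-open interval matters: at r = |x - t| one of the two arguments is 0, and k is
     described only on the open half-line. *)
  apply: mxint_ae.
  - apply: mx_measurableM.
      apply: (mx_measurable_ext (F := fun r => k (2^-1 * r + (x - t) / 2))) => [r _|]; first by rewrite a1.
      apply: mx_measurable_affine mk => // r /=; rewrite !in_itv /= andbT => /andP[rD _].
      by rewrite -a1 p1.
    apply: mx_measurable_adj.
    apply: (mx_measurable_ext (F := fun r => k (2^-1 * r + (t - x) / 2))) => [r _|]; first by rewrite a2.
    apply: mx_measurable_affine mk => // r /=; rewrite !in_itv /= andbT => /andP[rD _].
    by rewrite -a2 p2.
  - apply: mx_measurableS (mx_integrable_measurable i1) => // r.
    by rewrite /= !in_itv /= => /andP[/ltW -> ->].
  - have h1 := ae_affine ((x - t) / 2) half kk; have h2 := ae_affine ((t - x) / 2) half kk.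
    apply: ae_imply2 h1 h2 => r; rewrite -a1 -a2 => e1 e2 /andP[rD _].
    by rewrite e1 ?p1// e2 ?p2.
by rewrite i2 scalerA; congr (_ *: _); rewrite -[4]/((2 * 2)%:R) natrM mulrA mulVf ?mul1r// pnatr_eq0.
Qed.

End KernelEvaluation.

(** * The canonical system *)

Section Glue.
Context {R : realType}.
Implicit Types (x c D : R).

Lemma is_derive_glue (f g : R -> R) c x D : f c = g c ->
  (x <= c -> is_derive x 1 f D) -> (c <= x -> is_derive x 1 g D) ->
  is_derive x 1 (fun y => if y <= c then f y else g y) D.
Proof.
move=> fg df dg; set h := fun y => _.
have [xc|cx|xc] := ltgtP x c.
- have e : \forall y \near x, f y = h y by apply: filterS (lt_nbhsl xc) => y /ltW yc; rewrite /h yc.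
  by apply: near_eq_is_derive e _; apply: df; exact: ltW.
- have e : \forall y \near x, g y = h y.
    by apply: filterS (lt_nbhsr cx) => y cy; rewrite /h leNgt cy.
  by apply: near_eq_is_derive e _; apply: dg; exact: ltW.
rewrite -{c}xc in fg h df dg *.
have hc : h x = f x by rewrite /h lexx.
have [df1 df2] := df (lexx x); have [dg1 dg2] := dg (lexx x).
have L : h0^-1 *: ((h \o shift x) (h0 *: (1 : R)) - h x) @[h0 --> 0^'] --> D.
  have lf : h0^-1 *: ((f \o shift x) (h0 *: (1 : R)) - f x) @[h0 --> 0^'] --> D by rewrite -df2.
  have lg : h0^-1 *: ((g \o shift x) (h0 *: (1 : R)) - g x) @[h0 --> 0^'] --> D by rewrite -dg2.
  apply/cvgrPdist_lt => e e0.
  move/cvgrPdist_lt/(_ e e0) : lf => lf; move/cvgrPdist_lt/(_ e e0) : lg => lg.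
  apply: filterS2 lf lg => t tf tg /=; rewrite hc /h /=.
  by case: ifP => _; [exact: tf|rewrite fg; exact: tg].
by split; [apply: cvgP L|apply: cvg_lim L].
Qed.

Lemma mder_glue q r (F G : R -> 'M[R[i]]_(q, r)) c x (D : 'M[R[i]]_(q, r)) : F c = G c ->
  (x <= c -> is_mder F x D) -> (c <= x -> is_mder G x D) ->
  is_mder (fun y => if y <= c then F y else G y) x D.
Proof.
move=> FG dF dG i j.
have e y : (if y <= c then F y else G y) i j = if y <= c then F y i j else G y i j by case: ifP.
have FG' : F c i j = G c i j by rewrite FG.
split.
- apply: (is_derive_ext (h := fun y => if y <= c then complex.Re (F y i j) else complex.Re (G y i j))).
    by move=> y; rewrite e; case: ifP.
  by apply: is_derive_glue; [rewrite FG'|move=> xc; case: (dF xc i j)|move=> xc; case: (dG xc i j)].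
- apply: (is_derive_ext (h := fun y => if y <= c then complex.Im (F y i j) else complex.Im (G y i j))).
    by move=> y; rewrite e; case: ifP.
  by apply: is_derive_glue; [rewrite FG'|move=> xc; case: (dF xc i j)|move=> xc; case: (dG xc i j)].
Qed.

End Glue.

Section Flow.
Context {R : realType} (n p : nat) (th1 : 'M[R[i]]_(n, p)) (beta : 'M[R[i]]_n).
Implicit Types (x : R) (L Z Zt : 'M[R[i]]_n).
Local Notation rt2 := ((Num.sqrt (2%:R : R))%:C%C).

Lemma rt2M : rt2 * rt2 = 2 :> R[i].
Proof. by rewrite -rmorphM -expr2 sqr_sqrtr// rmorph_nat. Qed.

Definition Bof x L : 'M[R[i]]_(n + n, p) :=
  rt2 *: (col_mx (- L *m (phase beta x)^t* ) ((phase beta x)^t* ) *m th1).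

Definition Cof x L : 'M[R[i]]_(p, n + n) :=
  rt2 *: (th1^t* *m row_mx (phase beta x) (phase beta x *m L)).

(** The one combination of the two sums through which they enter B and C; [Lm_piece] recognises it
    as the sum of the Lambda_j(x - d_j) with j at most m. *)
Definition Lpiece Z Zt x := Z - phase beta (- x) *m Zt *m (phase beta (- x))^t*.

Lemma phase_adjK x : (phase beta (- x))^t* *m (phase beta x)^t* = 1%:M.
Proof. by rewrite -ctM phaseK ct1. Qed.

Lemma Bform_piece Z Zt x : Bform beta th1 Z Zt x = Bof x (Lpiece Z Zt x).
Proof.
rewrite /Bform /Bof phase_neg -phase_adj; congr (_ *: (col_mx _ _ *m _)).
have := phase_adjK x; rewrite /Lpiece.
generalize ((phase beta (- x))^t* ) ((phase beta x)^t* ) (phase beta (- x)) => P E Q PE.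
by rewrite opprB mulmxBl -!mulmxA PE mulmx1.
Qed.

Lemma Cform_piece Z Zt x : Cform beta th1 Z Zt x = Cof x (Lpiece Z Zt x).
Proof.
rewrite /Cform /Cof -phase_adjN -/(phase beta x); congr (_ *: (_ *m row_mx _ _)).
have := phaseK beta x; rewrite /Lpiece.
generalize ((phase beta (- x))^t* ) (phase beta x) (phase beta (- x)) => P E Q EQ.
by rewrite mulmxBr !mulmxA EQ mul1mx.
Qed.

Lemma calA_phase x : expmx (x%:C%C *: calA beta) =
  block_mx (phase beta x) 0 0 ((phase beta (- x))^t* ).
Proof.
rewrite /calA scale_block_mx !scaler0 expmx_block -phaseE; congr block_mx.
by rewrite phase_adjN; congr expmx; rewrite scalerA; congr (_ *: _); ring.
Qed.

Lemma flow_unit Z Zt x : flow beta th1 Z Zt x \in unitmx.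
Proof.
have := expmx_unit (calAx beta th1 Zt) x; have := expmx_unit (calA beta) (- x); rewrite /flow.
generalize (expmx (x%:C%C *: calAx beta th1 Zt)) (expmx ((- x)%:C%C *: calA beta)) => E1 E2 u2 u1.
rewrite unitmx_mul unitmx_mul u1 u2 !andbT.
by rewrite unitmxE /Omega det_ublock !det1 mulr1 unitr1.
Qed.

(** The commuting part [calA] cancels and 2 Y is left between the exponentials. Omega e^(-xA)
    carries the left factor of Y to that of B, while the right factor of Y equals that of C times
    Omega e^(-xA), which restores the flow. *)
Lemma flow_der Z Zt x :
  is_mder (flow beta th1 Z Zt) x
    (Bof x (Lpiece Z Zt x) *m Cof x (Lpiece Z Zt x) *m flow beta th1 Z Zt x).
Proof.
rewrite -Bform_piece -Cform_piece.
have d := mderM (mderMl (Omega Z) (mder_expmxN (calA beta) x)) (mder_expmx (calAx beta th1 Zt) x).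
apply: mder_eq d _.
rewrite /flow; set EN := expmx ((- x)%:C%C *: calA beta); set EX := expmx (x%:C%C *: calAx _ _ _).
have cA : calA beta *m EN = EN *m calA beta by rewrite /EN expmx_comm.
have -> : Omega Z *m - (calA beta *m EN) *m EX + Omega Z *m EN *m (calAx beta th1 Zt *m EX) =
    Omega Z *m EN *m (2 *: calY th1 Zt) *m EX.
  rewrite cA /calAx; clearbody EN EX; generalize (calA beta) (calY th1 Zt) (Omega Z) => A Y O.
  by rewrite mulmxN mulNmx mulmxDl mulmxDr !mulmxA addKr.
rewrite /Bform /Cform phase_neg -phase_adj -phase_adjN -/(phase beta x).
have eO : Omega Z *m EN *m col_mx Zt 1%:M =
    col_mx (phase beta (- x) *m Zt - Z *m (phase beta x)^t* ) ((phase beta x)^t* ).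
  rewrite /EN calA_phase opprK /Omega mulmx_block !mul_block_col.
  by rewrite !(mul1mx, mul0mx, mulmx0, mulmx1, addr0, add0r) mulNmx.
have eC : row_mx 1%:M (- Zt) =
    row_mx (phase beta x) (phase beta x *m Z - Zt *m (phase beta (- x))^t* ) *m (Omega Z *m EN).
  rewrite /EN calA_phase opprK /Omega mulmx_block mul_row_block.
  have := phaseK beta x; have := phase_adjK x.
  generalize ((phase beta (- x))^t* ) ((phase beta x)^t* ) (phase beta x) (phase beta (- x)) => P1 P2 P3 P4 h1 h2.
  rewrite !(mul1mx, mul0mx, mulmx0, mulmx1, addr0, add0r) h2; congr row_mx.
  by rewrite mulmxBl -[Zt *m _ *m _]mulmxA h1 mulmx1 mulNmx mulmxN mulmxA addKr.
rewrite /calY eC -!scalemxAr -!scalemxAl scalerA rt2M; congr (_ *: _).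
rewrite -eO !mulmxA.
by [].
Qed.

End Flow.

(** * Gluing the pieces of U *)

Section PiecewiseSolution.
Context {R : realType} (n p kappa : nat) (th1 : 'M[R[i]]_(n, p)) (beta : 'M[R[i]]_n)
  (d : 'I_kappa -> R) (X : 'I_kappa -> 'M[R[i]]_n) (l : R).
Hypothesis d_ge0 : forall j, 0 <= d j.
Hypothesis d_incr : forall i j : 'I_kappa, (i < j)%N -> d i < d j.
Hypothesis l_gt0 : 0 < l.
Implicit Types (x : R) (m : nat).

Definition Lm m x : 'M[R[i]]_n :=
  \sum_(j < kappa | (j < m)%N) Lam beta (X j) (Num.max (x - d j) 0).

Local Notation nd := (node d l).
Local Notation Z m := (Zsum X m).
Local Notation Zt m := (Ztsum d beta X m).

Lemma Lm_kappa x : Lm kappa x = Lx beta d X x.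
Proof. by apply: eq_bigl => j; rewrite ltn_ord. Qed.

Lemma nodeS (j : 'I_kappa) : nd j.+1 = d j.
Proof. by rewrite /node valK. Qed.

Lemma d_le (i j : 'I_kappa) : (i <= j)%N -> d i <= d j.
Proof. by rewrite leq_eqVlt => /predU1P[/val_inj ->//|/d_incr/ltW]. Qed.

(** The conjugation by e^(2 i d_j beta) in [Ztsum] is exactly the shift of the argument of Lambda_j
    by d_j. *)
Lemma LamD_shift (j : 'I_kappa) x : Lam beta (X j) (x - d j) =
  X j - phase beta (- x) *m (phase beta (d j) *m X j *m (phase beta (d j))^t* ) *m (phase beta (- x))^t*.
Proof.
rewrite /Lam; have -> : phase beta (- (x - d j)) = phase beta (- x) *m phase beta (d j).
  by rewrite opprB addrC phaseD.
generalize (phase beta (- x)) (phase beta (d j)) => P Q.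
by rewrite ctM !mulmxA.
Qed.

Lemma Ztsum_phase m : Zt m =
  \sum_(j < kappa | (j < m)%N) phase beta (d j) *m X j *m (phase beta (d j))^t*.
Proof. by apply: eq_bigr => j _; rewrite phase_adj. Qed.

Lemma Lm_piece m x : (forall j : 'I_kappa, (j < m)%N -> d j <= x) ->
  Lm m x = Lpiece beta (Z m) (Zt m) x.
Proof.
move=> dx; rewrite /Lpiece Ztsum_phase mulmx_sumr mulmx_suml -sumrB; apply: eq_bigr => j jm.
have -> : Num.max (x - d j) 0 = x - d j by apply/max_idPl; rewrite subr_ge0 dx.
exact: LamD_shift.
Qed.

Lemma LmS_le (j : 'I_kappa) x : x <= d j -> Lm j.+1 x = Lm j x.
Proof.
move=> xd; rewrite /Lm (bigD1 j)//=.
have -> : Num.max (x - d j) 0 = 0 by apply/max_idPr; rewrite subr_le0.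
rewrite Lam0 add0r; apply: eq_bigl => i; rewrite ltnS leq_eqVlt -val_eqE.
by case: ltngtP.
Qed.

Local Notation fl m := (flow beta th1 (Z m) (Zt m)).

(** Unlike U, this is meaningful on the whole line and not truncated at l, so its differential
    equation holds with two-sided derivatives at every real point. *)
Fixpoint Ut m x : 'M[R[i]]_(n + n) :=
  if m is m'.+1 then
    if x <= nd m then Ut m' x else fl m x *m invmx (fl m (nd m)) *m Ut m' (nd m)
  else fl 0 x *m invmx (fl 0 0).

Lemma UtS m x : Ut m.+1 x = if x <= nd m.+1 then Ut m x
  else fl m.+1 x *m invmx (fl m.+1 (nd m.+1)) *m Ut m (nd m.+1).
Proof. by []. Qed.

Lemma flow_norm m c (A : 'M[R[i]]_(n + n)) : fl m c *m invmx (fl m c) *m A = A.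
Proof. by rewrite mulmxV ?mul1mx// flow_unit. Qed.

Lemma flow_right_der m c (A : 'M[R[i]]_(n + n)) x : (forall j : 'I_kappa, (j < m)%N -> d j <= x) ->
  is_mder (fun x => fl m x *m invmx (fl m c) *m A) x
   (Bof th1 beta x (Lm m x) *m Cof th1 beta x (Lm m x) *m (fl m x *m invmx (fl m c) *m A)).
Proof.
move=> dx; rewrite (Lm_piece dx).
apply: mder_eq (mderMr A (mderMr (invmx (fl m c)) (flow_der th1 beta (Z m) (Zt m) x))) _.
by rewrite !mulmxA.
Qed.

(** At a new node the Lambda that is added vanishes, so the coefficients of both pieces agree there
    and the one-sided derivatives match. *)
Lemma Ut_der m x : (m <= kappa)%N ->
  is_mder (Ut m) x (Bof th1 beta x (Lm m x) *m Cof th1 beta x (Lm m x) *m Ut m x).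
Proof.
elim: m => [_|m ih mk].
  have h0 : forall j : 'I_kappa, (j < 0)%N -> d j <= x by [].
  have e y : fl 0 y *m invmx (fl 0 0) *m 1%:M = Ut 0 y := mulmx1 _.
  by rewrite -e; apply: mder_ext (flow_right_der 0 1%:M h0) => y; exact: e.
pose j := Ordinal mk; have nj : nd m.+1 = d j by exact: (nodeS j).
have {}ih := ih (ltnW mk).
have gl : Ut m (nd m.+1) = fl m.+1 (nd m.+1) *m invmx (fl m.+1 (nd m.+1)) *m Ut m (nd m.+1).
  by rewrite flow_norm.
have dj i : (i < m.+1)%N -> d j <= x -> forall k : 'I_kappa, (k < m.+1)%N -> d k <= x.
  by move=> _ jx k km; apply: le_trans jx; apply: d_le.
apply: (mder_glue gl) => [xd|dx].
  have -> : Ut m.+1 x = Ut m x by rewrite UtS xd.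
  by rewrite (LmS_le (j := j)) -?nj//.
have -> : Ut m.+1 x = fl m.+1 x *m invmx (fl m.+1 (nd m.+1)) *m Ut m (nd m.+1).
  rewrite UtS.
  have [xd|xd] := boolP (x <= nd m.+1).
    have -> : x = nd m.+1 by apply/eqP; rewrite eq_le xd.
    exact: gl.
  exact: erefl.
apply: flow_right_der => k km; apply: le_trans dx; rewrite nj; exact: d_le.
Qed.

Lemma Ut_le m x : x <= nd m.+1 -> Ut m.+1 x = Ut m x.
Proof. by move=> xd; rewrite UtS xd. Qed.

Lemma node_mono m : (m.+1 < kappa)%N -> nd m.+1 <= nd m.+2.
Proof.
move=> mk; rewrite (nodeS (Ordinal (ltnW mk))) (nodeS (Ordinal mk)).
exact: d_le.
Qed.

Lemma node_ge0 m : (m <= kappa)%N -> 0 <= nd m.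
Proof. by case: m => [|m] mk //; rewrite (nodeS (Ordinal mk)). Qed.

Lemma Ut_eq m m' x : (m <= m' <= kappa)%N -> ((m < kappa)%N -> x <= nd m.+1) -> Ut m' x = Ut m x.
Proof.
move=> /andP[mm mk] xd; elim: m' mm mk => [|m' ih]; first by rewrite leqn0 => /eqP ->.
rewrite leq_eqVlt => /predU1P[->//|]; rewrite ltnS => mm mk.
rewrite Ut_le ?ih//; first exact: ltnW.
apply: le_trans (xd (leq_ltn_trans mm mk)) _.
rewrite (nodeS (Ordinal (leq_ltn_trans mm mk))) (nodeS (Ordinal mk)); exact: d_le.
Qed.

Lemma Ut0 m : (m <= kappa)%N -> Ut m 0 = 1%:M.
Proof.
move=> mk; rewrite (Ut_eq (m := 0)) ?mk//; first by rewrite /= mulmxV// flow_unit.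
by move=> k0; apply: node_ge0.
Qed.

Variable U : R -> 'M[R[i]]_(n + n).
Hypothesis U0 : U 0 = 1%:M.
Hypothesis U_def : forall m x, (m <= kappa)%N -> nd m < l ->
  nd m <= x <= Num.min l (nd m.+1) -> U x = fl m x *m invmx (fl m (nd m)) *m U (nd m).

Lemma U_Ut m x : (m <= kappa)%N -> nd m < l -> 0 <= x <= Num.min l (nd m.+1) -> U x = Ut m x.
Proof.
elim: m x => [|m ih] x mk ml /andP[x0 xm].
  by rewrite (U_def (m := 0)) ?x0//= U0 mulmx1.
have ml' : nd m < l.
  case: m {ih xm} mk ml => [|m] mk ml //.
  by apply: le_lt_trans ml; exact: node_mono.
have eqc : U (nd m.+1) = Ut m (nd m.+1).
  by apply: ih => //; [exact: ltnW|rewrite node_ge0// le_min lexx (ltW ml)].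
have [xc|cx] := leP x (nd m.+1).
  rewrite Ut_le//; apply: ih => //; first exact: ltnW.
  by rewrite x0 le_min xc (le_trans xc (ltW ml)).
rewrite (U_def (m := m.+1)) ?(ltW cx)// eqc UtS ifF//.
by apply/negbTE; rewrite -ltNge.
Qed.

Lemma piece_exists x : 0 <= x < l -> exists m, [/\ (m <= kappa)%N, nd m < l, nd m <= x &
  x < Num.min l (nd m.+1)].
Proof.
move=> /andP[x0 xl].
have : forall m, (m <= kappa)%N -> nd m <= x -> exists m, [/\ (m <= kappa)%N, nd m < l, nd m <= x &
  x < Num.min l (nd m.+1)].
  move=> m; elim: (kappa - m)%N {-2}m (erefl (kappa - m)%N) => [|k ih] {}m mk1 mk mx.
    exists m; split => //; first exact: le_lt_trans xl.
    have -> : m = kappa by apply/eqP; rewrite eqn_leq mk -subn_eq0 mk1 eqxx.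
    (* The search moves up through the nodes; at m = kappa the next node is l by convention. *)
    by rewrite /node insubN ?ltnn// minxx.
  have mk' : (m < kappa)%N by rewrite -subn_gt0 mk1.
  have [xm|mx'] := ltP x (nd m.+1).
    by exists m; split => //; [exact: le_lt_trans xl|rewrite lt_min xl xm].
  by apply: (ih m.+1) => //; rewrite subnS mk1.
by move=> /(_ 0%N (leq0n _)); apply.
Qed.

Lemma U_global x : 0 <= x <= l -> U x = Ut kappa x.
Proof.
move=> /andP[x0 xl].
have key m : (m <= kappa)%N -> nd m < l -> 0 <= x <= Num.min l (nd m.+1) -> U x = Ut kappa x.
  move=> mk ml xm; rewrite (U_Ut mk ml xm) (Ut_eq (m := m) (m' := kappa))//; first by rewrite mk leqnn.
  by move=> _; case/andP: xm => _; rewrite le_min => /andP[].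
have [xl'|lx] := ltP x l.
  have [|m [mk ml mx xm]] := @piece_exists x; first by rewrite x0.
  by apply: (key m) => //; rewrite x0 (ltW xm).
have {xl lx} -> : x = l by apply/eqP; rewrite eq_le xl.
(* The end point l lies in no half-open piece. It is reached from the piece that starts before l and
   whose next node is at least l. *)
have : forall m, (m <= kappa)%N -> nd m < l -> exists m, [/\ (m <= kappa)%N, nd m < l & l <= nd m.+1].
  move=> m; elim: (kappa - m)%N {-2}m (erefl (kappa - m)%N) => [|k ih] {}m mk1 mk ml.
    exists m; split => //.
    have -> : m = kappa by apply/eqP; rewrite eqn_leq mk -subn_eq0 mk1 eqxx.
    by rewrite /node insubN ?ltnn.
  have mk' : (m < kappa)%N by rewrite -subn_gt0 mk1.
  have [lm|ml'] := leP l (nd m.+1); first by exists m.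
  by apply: (ih m.+1) => //; rewrite subnS mk1.
move=> /(_ 0%N (leq0n _) l_gt0)[m [mk ml lm]].
rewrite (U_Ut mk ml); last by rewrite (ltW l_gt0) le_min lexx lm.
rewrite (Ut_eq (m := m) (m' := kappa))//; by rewrite mk leqnn.
Qed.

Lemma piece_coefficients (B : R -> 'M[R[i]]_(n + n, p)) (C : R -> 'M[R[i]]_(p, n + n)) x :
  (forall (m : nat) (x : R), (m <= kappa)%N -> nd m < l -> nd m < x < Num.min l (nd m.+1) ->
       B x = Bform beta th1 (Z m) (Zt m) x) ->
  (forall (m : nat) (x : R), (m <= kappa)%N -> nd m < l -> nd m < x < Num.min l (nd m.+1) ->
       C x = Cform beta th1 (Z m) (Zt m) x) ->
  0 < x < l -> (forall j, x != d j) ->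
  B x = Bof th1 beta x (Lx beta d X x) /\ C x = Cof th1 beta x (Lx beta d X x).
Proof.
move=> HB HC /andP[x0 xl] xd.
have [|m [mk ml mx xm]] := @piece_exists x; first by rewrite (ltW x0).
have mx' : nd m < x.
  rewrite lt_neqAle mx andbT; case: m mk {ml mx xm} => [|m] mk; first by rewrite /= lt_eqF.
  by rewrite (nodeS (Ordinal mk)) eq_sym.
have mxm : nd m < x < Num.min l (nd m.+1) by rewrite mx' xm.
rewrite (HB m x mk ml mxm) (HC m x mk ml mxm) Bform_piece Cform_piece -Lm_piece; last first.
  move=> j jm; apply: le_trans mx; case: m mk jm {ml mx' xm mxm} => // m mk jm.
  rewrite (nodeS (Ordinal mk)); exact: d_le.
have -> : Lm m x = Lx beta d X x; last by [].
rewrite /Lx (bigID (fun j : 'I_kappa => (j < m)%N)) /= [X in _ + X]big1 ?addr0// => j.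
rewrite -leqNgt => mj.
have -> : Num.max (x - d j) 0 = 0.
  apply/max_idPr; rewrite subr_le0; apply: ltW; move: xm; rewrite lt_min => /andP[_ xm].
  apply: lt_le_trans xm _; have mk' : (m < kappa)%N by exact: leq_ltn_trans (ltn_ord j).
  by rewrite (nodeS (Ordinal mk')); exact: d_le.
exact: Lam0.
Qed.

End PiecewiseSolution.

(** * J-unitarity of U and invertibility of its lower right block *)

Section Symplectic.
Context {R : realType} (n p kappa : nat) (th1 : 'M[R[i]]_(n, p)) (beta : 'M[R[i]]_n)
  (d : 'I_kappa -> R) (X Q : 'I_kappa -> 'M[R[i]]_n) (l : R).
Hypothesis d_ge0 : forall j, 0 <= d j.
Hypothesis d_incr : forall i j : 'I_kappa, (i < j)%N -> d i < d j.
Hypothesis l_gt0 : 0 < l.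
Hypothesis X_herm : forall j, (X j)^t* = X j.
Hypothesis X_sol : forall j, ii *: (beta *m X j - X j *m beta^t* ) = Q j.
Hypothesis Q_psd : forall j (v : 'cV[R[i]]_n), 0 <= complex.Re ((v^t* *m Q j *m v) ord0 ord0).
Implicit Types (x : R).

Local Notation L := (Lx beta d X).
Local Notation J := (Jmx R n).
Local Notation Uk := (Ut th1 beta d X l kappa).
Definition B0 x := Bof th1 beta x (L x).
Definition C0 x := Cof th1 beta x (L x).

Lemma Lx_adj x : (L x)^t* = L x.
Proof. by rewrite /Lx ct_sum; apply: eq_bigr => j _; rewrite Lam_adj. Qed.

Lemma Jmx_adj : J^t* = - J.
Proof.
rewrite /Jmx tr_block_mx map_block_mx !trmx0 !map_mx0 trmx1 map_mx1.
by rewrite linearN /= map_mxN trmx1 map_mx1 opp_block_mx oppr0 opprK.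
Qed.

Lemma JmxJ : J *m J = - 1%:M.
Proof.
rewrite /Jmx mulmx_block !(mul0mx, mulmx0, mul1mx, mulmx1, add0r, addr0).
by rewrite scalar_mx_block opp_block_mx oppr0.
Qed.

Lemma C0E x : C0 x = (B0 x)^t* *m J.
Proof.
rewrite /C0 /B0 /Cof /Bof ctZ ctM ct_col_mx ctM ctN Lx_adj trmxCK -scalemxAl -mulmxA.
have rtC (r : R) : (r%:C%C : R[i])^* = r%:C%C by apply: complex_ext; rewrite !ReImE /= ?oppr0.
rewrite rtC; congr (_ *: _); congr (_ *m _).
rewrite /Jmx mul_row_block !(mulmx0, mulmx1, add0r, addr0).
by rewrite !mulmxN mulmx1 opprK.
Qed.

Lemma Uk_der x : is_mder Uk x (B0 x *m C0 x *m Uk x).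
Proof.
have := Ut_der th1 beta X l d_incr x (leqnn kappa).
by rewrite Lm_kappa.
Qed.

Lemma Uk0 : Uk 0 = 1%:M.
Proof. exact: Ut0. Qed.

Lemma Uk_symplectic x : (Uk x)^t* *m J *m Uk x = J.
Proof.
have dz t : is_mder (fun x => (Uk x)^t* *m J *m Uk x) t 0.
  have dU := Uk_der t.
  apply: mder_eq (mderM (mderMr J (mder_adj dU)) dU) _.
  rewrite !ctM C0E ctM trmxCK Jmx_adj.
  generalize (Uk t) (B0 t) => V W.
  rewrite !(mulmxN, mulNmx) !mulmxA.
  by rewrite addNr.
by rewrite (mder0_cst x 0 dz) Uk0 ct1 mul1mx mulmx1.
Qed.

Lemma Uk_inv x : (J *m (Uk x)^t* *m J^t* ) *m Uk x = 1%:M.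
Proof.
rewrite Jmx_adj mulmxN mulNmx.
have -> : J *m (Uk x)^t* *m J *m Uk x = J *m ((Uk x)^t* *m J *m Uk x) by rewrite !mulmxA.
by rewrite Uk_symplectic JmxJ opprK.
Qed.

Lemma Uk_unit x : Uk x \in unitmx.
Proof. by case: (mulmx1_unit (Uk_inv x)). Qed.

Lemma invmx_Uk x : invmx (Uk x) = J *m (Uk x)^t* *m J^t*.
Proof.
have u := Uk_unit x; have e := Uk_inv x.
by rewrite -[LHS]mul1mx -e -[LHS]mulmxA mulmxV ?mulmx1.
Qed.

Definition dL x : 'M[R[i]]_n := \sum_j (if d j < x then dLam beta (Q j) (x - d j) else 0).

Lemma Lx_der x : (forall j, x != d j) -> is_mder L x (dL x).
Proof.
move=> xd; apply: mder_sum => j _.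
have [dx|xd'] := ltP (d j) x.
  have h : is_mder (fun y => Lam beta (X j) (1 * y + - d j)) x (1%:C%C *: dLam beta (Q j) (1 * x + - d j)).
    by apply: mder_affine; exact: Lam_der.
  rewrite scale1r mul1r in h.
  have near1 : \forall y \near x, Lam beta (X j) (1 * y + - d j) = Lam beta (X j) (Num.max (y - d j) 0).
    apply: filterS (lt_nbhsr dx) => y yd; rewrite mul1r; congr Lam.
    by apply/esym/max_idPl; rewrite subr_ge0 ltW.
  by move=> a b; have [h1 h2] := h a b; split; [apply: near_eq_is_derive h1|apply: near_eq_is_derive h2];
    apply: filterS near1 => y ->.
have {}dx : x < d j by rewrite lt_neqAle xd.
have near1 : \forall y \near x, (0 : 'M[R[i]]_n) = Lam beta (X j) (Num.max (y - d j) 0).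
  apply: filterS (lt_nbhsl dx) => y yd; rewrite -(Lam0 beta (X j)); congr Lam.
  by apply/esym/max_idPr; rewrite subr_le0 ltW.
move=> a b; have [h1 h2] := mder_cst (0 : 'M[R[i]]_n) x a b; split; [apply: near_eq_is_derive h1|apply: near_eq_is_derive h2];
  by apply: filterS near1 => y <-.
Qed.

Lemma Lx_mcont x : mcont L x.
Proof.
apply: mcont_sum => j _; apply: (mcont_comp (h := fun x => Num.max (x - d j) 0)).
  apply: (@continuous_max R R (fun y => y - d j) (fun=> 0)) => //; last exact: cst_continuous.
  by apply: (@continuousB R R R) => //; exact: cst_continuous.
exact: mder_mcont (Lam_der _ (X_sol j)).
Qed.

(** Each term is a congruence 2 E Q_j E^* with E = e^(-2 i (x - d_j) beta), so [Q_psd] applies to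
    the vector E^* v. This is the sign that makes the form in [Uk_lower_trivial] monotone. *)
Lemma dL_psd x (v : 'cV[R[i]]_n) : 0 <= complex.Re ((v^t* *m dL x *m v) ord0 ord0).
Proof.
rewrite mulmx_sumr mulmx_suml summxE Re_sum; apply: sumr_ge0 => j _.
case: ifP => _; last by rewrite mulmx0 mul0mx mxE.
have h := Q_psd j ((phase beta (- (x - d j)))^t* *m v).
have -> : v^t* *m dLam beta (Q j) (x - d j) *m v =
  2 *: (((phase beta (- (x - d j)))^t* *m v)^t* *m Q j *m ((phase beta (- (x - d j)))^t* *m v)).
  rewrite /dLam ctM trmxCK; generalize (phase beta (- (x - d j))) => P.
  by rewrite -scalemxAr -scalemxAl !mulmxA.
rewrite mxE ReM /=; move: h; set a := complex.Re _; nra.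
Qed.

Lemma Re_adj_mul q (f : 'cV[R[i]]_q) :
  complex.Re ((f^t* *m f) ord0 ord0) = \sum_i sqnorm (f i ord0).
Proof.
rewrite mxE Re_sum; apply: eq_bigr => i _; rewrite !mxE ReM Re_conj Im_conj /sqnorm.
by ring.
Qed.

Lemma phase_mcont x : mcont (phase beta) x.
Proof. exact: mder_mcont (phase_der _ _). Qed.

Lemma B0_mcont x : mcont B0 x.
Proof.
apply: mcontZl; apply: mcontM (mcont_cst _ _).
have h := mcont_adj (phase_mcont x).
by apply: mcont_col_mx => //; apply: mcontM => //; apply: mcontN; exact: Lx_mcont.
Qed.

Lemma C0_mcont x : mcont C0 x.
Proof.
apply: (mcont_ext (F := fun x => (B0 x)^t* *m J)) => [y|]; first by rewrite C0E.
apply: mcontM (mcont_cst _ _); apply: mcont_adj; exact: B0_mcont.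
Qed.

Lemma Uk_lower_trivial (v : 'cV[R[i]]_n) : drsubmx (Uk l) *m v = 0 -> v = 0.
Proof.
move=> Uv; pose y x := Uk x *m col_mx 0 v.
pose y1 x := usubmx (y x); pose y2 x := dsubmx (y x).
pose f x := C0 x *m y x.
have dy x : is_mder y x (B0 x *m f x).
  by apply: mder_eq (mderMr _ (Uk_der x)) _; rewrite /f !mulmxA.
have cy x : mcont y x := mder_mcont (dy x).
have cf x : mcont f x by apply: mcontM => //; exact: C0_mcont.
pose rt : R[i] := (Num.sqrt (2%:R : R))%:C%C.
have rtC : rt^* = rt by apply: complex_ext; rewrite !ReImE /= ?oppr0.
pose P x := phase beta x.
have dy2 x : is_mder y2 x (rt *: ((P x)^t* *m th1 *m f x)).
  apply: mder_eq (mder_dsubmx (dy x)) _.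
  by rewrite /B0 /Bof -scalemxAl mul_col_mx mul_col_mx linearZ /= col_mxKd.
have dy1 x : is_mder y1 x (- (L x *m (rt *: ((P x)^t* *m th1 *m f x)))).
  apply: mder_eq (mder_usubmx (dy x)) _.
  rewrite /B0 /Bof -scalemxAl mul_col_mx mul_col_mx linearZ /= col_mxKu -/(P x).
  by rewrite -scalemxAr -scalerN !mulNmx !mulmxA.
(* C y depends on y through [w] alone, and in w' the terms with y2' cancel, which leaves L' y2. *)
pose w x := y1 x + L x *m y2 x.
have fE x : f x = rt *: (th1^t* *m P x *m w x).
  rewrite /f /C0 /Cof -scalemxAl; congr (_ *: _).
  rewrite -[in LHS]mulmxA -[in RHS]mulmxA; congr (_ *m _).
  by rewrite -[y x]vsubmxK mul_row_col -/(y1 x) -/(y2 x) /w -/(P x) mulmxDr !mulmxA.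
pose Ph x := complex.Re (((y2 x)^t* *m w x) ord0 ord0).
have dPh x : (forall j, x != d j) ->
    is_derive x 1 Ph (\sum_i sqnorm (f x i ord0) + complex.Re (((y2 x)^t* *m dL x *m y2 x) ord0 ord0)).
  move=> xd; have dw : is_mder w x (dL x *m y2 x).
    apply: mder_eq (mderD (dy1 x) (mderM (Lx_der xd) (dy2 x))) _.
    by rewrite addrCA addNr addr0.
  have [h _] := mderM (mder_adj (dy2 x)) dw ord0 ord0.
  move: h; rewrite mxE ReD.
  (* The same factor sqrt 2 theta1^* e^(2 i x beta) occurs in f and, adjoint, in y2'. So the first
     term of the derivative is the squared length of f. *)
  have -> : (rt *: ((P x)^t* *m th1 *m f x))^t* *m w x = (f x)^t* *m f x.
    rewrite [X in _ = _ *m X]fE -scalemxAr ctZ rtC -scalemxAl; congr (_ *: _).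
    move: (f x) (P x) (w x) => F P' W.
    by rewrite !ctM trmxCK !mulmxA.
  by rewrite Re_adj_mul mulmxA.
have cPh x : {for x, continuous Ph}.
  have h : mcont (fun x => (y2 x)^t* *m w x) x.
    have c2 : mcont y2 x := mder_mcont (dy2 x).
    apply: mcontM; first exact: mcont_adj.
    apply: mcontD; first exact: mder_mcont (dy1 x).
    by apply: mcontM => //; exact: Lx_mcont.
  by case: (h ord0 ord0).
pose s := [seq d j | j : 'I_kappa].
have off x : x \notin s -> forall j, x != d j.
  move=> xs j; apply: contra xs => /eqP ->; apply/mapP; exists j => //.
  by rewrite mem_enum.
have mono a b : a <= b -> Ph a <= Ph b.
  move=> ab; apply: (nondecreasing_off_finite (s := s) ab).
    by apply: continuous_subspaceT => x; exact: cPh.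
  move=> x _ xs; split; first exact: (dPh x (off x xs)).
  by rewrite addr_ge0// ?dL_psd// sumr_ge0// => i _; exact: sqnorm_ge0.
have Ph0 : Ph 0 = 0.
  have w0 : w 0 = 0.
    rewrite /w /y1 /y2 /y Uk0 mul1mx col_mxKu col_mxKd add0r.
    rewrite /Lx big1 ?mul0mx// => j _.
    by rewrite (_ : Num.max _ _ = 0) ?Lam0//; apply/max_idPr; rewrite sub0r oppr_le0.
  by rewrite /Ph w0 mulmx0 mxE.
have y2l : y2 l = 0.
  rewrite /y2 /y -[Uk l]submxK mul_block_col col_mxKd mulmx0 add0r.
  exact: Uv.
have Phl : Ph l = 0 by rewrite /Ph y2l ct0 mul0mx mxE.
(* A nondecreasing function with equal end values is constant, so both nonnegative parts of its
   derivative vanish off the nodes. *)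
have PhE x : 0 <= x <= l -> Ph x = 0.
  move=> /andP[x0 xl]; apply/eqP; rewrite eq_le.
  by have := mono _ _ x0; have := mono _ _ xl; rewrite Ph0 Phl => -> ->.
have f0 x : 0 < x < l -> (forall j, x != d j) -> f x = 0.
  move=> /andP[x0 xl] xd; have h := dPh x xd.
  have h0 : is_derive x 1 (fun=> 0 : R) (\sum_i sqnorm (f x i ord0) + complex.Re (((y2 x)^t* *m dL x *m y2 x) ord0 ord0)).
    apply: near_eq_is_derive h; apply: filterS2 (lt_nbhsr x0) (lt_nbhsl xl) => z z0 zl.
    by rewrite PhE// !ltW.
  have e := is_derive_uniq h0 (is_derive_cst (0 : R) x 1).
  have p1 : 0 <= \sum_i sqnorm (f x i ord0) by apply: sumr_ge0 => i _; exact: sqnorm_ge0.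
  have p2 := dL_psd x (y2 x).
  have /eqP : \sum_i sqnorm (f x i ord0) = 0.
    by apply/eqP; rewrite eq_le p1 andbT -[leRHS]e lerDl.
  rewrite psumr_eq0 => [/allP h1|i _]; last exact: sqnorm_ge0.
  apply/matrixP => i j; rewrite ord1 [RHS]mxE; apply: sqnorm_eq0; apply/eqP.
  by apply: h1; rewrite mem_index_enum.
have dy20 x : 0 < x < l -> x \notin s -> is_mder y2 x 0.
  move=> x0l xs; apply: mder_eq (dy2 x) _.
  by rewrite f0 ?mulmx0 ?scaler0//; exact: off.
have y20 : y2 0 = y2 l.
  apply/matrixP => i j; have l0 := ltW l_gt0.
  have cc x : ccont (fun x => y2 x i j) x := mder_mcont (dy2 x) i j.
  apply: complex_ext.
  - apply: (cst_off_finite (s := s) (h := fun x => complex.Re (y2 x i j)) l0).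
      by apply: continuous_subspaceT => x; case: (cc x).
    by move=> x x0l xs; have [+ _] := dy20 x x0l xs i j; rewrite mxE.
  - apply: (cst_off_finite (s := s) (h := fun x => complex.Im (y2 x i j)) l0).
      by apply: continuous_subspaceT => x; case: (cc x).
    by move=> x x0l xs; have [_ +] := dy20 x x0l xs i j; rewrite mxE.
by move: y20; rewrite y2l /y2 /y Uk0 mul1mx col_mxKd.
Qed.

Lemma Uk_lower_unit : drsubmx (Uk l) \in unitmx.
Proof.
rewrite -unitmx_tr -(map_unitmx Num.conj) -row_free_unit; apply: inj_row_free => v hv.
have : v^t* = 0.
  apply: Uk_lower_trivial; have := congr1 (fun A => A^t* ) hv.
  by rewrite ctM trmxCK ct0.
by move/(congr1 (fun A => A^t* )); rewrite trmxCK ct0.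
Qed.

End Symplectic.

(** * Products of absolutely continuous functions *)

Section RealPrimitive.
Context {R : realType} (l : R).
Hypothesis l_gt0 : 0 < l.
Local Notation mu := (@lebesgue_measure R).
Implicit Types (x y t : R) (h a da : R -> R).

Definition prim h x := \int[mu]_(t in `]0, x[) h t.

Lemma rint_sub h x y : rint `]0, l[ h -> 0 <= x -> y <= l -> rint `]x, y[ h.
Proof.
move=> hi x0 yl; apply: integrableS hi => // t; rewrite /= !in_itv /= => /andP[xt ty].
by rewrite (le_lt_trans x0 xt) (lt_le_trans ty yl).
Qed.

Lemma prim0 h : prim h 0 = 0.
Proof. by rewrite /prim set_itv_ge ?Rintegral_set0// bnd_simp ltxx. Qed.

Lemma primB h x y : rint `]0, l[ h -> 0 <= x -> x <= y -> y <= l ->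
  prim h y - prim h x = \int[mu]_(t in `]x, y[) h t.
Proof.
move=> hi x0; rewrite le_eqVlt => /predU1P[-> _|xy yl].
  by rewrite subrr set_itv_ge ?Rintegral_set0// bnd_simp ltxx.
have iy := rint_sub hi (lexx 0) yl.
rewrite -(Rintegral_itvB (x := x) iy) ?bnd_simp//.
by congr (_ - _); apply: Rintegral_itv_bndo_bndc; apply: (rint_sub hi) => //; exact: le_trans (ltW xy) yl.
Qed.

Lemma rint_norm D h : measurable D -> rint D h -> rint D (fun t => `|h t|).
Proof. by move=> mD hi; exact: integrable_norm hi. Qed.

Lemma prim_norm h x y : rint `]0, l[ h -> 0 <= x -> x <= y -> y <= l ->
  `|prim h y - prim h x| <= prim (fun t => `|h t|) y - prim (fun t => `|h t|) x.
Proof.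
move=> hi x0 xy yl; rewrite !primB//; last exact: rint_norm.
by apply: le_normr_Rintegral => //; exact: rint_sub.
Qed.

Lemma prim_bound h x : rint `]0, l[ h -> 0 <= x <= l -> `|prim h x| <= prim (fun t => `|h t|) l.
Proof.
move=> hi /andP[x0 xl]; have := prim_norm hi (lexx 0) x0 xl; rewrite !prim0 !subr0 => /le_trans; apply.
have hn := rint_norm (measurable_itv _) hi.
rewrite -subr_ge0 primB//; apply: Rintegral_ge0 => t _; exact: normr_ge0.
Qed.

Lemma prim_measurable h : rint `]0, l[ h -> measurable_fun `]0, l[ (prim h).
Proof.
move=> hi; pose h0 := h \_ `]0, l[.
have i0 : mu.-integrable `[0, l] (EFin \o h0).
  apply: (@integrableS _ _ _ mu setT) => //.
  by rewrite /h0 -restrict_EFin; apply/integrable_restrict => //=; rewrite setTI.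
have := parameterized_integral_continuous (ltW l_gt0) i0.
move=> /(subspace_continuous_measurable_fun (measurable_itv _)) m1.
have m2 : measurable_fun `]0, l[ (fun x => parameterized_integral mu 0 x h0).
  by apply: measurable_funS m1 => // t; rewrite /= !in_itv /= => /andP[/ltW -> /ltW ->].
apply: eq_measurable_fun m2 => x; rewrite inE /= in_itv /= => /andP[x0 xl].
rewrite /parameterized_integral /h0 -Rintegral_mkcondr.
have -> : `[0, x] `&` `]0, l[ = `]0, x]%classic :> set R.
  apply/seteqP; split => t /=; rewrite !in_itv /=; first by move=> [/andP[_ ->] /andP[-> _]].
  by move=> /andP[t0 tx]; rewrite tx t0 (ltW t0) (le_lt_trans tx xl).
by rewrite -Rintegral_itv_bndo_bndc//; apply: (rint_sub hi) => //; exact: ltW.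
Qed.

Lemma rint_mul_bounded D (h k : R -> R) (K : R) : measurable D -> rint D h -> measurable_fun D k ->
  (forall t, D t -> `|k t| <= K) -> rint D (fun t => k t * h t).
Proof.
move=> mD hi mk kK; apply: (@le_integrable _ _ _ mu D mD _ (EFin \o (fun t => K * h t))); last exact: rintZ.
  by apply/measurable_EFinP; apply: measurable_funM => //; have /measurable_EFinP := measurable_int _ hi.
move=> t Dt /=; rewrite lee_fin !normrM ler_wpM2r//.
by apply: le_trans (kK t Dt) (ler_norm _).
Qed.

Lemma rint_bounded (k : R -> R) (K : R) : measurable_fun `]0, l[ k ->
  (forall t, 0 < t < l -> `|k t| <= K) -> rint `]0, l[ k.
Proof.
move=> mk kK; have i1 : rint `]0, l[ (fun=> 1).
  by apply: integrableS (rint_cont (a := 0) (b := l) (h := fun=> 1) _) => //;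
    [move=> t; rewrite /= !in_itv /= => /andP[/ltW -> /ltW ->]|move=> x _; exact: cst_continuous].
have := rint_mul_bounded (measurable_itv _) i1 mk (K := K) (fun t => _).
move=> h; apply: rint_ext (h _) _ => //; first by move=> t _; rewrite mulr1.
Qed.

Lemma rint_intD D h k : measurable D -> rint D h -> rint D k ->
  \int[mu]_(t in D) (h t + k t) = \int[mu]_(t in D) h t + \int[mu]_(t in D) k t.
Proof. by move=> mD hi ki; exact: RintegralD. Qed.

Lemma rint_intZ D (c : R) h : measurable D -> rint D h ->
  \int[mu]_(t in D) (c * h t) = c * \int[mu]_(t in D) h t.
Proof. by move=> mD hi; exact: RintegralZl. Qed.

(* Summing over an even subdivision into [m] parts gives [O(1 / m)]. *)
Lemma increments_cst (D N : R -> R) (K : R) :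
  (forall x y, 0 <= x -> x <= y -> y <= l -> `|D y - D x| <= K * (y - x) * (N y - N x)) ->
  D l = D 0.
Proof.
move=> H; apply/eqP; rewrite -subr_eq0 -normr_le0; set Cst := K * l * (N l - N 0).
have key (n : nat) : `|D l - D 0| * n.+1%:R <= Cst.
  pose s (i : nat) := i%:R * (l / n.+1%:R).
  have q0 : 0 <= l / n.+1%:R by rewrite divr_ge0// ltW.
  have sn : s n.+1 = l by rewrite /s mulrC divfK// pnatr_eq0.
  have smono i j : (i <= j)%N -> s i <= s j by move=> ij; rewrite ler_wpM2r// ler_nat.
  have s0 : s 0%N = 0 by rewrite /s mul0r.
  have st i : s i.+1 - s i = l / n.+1%:R by rewrite /s -mulrBl -natrB// subSnn mul1r.
  have ind i : (i <= n.+1)%N -> `|D (s i) - D 0| <= K * (l / n.+1%:R) * (N (s i) - N 0).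
    elim: i => [_|i ih iN]; first by rewrite s0 !subrr normr0 mulr0.
    have h1 := ih (ltnW iN).
    have h2 : `|D (s i.+1) - D (s i)| <= K * (l / n.+1%:R) * (N (s i.+1) - N (s i)).
      rewrite -(st i); apply: H; first by rewrite -s0 smono.
        exact: smono.
      by rewrite -sn smono.
    have -> : D (s i.+1) - D 0 = (D (s i.+1) - D (s i)) + (D (s i) - D 0) by ring.
    apply: le_trans (ler_normD _ _) _; apply: le_trans (lerD h2 h1) _.
    by rewrite -mulrDr addrA subrK.
  have := ind n.+1 (leqnn _); rewrite sn => h.
  have n0 : 0 < n.+1%:R :> R by [].
  rewrite -ler_pdivlMr//; apply: le_trans h _; rewrite /Cst.
  by rewrite le_eqVlt; apply/orP; left; apply/eqP; ring.
rewrite leNgt; apply/negP => d0.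
have := key (Num.truncn (Cst / `|D l - D 0|)); rewrite leNgt => /negP; apply.
by rewrite mulrC -ltr_pdivrMr// truncnS_gt.
Qed.

(** Integration by parts with one factor merely integrable. On [x, y] the defect consists of the
    integrals of [e1] and [e2], each at most K (y - x) times the integral of |h|; [increments_cst]
    turns this into equality. *)
Lemma prim_product h a da : rint `]0, l[ h ->
  (forall x, is_derive x 1 a (da x)) -> (forall x, {for x, continuous da}) ->
  rint `]0, l[ (fun t => da t * prim h t + a t * h t) /\
  a l * prim h l = prim (fun t => da t * prim h t + a t * h t) l.
Proof.
move=> hi dda cda; have mI : measurable (`]0, l[ : set R) by [].
have ca x : {for x, continuous a} := is_derive_continuous (dda x).
have bnd (k : R -> R) : (forall x, {for x, continuous k}) ->
    exists2 K, 0 <= K & forall x, 0 <= x <= l -> `|k x| <= K.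
  move=> ck; have cn : {within `[0, l], continuous (fun x => `|k x|)}.
    by apply: continuous_subspaceT => x; exact: (continuous_comp (ck x) (@norm_continuous R R _)).
  have [c _ Hc] := EVT_max (ltW l_gt0) cn.
  by exists `|k c| => // x xl; apply: Hc; rewrite in_itv.
have [K1 K10 HK1] := bnd a ca; have [K K0 HK] := bnd da cda.
have mc (k : R -> R) D : (forall x, {for x, continuous k}) -> measurable_fun D k.
  by move=> ck; apply: measurable_funTS; exact: continuous_measurable_fun.
have hn := rint_norm mI hi.
set Nn := prim (fun t => `|h t|).
have mP := prim_measurable hi.
have iP : rint `]0, l[ (prim h).
  by apply: (rint_bounded mP (K := Nn l)) => t /andP[t0 tl]; apply: prim_bound => //; rewrite !ltW.
have i1 : rint `]0, l[ (fun t => da t * prim h t).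
  apply: (rint_mul_bounded mI iP (mc da _ cda) (K := K)) => t.
  by rewrite /= in_itv /= => /andP[/ltW t0 /ltW tl]; apply: HK; rewrite t0.
have i2 : rint `]0, l[ (fun t => a t * h t).
  apply: (rint_mul_bounded mI hi (mc a _ ca) (K := K1)) => t.
  by rewrite /= in_itv /= => /andP[/ltW t0 /ltW tl]; apply: HK1; rewrite t0.
have i3 := rintD mI i1 i2; split => //.
pose Dl x := a x * prim h x - prim (fun t => da t * prim h t + a t * h t) x.
suff : Dl l = Dl 0.
  by rewrite /Dl !prim0 mulr0 subrr => /eqP; rewrite subr_eq0 => /eqP.
apply: (increments_cst (N := Nn) (K := 2 * K)) => x y x0 xy yl.
have mJ : measurable (`]x, y[ : set R) by [].
have sub t : `]x, y[%classic t -> 0 <= t <= l /\ x < t < y.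
  rewrite /= in_itv /= => /andP[xt ty]; split; last by rewrite xt.
  by rewrite (le_trans x0 (ltW xt)) (le_trans (ltW ty) yl).
pose e1 t := da t * (prim h t - prim h x); pose e2 t := (a t - a y) * h t.
have jh : rint `]x, y[ h by exact: rint_sub.
have jhn : rint `]x, y[ (fun t => `|h t|) by exact: rint_norm.
have jd : rint `]x, y[ da.
  apply: integrableS (rint_cont (a := x) (b := y) (h := da) _) => //.
  by move=> t; rewrite /= !in_itv /= => /andP[/ltW -> /ltW ->].
have j1 : rint `]x, y[ (fun t => da t * prim h t) by exact: rint_sub.
have j2 : rint `]x, y[ (fun t => a t * h t) by exact: rint_sub.
have je1 : rint `]x, y[ e1.
  by apply: rint_ext (rintB mJ j1 (rintZ (prim h x) mJ jd)) mJ => t _; rewrite /e1; ring.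
have je2 : rint `]x, y[ e2.
  by apply: rint_ext (rintB mJ j2 (rintZ (a y) mJ jh)) mJ => t _; rewrite /e2; ring.
have Ida : \int[mu]_(t in `]x, y[) da t = a y - a x.
  rewrite -(rint_FTC xy (fun z _ => dda z) (fun z _ => cda z)).
  move: xy; rewrite le_eqVlt => /predU1P[e|xy].
    by rewrite e set_itv_ge ?bnd_simp ?ltxx// Rintegral_set0 set_itv1 Rintegral_set1.
  rewrite Rintegral_itv_bndo_bndc// Rintegral_itv_obnd_cbnd//.
  apply: integrableS (rint_cont (a := x) (b := y) (h := da) _) => //.
  by move=> t; rewrite /= !in_itv /= => /andP[/ltW -> ->].
have Ih : \int[mu]_(t in `]x, y[) (da t * prim h t + a t * h t) =
    prim h x * (a y - a x) + a y * (prim h y - prim h x) +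
    (\int[mu]_(t in `]x, y[) e1 t + \int[mu]_(t in `]x, y[) e2 t).
  have s1 := rintZ (prim h x) mJ jd; have s2 := rintZ (a y) mJ jh.
  transitivity (\int[mu]_(t in `]x, y[) ((prim h x * da t + a y * h t) + (e1 t + e2 t))).
    by apply: eq_Rintegral => t _; rewrite /e1 /e2; ring.
  rewrite (@rint_intD _ (fun t => prim h x * da t + a y * h t) (fun t => e1 t + e2 t) mJ (rintD mJ s1 s2) (rintD mJ je1 je2)).
  rewrite (rint_intD mJ s1 s2) (rint_intD mJ je1 je2) (rint_intZ _ mJ jd) (rint_intZ _ mJ jh).
  by rewrite Ida (primB hi x0 xy yl).
have -> : Dl y - Dl x = - (\int[mu]_(t in `]x, y[) e1 t + \int[mu]_(t in `]x, y[) e2 t).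
  have := primB i3 x0 xy yl; rewrite Ih /Dl.
  move: (prim (fun t => da t * prim h t + a t * h t) y) (prim (fun t => da t * prim h t + a t * h t) x).
  move=> Py Px hh; have -> : Py = Px + (Py - Px) by ring.
  by rewrite hh; ring.
rewrite normrN; apply: le_trans (ler_normD _ _) _.
have Nxy : Nn y - Nn x = \int[mu]_(t in `]x, y[) `|h t| by rewrite primB.
have Nx0 : 0 <= Nn y - Nn x by rewrite Nxy; apply: Rintegral_ge0 => t _; exact: normr_ge0.
have b1 : `|\int[mu]_(t in `]x, y[) e1 t| <= K * (Nn y - Nn x) * (y - x).
  apply: le_trans (@le_normr_Rintegral _ _ _ mu _ _ mJ je1) _.
  apply: (@le_trans _ _ (\int[mu]_(t in `]x, y[) (K * (Nn y - Nn x)))).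
    apply: le_Rintegral => //; first exact: rint_norm.
      apply: integrableS (rint_cont (a := x) (b := y) (h := fun=> K * (Nn y - Nn x)) _) => //.
        by move=> t; rewrite /= !in_itv /= => /andP[/ltW -> /ltW ->].
      by move=> z _; exact: cst_continuous.
    move=> t /sub[t0l /andP[xt ty]]; rewrite /e1 normrM ler_pM//; first exact: HK.
    apply: le_trans (prim_norm hi x0 (ltW xt) _) _; first by case/andP: t0l.
    rewrite lerD2r -subr_ge0 primB ?(ltW ty)//; last by case/andP: t0l.
    by apply: Rintegral_ge0 => z _; exact: normr_ge0.
  have fm : fine (mu `]x, y[) = y - x.
    rewrite lebesgue_measure_itv /= lte_fin.
    by move: xy; rewrite le_eqVlt => /predU1P[->|->//]; rewrite ltxx subrr.
  by rewrite Rintegral_cst// -[X in _ <= _ * X]fm.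
have b2 : `|\int[mu]_(t in `]x, y[) e2 t| <= K * (y - x) * (Nn y - Nn x).
  apply: le_trans (@le_normr_Rintegral _ _ _ mu _ _ mJ je2) _.
  rewrite Nxy -RintegralZl//; apply: le_Rintegral => //; first exact: rint_norm.
    exact: rintZ.
  move=> t /sub[t0l /andP[xt ty]]; rewrite /e2 normrM ler_wpM2r// distrC.
  apply: (@le_trans _ _ (K * (y - t))).
    apply: (is_derive_bound (ltW ty) (fun z _ => dda z)) => z /andP[tz zy]; apply: HK.
    by rewrite (le_trans _ tz) ?(le_trans zy yl)//; case/andP: t0l.
  by rewrite ler_wpM2l// lerB// ltW.
by apply: le_trans (lerD b1 b2) _; rewrite le_eqVlt; apply/orP; left; apply/eqP; ring.
Qed.

End RealPrimitive.

Section ComplexPrimitive.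
Context {R : realType}.
Local Notation mu := (@lebesgue_measure R).
Implicit Types (l x t : R) (f a da : R -> R[i]).

Definition cprim f x := cint `]0, x[ f.
Definition mprim q r (F : R -> 'M[R[i]]_(q, r)) x := mxint `]0, x[ F.

Lemma Re_cprim f x : complex.Re (cprim f x) = prim (fun t => complex.Re (f t)) x.
Proof. by []. Qed.

Lemma Im_cprim f x : complex.Im (cprim f x) = prim (fun t => complex.Im (f t)) x.
Proof. by []. Qed.

Lemma cprim_product l f a da : 0 < l -> cintegrable `]0, l[ f ->
  (forall x, is_cder a x (da x)) -> (forall x, ccont da x) ->
  cintegrable `]0, l[ (fun t => da t * cprim f t + a t * f t) /\
  a l * cprim f l = cprim (fun t => da t * cprim f t + a t * f t) l.
Proof.
move=> l0 [f1 f2] dda cda; have mI : measurable (`]0, l[ : set R) by [].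
have [i11 e11] := prim_product l0 f1 (fun x => (dda x).1) (fun x => (cda x).1).
have [i12 e12] := prim_product l0 f2 (fun x => (dda x).1) (fun x => (cda x).1).
have [i21 e21] := prim_product l0 f1 (fun x => (dda x).2) (fun x => (cda x).2).
have [i22 e22] := prim_product l0 f2 (fun x => (dda x).2) (fun x => (cda x).2).
have eRe t : complex.Re (da t) * prim (fun t => complex.Re (f t)) t + complex.Re (a t) * complex.Re (f t) -
   (complex.Im (da t) * prim (fun t => complex.Im (f t)) t + complex.Im (a t) * complex.Im (f t)) =
   complex.Re (da t * cprim f t + a t * f t).
  by rewrite ReD !ReM Re_cprim Im_cprim; ring.
have eIm t : complex.Re (da t) * prim (fun t => complex.Im (f t)) t + complex.Re (a t) * complex.Im (f t) +
   (complex.Im (da t) * prim (fun t => complex.Re (f t)) t + complex.Im (a t) * complex.Re (f t)) =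
   complex.Im (da t * cprim f t + a t * f t).
  by rewrite ImD !ImM Re_cprim Im_cprim; ring.
split.
  by split; [apply: rint_ext (rintB mI i11 i22) mI => t _; exact: eRe|
    apply: rint_ext (rintD mI i12 i21) mI => t _; exact: eIm].
apply: complex_ext.
- rewrite ReM !Re_cprim Im_cprim e11 e22 -[RHS]/(\int[mu]_(t in `]0, l[) _).
  rewrite -RintegralB//; apply: eq_Rintegral => t _; exact: eRe.
- rewrite ImM !Im_cprim Re_cprim e12 e21.
  rewrite -rint_intD//; apply: eq_Rintegral => t _; exact: eIm.
Qed.

Lemma mprimE q r (F : R -> 'M[R[i]]_(q, r)) x i j : mprim F x i j = cprim (fun t => F t i j) x.
Proof. exact: mxintE. Qed.

Lemma mprim0 q r (F : R -> 'M[R[i]]_(q, r)) : mprim F 0 = 0.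
Proof.
apply/matrixP => i j; rewrite mprimE mxE; apply: complex_ext; first by rewrite Re_cprim prim0.
by rewrite Im_cprim prim0.
Qed.

Lemma mprim_product q r s l (F : R -> 'M[R[i]]_(r, s)) (A dA : R -> 'M[R[i]]_(q, r)) :
  0 < l -> mx_integrable `]0, l[ F ->
  (forall x, is_mder A x (dA x)) -> (forall x, mcont dA x) ->
  mx_integrable `]0, l[ (fun t => dA t *m mprim F t + A t *m F t) /\
  A l *m mprim F l = mprim (fun t => dA t *m mprim F t + A t *m F t) l.
Proof.
move=> l0 hF ddA cdA; have mI : measurable (`]0, l[ : set R) by [].
have h i k j := cprim_product l0 (hF k j) (fun x => ddA x i k) (fun x => cdA x i k).
have e t i j : \sum_k (dA t i k * cprim (fun t => F t k j) t + A t i k * F t k j) =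
    (dA t *m mprim F t + A t *m F t) i j.
  rewrite [RHS]mxE [X in _ = X + _]mxE [X in _ = _ + X]mxE -big_split /=.
  by apply: eq_bigr => k _; rewrite mprimE.
split=> [i j|].
  apply: (cintegrable_ext (f := fun t => \sum_k (dA t i k * cprim (fun t => F t k j) t + A t i k * F t k j)) mI).
    by move=> t _; rewrite e.
  by apply: cintegrable_sum => // k _; case: (h i k j).
apply/matrixP => i j; rewrite mprimE [LHS]mxE.
transitivity (\sum_k cprim (fun t => dA t i k * cprim (fun t => F t k j) t + A t i k * F t k j) l).
  by apply: eq_bigr => k _; rewrite mprimE; case: (h i k j).
rewrite /cprim -cint_sum//; last by move=> k _; case: (h i k j).
by apply: cint_ext => t _; rewrite -e.
Qed.

Lemma mx_integrable_cont q r l (F : R -> 'M[R[i]]_(q, r)) :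
  (forall x, mcont F x) -> mx_integrable `]0, l[ F.
Proof.
move=> cF i j; have [h1 h2] : cintegrable `[0, l] (fun x => F x i j).
  by apply: cintegrable_cont => x _; exact: cF.
have sub : `]0, l[ `<=` `[0, l]%classic by move=> t; rewrite /= !in_itv /= => /andP[/ltW -> /ltW ->].
by split; [apply: integrableS h1|apply: integrableS h2].
Qed.

Lemma mprim_FTC q r l (A dA : R -> 'M[R[i]]_(q, r)) : 0 <= l ->
  (forall x, is_mder A x (dA x)) -> (forall x, mcont dA x) -> mprim dA l = A l - A 0.
Proof.
move=> l0 ddA cdA; rewrite -(mxint_FTC l0 (fun x _ => ddA x) (fun x _ => cdA x)).
move: l0; rewrite le_eqVlt => /predU1P[<-|l0].
  rewrite -/(mprim dA 0) mprim0; apply/matrixP => i j; rewrite !mxE.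
  by apply: complex_ext; rewrite /= set_itv1 Rintegral_set1.
apply/matrixP => i j; rewrite !mxE; have [h1 h2] := mx_integrable_cont l cdA i j.
have hc : cintegrable `]0, l] (fun x => dA x i j).
  have [k1 k2] : cintegrable `[0, l] (fun x => dA x i j).
    by apply: cintegrable_cont => x _; exact: cdA.
  have sub : `]0, l] `<=` `[0, l]%classic by move=> t; rewrite /= !in_itv /= => /andP[/ltW -> ->].
  by split; [apply: integrableS k1|apply: integrableS k2].
congr Complex.
- by rewrite Rintegral_itv_bndo_bndc// Rintegral_itv_obnd_cbnd//; case: hc.
- by rewrite Rintegral_itv_bndo_bndc// Rintegral_itv_obnd_cbnd//; case: hc.
Qed.

(** The product rule for A times (primitive of F minus v). It is applied below with A = U^-1 and
    with A = U, where v carries the boundary condition at l. *)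
Lemma mprim_shift q r s l x (F : R -> 'M[R[i]]_(r, s)) (A dA : R -> 'M[R[i]]_(q, r)) v :
  0 <= x <= l -> mx_integrable `]0, l[ F ->
  (forall x, is_mder A x (dA x)) -> (forall x, mcont dA x) ->
  mprim (fun t => dA t *m (mprim F t - v) + A t *m F t) x =
  A x *m (mprim F x - v) + A 0 *m v.
Proof.
move=> /andP[x0 xl] hF ddA cdA; move: x0; rewrite le_eqVlt => /predU1P[<-|x0].
  by rewrite !mprim0 sub0r mulmxN addNr.
have hFx : mx_integrable `]0, x[ F.
  move=> i j; have [h1 h2] := hF i j.
  have sub : `]0, x[ `<=` `]0, l[%classic by move=> t; rewrite /= !in_itv /= => /andP[-> /lt_le_trans ->].
  by split; [apply: integrableS h1|apply: integrableS h2].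
have mI : measurable (`]0, x[ : set R) by [].
have [i1 e1] := mprim_product x0 hFx ddA cdA.
have i2 : mx_integrable `]0, x[ dA := mx_integrable_cont x cdA.
have i3 := mx_integrableMr (- v) mI i2.
transitivity (mprim (fun t => (dA t *m mprim F t + A t *m F t) + dA t *m (- v)) x).
  by apply: mxint_ext => t _; rewrite mulmxBr mulmxN addrAC.
have e2 : mprim (fun t => (dA t *m mprim F t + A t *m F t) + dA t *m (- v)) x =
    mprim (fun t => dA t *m mprim F t + A t *m F t) x + mprim (fun t => dA t *m (- v)) x.
  exact: mxintD mI i1 i3.
have e3 : mprim (fun t => dA t *m (- v)) x = mprim dA x *m (- v) := mxintMr (- v) mI i2.
rewrite e2 e3 -e1 (mprim_FTC (ltW x0) ddA cdA).
by rewrite mulmxBl !mulmxN opprK mulmxBr addrA.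
Qed.

End ComplexPrimitive.

(** * Operators with semiseparable kernels *)

Section SquareIntegrable.
Context {R : realType} (l : R).
Hypothesis l_gt0 : 0 < l.
Local Notation mu := (@lebesgue_measure R).
Local Notation D := (`]0, l[%classic : set R).
Implicit Types (x t : R).

Let mD : measurable D := measurable_itv _.

Lemma rint_if (a b : R -> R) x : rint D a -> rint D b -> 0 < x < l ->
  rint D (fun t => if t < x then a t else b t) /\
  \int[mu]_(t in D) (if t < x then a t else b t) = prim a x + (prim b l - prim b x).
Proof.
move=> ia ib /andP[x0 xl]; set h := fun t => _.
have ih : rint D h.
  apply: (@le_integrable _ _ _ mu D mD _ (EFin \o (fun t => `|a t| + `|b t|))).
  - apply/measurable_EFinP; apply: measurable_fun_if => //.
    + by apply: measurable_fun_ltr => //; exact: measurable_cst.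
    + apply: measurable_funS (_ : measurable_fun D a); [exact: mD|exact: subIsetl|].
      by have /measurable_EFinP := measurable_int _ ia.
    + apply: measurable_funS (_ : measurable_fun D b); [exact: mD|exact: subIsetl|].
      by have /measurable_EFinP := measurable_int _ ib.
  - move=> t _ /=; rewrite lee_fin [leRHS]ger0_norm ?addr_ge0// /h.
    by case: ifP => _; rewrite ?lerDl ?lerDr.
  - by apply: rintD => //; exact: rint_norm.
split => //; rewrite -[LHS](subrK (prim h x)) -[X in X - _]/(prim h l) (primB ih (ltW x0) (ltW xl))//.
rewrite addrC; congr (_ + _).
  by apply: eq_Rintegral => t; rewrite inE /= in_itv /= /h => /andP[_ ->].
rewrite (primB ib (ltW x0) (ltW xl))//; apply: eq_Rintegral => t; rewrite inE /= in_itv /= /h => /andP[xt _].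
by rewrite ltNge (ltW xt).
Qed.

Lemma mxint_if q r (F G : R -> 'M[R[i]]_(q, r)) x : mx_integrable D F -> mx_integrable D G -> 0 < x < l ->
  mx_integrable D (fun t => if t < x then F t else G t) /\
  mxint D (fun t => if t < x then F t else G t) = mprim F x + (mprim G l - mprim G x).
Proof.
move=> hF hG xl.
have e t i j : (if t < x then F t else G t) i j = if t < x then F t i j else G t i j by case: ifP.
have h1 i j := rint_if (hF i j).1 (hG i j).1 xl.
have h2 i j := rint_if (hF i j).2 (hG i j).2 xl.
split=> [i j|].
  split; [apply: rint_ext (h1 i j).1 mD|apply: rint_ext (h2 i j).1 mD] => t _;
    by rewrite e; case: ifP.
apply/matrixP => i j; rewrite [RHS]mxE [X in _ = _ + X]mxE [X in _ = _ + (_ + X)]mxE.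
apply: complex_ext; rewrite mxintE.
- rewrite ReD ReD ReN !mprimE !Re_cprim -(h1 i j).2; apply: eq_Rintegral => t _.
  by rewrite e; case: ifP.
- rewrite ImD ImD ImN !mprimE !Im_cprim -(h2 i j).2; apply: eq_Rintegral => t _.
  by rewrite e; case: ifP.
Qed.

Lemma mprim_measurable q r (F : R -> 'M[R[i]]_(q, r)) : mx_integrable D F -> mx_measurable D (mprim F).
Proof.
move=> hF i j; have [h1 h2] := hF i j.
by split; [apply: eq_measurable_fun (prim_measurable l_gt0 h1)|apply: eq_measurable_fun (prim_measurable l_gt0 h2)] => t _;
  rewrite mprimE.
Qed.

Lemma mprim_bounded q r (F : R -> 'M[R[i]]_(q, r)) : mx_integrable D F ->
  exists K : R, forall x, 0 <= x <= l -> mnorm (mprim F x) <= K.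
Proof.
move=> hF; pose b i j := prim (fun t => `|complex.Re (F t i j)|) l + prim (fun t => `|complex.Im (F t i j)|) l.
exists (\sum_i \sum_j b i j) => x xl; apply: ler_sum => i _; apply: ler_sum => j _.
have [h1 h2] := hF i j.
by rewrite mprimE /c1 Re_cprim Im_cprim lerD// prim_bound.
Qed.

Lemma sqnorm_integrable (f : R -> R[i]) : cmeasurable D f ->
  (\int[mu]_(x in D) (sqnorm (f x))%:E < +oo)%E -> rint D (fun x => sqnorm (f x)).
Proof.
move=> [m1 m2] fin; apply/integrableP; split; first exact: measurable_sqnorm.
apply: le_lt_trans fin; rewrite le_eqVlt; apply/orP; left; apply/eqP.
by apply: eq_integral => x _; rewrite /= ger0_norm// sqnorm_ge0.
Qed.

Lemma mxL2_integrable q r (F : R -> 'M[R[i]]_(q, r)) : mxL2 D F -> mx_integrable D F.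
Proof.
move=> [mF fF] i j; have iq := sqnorm_integrable (mF i j) (fF i j).
have i1 : rint D (fun=> 1) by apply: (rint_bounded (K := 1)) => // t _; rewrite normr1.
have [m1 m2] := mF i j.
(* On a bounded interval square integrability implies integrability, by |u| at most 1 + u^2. *)
have bd (u : R) (v : R) : `|u| <= 1 + (u ^+ 2 + v ^+ 2).
  have := sqr_ge0 (`|u| - 1); have := sqr_ge0 u; have := sqr_ge0 v; rewrite -(real_normK (num_real u)); nra.
have q0 t : 0 <= 1 + sqnorm (F t i j) := addr_ge0 ler01 (sqnorm_ge0 _).
split; apply: (@le_integrable _ _ _ mu D mD _ (EFin \o (fun t => 1 + sqnorm (F t i j)))); try exact: rintD.
- exact/measurable_EFinP.
- by move=> t _; rewrite /= lee_fin (ger0_norm (q0 t)); exact: bd.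
- exact/measurable_EFinP.
- move=> t _; rewrite /= lee_fin (ger0_norm (q0 t)).
  by rewrite /sqnorm [X in 1 + X]addrC; exact: bd.
Qed.

Lemma mxL2_bounded q r (F : R -> 'M[R[i]]_(q, r)) (K : R) : mx_measurable D F ->
  (forall x, 0 < x < l -> mnorm (F x) <= K) -> mxL2 D F.
Proof.
move=> mF FK; split => // i j; have [m1 m2] := mF i j.
have h : rint D (fun x => sqnorm (F x i j)).
  apply: (rint_bounded (K := K ^+ 2)) => //.
    by apply/measurable_EFinP; exact: measurable_sqnorm.
  move=> t tl; rewrite ger0_norm ?sqnorm_ge0//; apply: le_trans (sqnorm_le_c1 _) _.
  have h := le_trans (c1_le_mnorm (F t) i j) (FK t tl).
  by rewrite lerXn2r ?nnegrE ?c1_ge0// (le_trans (c1_ge0 _) h).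
have /integrableP[_] := h; apply: le_lt_trans; rewrite le_eqVlt; apply/orP; left; apply/eqP.
by apply: eq_integral => x _; rewrite /= ger0_norm// sqnorm_ge0.
Qed.

Lemma mxL2D q r (F G : R -> 'M[R[i]]_(q, r)) : mxL2 D F -> mxL2 D G -> mxL2 D (fun x => F x + G x).
Proof.
move=> [mF fF] [mG fG]; split; first exact: mx_measurableD.
move=> i j; have i1 := sqnorm_integrable (mF i j) (fF i j).
have i2 := sqnorm_integrable (mG i j) (fG i j).
have /integrableP[_] := rintZ 2 mD (rintD mD i1 i2); apply: le_lt_trans.
have [m1 m2] := mx_measurableD mF mG i j.
apply: ge0_le_integral => //.
- by move=> x _; rewrite lee_fin sqnorm_ge0.
- exact: measurable_sqnorm.
- apply/measurable_EFinP; apply: measurableT_comp => //.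
  have /measurable_EFinP := measurable_int _ (rintZ 2 mD (rintD mD i1 i2)); exact.
- move=> x _; rewrite /= lee_fin mxE; apply: le_trans (sqnormD_le _ _) _; exact: ler_norm.
Qed.

Lemma mx_integrable_mulcont q r s (G : R -> 'M[R[i]]_(q, r)) (F : R -> 'M[R[i]]_(r, s)) :
  (forall x, mcont G x) -> mx_integrable D F -> mx_integrable D (fun t => G t *m F t).
Proof.
move=> cG hF i j.
have [K K0 HK] := mcont_bounded (a := 0) (b := l) (fun x _ => cG x).
have mG := mcont_measurable mD cG.
apply: (cintegrable_ext (f := fun t => \sum_k G t i k * F t k j) mD); first by move=> t _; rewrite mxE.
apply: cintegrable_sum => // k _; have [f1 f2] := hF k j; have [g1 g2] := mG i k.
have bd t : D t -> `|complex.Re (G t i k)| <= K /\ `|complex.Im (G t i k)| <= K.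
  rewrite /= in_itv /= => /andP[/ltW t0 /ltW tl].
  have h : c1 (G t i k) <= K by apply: le_trans (c1_le_mnorm _ _ _) (HK t _); rewrite t0.
  by split; apply: le_trans h; [exact: c1_Re|exact: c1_Im].
have b1 t (Dt : D t) := (bd t Dt).1; have b2 t (Dt : D t) := (bd t Dt).2.
split.
- apply: rint_ext (rintB mD (rint_mul_bounded mD f1 g1 b1) (rint_mul_bounded mD f2 g2 b2)) mD => t _.
  by rewrite ReM.
- apply: rint_ext (rintD mD (rint_mul_bounded mD f2 g1 b1) (rint_mul_bounded mD f1 g2 b2)) mD => t _.
  by rewrite ImM.
Qed.

End SquareIntegrable.

Section SemiseparableOperators.
Context {R : realType} (l : R) (p q : nat).
Hypothesis l_gt0 : 0 < l.
Local Notation D := (`]0, l[%classic : set R).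
Implicit Types (x t : R) (f : R -> 'cV[R[i]]_p).

Let mD : measurable D := measurable_itv _.

Definition semisep (H : R -> 'M[R[i]]_(p, q)) (M1 M2 : 'M[R[i]]_q) (G : R -> 'M[R[i]]_(q, p)) x t :=
  H x *m (if t < x then M1 else M2) *m G t.

Section Action.
Variables (H : R -> 'M[R[i]]_(p, q)) (M1 M2 : 'M[R[i]]_q) (G : R -> 'M[R[i]]_(q, p)).
Hypothesis cH : forall x, mcont H x.
Hypothesis cG : forall x, mcont G x.

(** Splitting at t = x reduces the operator to one primitive, that of G f, and its value at l. *)
Lemma semisep_int f x : mx_integrable D f -> 0 < x < l ->
  mx_integrable D (fun t => semisep H M1 M2 G x t *m f t) /\
  int_op l (semisep H M1 M2 G) f x = f x + H x *m
    (M1 *m mprim (fun t => G t *m f t) x +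
     M2 *m (mprim (fun t => G t *m f t) l - mprim (fun t => G t *m f t) x)).
Proof.
move=> hf xl; set ph := fun t => G t *m f t.
have hph : mx_integrable D ph by exact: mx_integrable_mulcont.
have h1 := mx_integrableMl M1 mD hph; have h2 := mx_integrableMl M2 mD hph.
have [i1 e1] := mxint_if h1 h2 xl.
have e t : H x *m (if t < x then M1 *m ph t else M2 *m ph t) = semisep H M1 M2 G x t *m f t.
  by rewrite /semisep /ph; case: ifP => _; rewrite !mulmxA.
split.
  by apply: mx_integrable_ext mD _ (mx_integrableMl (H x) mD i1) => t _; exact: e.
rewrite /int_op; congr (_ + _).
transitivity (mxint D (fun t => H x *m (if t < x then M1 *m ph t else M2 *m ph t))).
  by apply: mxint_ext => t _; rewrite e.
rewrite (mxintMl _ mD i1) e1; congr (_ *m _).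
have pM (N : 'M[R[i]]_q) y : y <= l -> mprim (fun t => N *m ph t) y = N *m mprim ph y.
  move=> yl; apply: mxintMl => // i j; have [k1 k2] := hph i j.
  have sub : `]0, y[ `<=` D by move=> t; rewrite /= !in_itv /= => /andP[-> /lt_le_trans ->].
  by split; [apply: integrableS k1|apply: integrableS k2].
have xl' : x <= l by case/andP: xl => _ /ltW.
by rewrite !pM// mulmxBr.
Qed.

Lemma semisep_acts : acts_on_L2 l (semisep H M1 M2 G).
Proof.
move=> f fL2; have hf := mxL2_integrable fL2; split.
  by apply: aeW => x xl; case: (semisep_int hf xl).
have hph : mx_integrable D (fun t => G t *m f t) by exact: mx_integrable_mulcont.
set Ph := mprim (fun t => G t *m f t).
have mPh : mx_measurable D Ph := mprim_measurable l_gt0 hph.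
have [K HK] := mprim_bounded hph; have [KH KH0 HKH] := mcont_bounded (a := 0) (b := l) (fun x _ => cH x).
pose g x := H x *m (M1 *m Ph x + M2 *m (Ph l - Ph x)).
have mg : mx_measurable D g.
  apply: mx_measurableM; first exact: mcont_measurable.
  apply: mx_measurableD; first by apply: mx_measurableM => //; exact: mx_measurable_cst.
  apply: mx_measurableM; first exact: mx_measurable_cst.
  apply: (mx_measurable_ext (F := fun x => Ph l + (- 1)%:M *m Ph x)) => [x _|].
    by rewrite mul_scalar_mx scaleN1r.
  by apply: mx_measurableD; [exact: mx_measurable_cst|apply: mx_measurableM => //; exact: mx_measurable_cst].
have gL2 : mxL2 D g.
  apply: (mxL2_bounded (K := KH * (mnorm M1 * K + mnorm M2 * (K + K)))) => // x /andP[/ltW x0 /ltW xl].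
  have x0l : 0 <= x <= l by rewrite x0.
  have l0l : 0 <= l <= l by rewrite ltW/=.
  apply: le_trans (mnormM _ _) _; apply: ler_pM; rewrite ?mnorm_ge0//; first exact: HKH.
  apply: le_trans (mnormD _ _) _; apply: lerD; apply: le_trans (mnormM _ _) _; rewrite ler_wpM2l ?mnorm_ge0//.
    exact: HK.
  by apply: le_trans (mnormD _ _) _; rewrite mnormN lerD ?HK.
have sL2 := mxL2D fL2 gL2.
have e x : D x -> f x + g x = int_op l (semisep H M1 M2 G) f x.
  by rewrite /= in_itv /= => xl; have [_ ->] := semisep_int hf xl.
split; first exact: mx_measurable_ext e sL2.1.
move=> i j; have := sL2.2 i j; congr (_ < +oo)%E; apply: eq_integral => x; rewrite inE => Dx.
by rewrite -e.
Qed.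

End Action.

Section Inverse.
Variables (B : R -> 'M[R[i]]_(q, p)) (C : R -> 'M[R[i]]_(p, q)) (U V : R -> 'M[R[i]]_q) (P Px : 'M[R[i]]_q).
Hypothesis cB : forall x, mcont B x.
Hypothesis cC : forall x, mcont C x.
Hypothesis U0 : U 0 = 1%:M.
Hypothesis UV : forall x, U x *m V x = 1%:M.
Hypothesis VU : forall x, V x *m U x = 1%:M.
Hypothesis dU : forall x, is_mder U x (B x *m C x *m U x).
Hypothesis dV : forall x, is_mder V x (- (V x *m B x *m C x)).
Hypothesis PxP : Px *m P = P.
Hypothesis PPx : P *m Px = Px.
Hypothesis bndV : Px *m V l *m (1%:M - P) = 0.
Hypothesis bndU : P *m U l *m (1%:M - Px) = 0.

Let KS := semisep C (- (1%:M - P)) P B.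
Let KT := semisep (fun x => C x *m U x) (1%:M - Px) (- Px) (fun x => V x *m B x).

Let cU x : mcont U x := mder_mcont (dU x).
Let cV x : mcont V x := mder_mcont (dV x).
Let cCU x : mcont (fun x => C x *m U x) x.
Proof. exact: mcontM. Qed.
Let cVB x : mcont (fun x => V x *m B x) x.
Proof. exact: mcontM. Qed.

Let V0 : V 0 = 1%:M.
Proof. by have := VU 0; rewrite U0 mulmx1. Qed.

Lemma KS_op f x : mx_integrable D f -> 0 < x < l ->
  int_op l KS f x = f x - C x *m (mprim (fun t => B t *m f t) x - P *m mprim (fun t => B t *m f t) l).
Proof.
move=> hf xl; have [_ ->] := semisep_int C (- (1%:M - P)) P cB hf xl.
rewrite -mulmxN; congr (_ + _ *m _).
move: (mprim _ x) (mprim _ l) => a b.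
by rewrite mulNmx mulmxBl mul1mx mulmxBr !opprB addrC addrA addrNK.
Qed.

Lemma KT_op f x : mx_integrable D f -> 0 < x < l ->
  int_op l KT f x = f x + C x *m U x *m
    (mprim (fun t => V t *m B t *m f t) x - Px *m mprim (fun t => V t *m B t *m f t) l).
Proof.
move=> hf xl; have [_ ->] := semisep_int (fun x => C x *m U x) (1%:M - Px) (- Px) cVB hf xl.
congr (_ + _ *m _).
move: (mprim _ x) (mprim _ l) => a b.
by rewrite mulNmx mulmxBl mul1mx mulmxBr opprB addrA addrNK.
Qed.

(** Put z = Ph - v with v = P Ph(l), so that S f = f - C z. Then V B S f is the derivative of V z,
    with primitive V z + v. As z(l) lies in the kernel of P, [bndV] shows that Px sends the value at
    l to v, and T adds back C U V z = C z. *)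
Lemma KTS f x : mxL2 D f -> 0 < x < l -> int_op l KT (int_op l KS f) x = f x.
Proof.
move=> fL2 xl; have hf := mxL2_integrable fL2.
have [_ gL2] := semisep_acts (- (1%:M - P)) P cC cB fL2.
have hg := mxL2_integrable gL2.
pose Ph := mprim (fun t => B t *m f t); pose v := P *m Ph l.
have hBf : mx_integrable D (fun t => B t *m f t) by exact: mx_integrable_mulcont.
have cdV y : mcont (fun x => - (V x *m B x *m C x)) y.
  by apply: mcontN; apply: mcontM.
have psi y : 0 <= y <= l -> mprim (fun t => V t *m B t *m int_op l KS f t) y = V y *m (Ph y - v) + v.
  move=> yl; rewrite -{2}[v]mul1mx -V0 -(mprim_shift v yl hBf dV cdV); apply: mxint_ext => t.
  rewrite inE /= in_itv /= => /andP[t0 ty]; have tl : 0 < t < l.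
    by rewrite t0 (lt_le_trans ty)//; case/andP: yl.
  rewrite (KS_op hf tl) -/Ph -/v mulmxBr [RHS]addrC mulNmx; congr (_ - _); by rewrite !mulmxA.
have xc : 0 <= x <= l by case/andP: xl => /ltW -> /ltW ->.
have lc : 0 <= l <= l by rewrite lexx ltW.
rewrite (KT_op hg xl) (psi x xc) (psi l lc).
have -> : V x *m (Ph x - v) + v - Px *m (V l *m (Ph l - v) + v) = V x *m (Ph x - v).
  have -> : Ph l - v = (1%:M - P) *m Ph l by rewrite mulmxBl mul1mx.
  have ev : Px *m v = v by rewrite /v mulmxA PxP.
  have -> : Px *m (V l *m ((1%:M - P) *m Ph l) + v) = v.
    by rewrite mulmxDr ev !mulmxA bndV mul0mx add0r.
  by rewrite addrK.
rewrite mulmxA -[C x *m _ *m _]mulmxA UV mulmx1 KS_op//.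
by rewrite subrK.
Qed.

(** Now z = U (Ps - v) with v = Px Ps(l). As U' = B C U, the derivative of z is B T f. By [bndU] the
    vector P U(l) (Ps(l) - v) is zero, so S subtracts exactly C z. *)
Lemma KST f x : mxL2 D f -> 0 < x < l -> int_op l KS (int_op l KT f) x = f x.
Proof.
move=> fL2 xl; have hf := mxL2_integrable fL2.
have [_ gL2] := semisep_acts (1%:M - Px) (- Px) cCU cVB fL2.
have hg := mxL2_integrable gL2.
pose Ps := mprim (fun t => V t *m B t *m f t); pose v := Px *m Ps l.
have hBf : mx_integrable D (fun t => V t *m B t *m f t) by exact: (mx_integrable_mulcont cVB).
have cdU y : mcont (fun x => B x *m C x *m U x) y.
  by apply: mcontM => //; apply: mcontM.
have phi y : 0 <= y <= l -> mprim (fun t => B t *m int_op l KT f t) y = U y *m (Ps y - v) + v.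
  move=> yl; rewrite -{2}[v]mul1mx -U0 -(mprim_shift v yl hBf dU cdU); apply: mxint_ext => t.
  rewrite inE /= in_itv /= => /andP[t0 ty]; have tl : 0 < t < l.
    by rewrite t0 (lt_le_trans ty)//; case/andP: yl.
  rewrite (KT_op hf tl) -/Ps -/v mulmxDr [RHS]addrC !mulmxA UV mul1mx.
  by [].
have xc : 0 <= x <= l by case/andP: xl => /ltW -> /ltW ->.
have lc : 0 <= l <= l by rewrite lexx ltW.
rewrite (KS_op hg xl) (phi x xc) (phi l lc).
have -> : U x *m (Ps x - v) + v - P *m (U l *m (Ps l - v) + v) = U x *m (Ps x - v).
  have -> : Ps l - v = (1%:M - Px) *m Ps l by rewrite mulmxBl mul1mx.
  have ev : P *m v = v by rewrite /v mulmxA PPx.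
  have -> : P *m (U l *m ((1%:M - Px) *m Ps l) + v) = v.
    by rewrite mulmxDr ev !mulmxA bndU mul0mx add0r.
  by rewrite addrK.
rewrite KT_op// -/Ps -/v [C x *m (U x *m _)]mulmxA.
by rewrite addrK.
Qed.

End Inverse.
End SemiseparableOperators.

(** * Kernels and functions altered on a finite set *)

Section FiniteExceptions.
Context {R : realType} (l : R) (s : seq R).
Local Notation mu := (@lebesgue_measure R).
Local Notation D := (`]0, l[%classic : set R).
Implicit Types (x t : R).

Let mD : measurable D := measurable_itv _.

(** Preimages under f and g differ within [s], and every subset of a finite set is measurable. *)
Lemma measurable_off_finite (f g : R -> R) : (forall x, D x -> x \notin s -> f x = g x) ->
  measurable_fun D f -> measurable_fun D g.
Proof.
move=> fg mf _ Y mY.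
have fin (A : set R) : measurable (A `&` [set` s]).
  apply: countable_measurable => [x|]; first exact: measurable_set1.
  by apply: finite_set_countable; apply: sub_finite_set (@finite_seq _ s) => x [].
have -> : D `&` g @^-1` Y = ((D `&` f @^-1` Y) `\` (setT `&` [set` s])) `|` ((D `&` g @^-1` Y) `&` [set` s]).
  apply/seteqP; split => x /=.
    move=> [Dx gY]; have [xs|xs] := boolP (x \in s); first by right.
    by left; split; [split => //; rewrite fg|move=> [_ ]; apply/negP].
  move=> [[[Dx fY] /not_andP[//|/negP xs]]|[[Dx gY] _]]; split => //.
  by rewrite -fg.
by apply: measurableU; [apply: measurableD|] => //; exact: mf.
Qed.

Lemma ae_off_finite (P : R -> Prop) : (forall x, x \notin s -> P x) -> {ae mu, forall x, P x}.
Proof.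
move=> H; apply: (ae_imply (P := fun x => forall i : 'I_(size s), x != tnth (in_tuple s) i)) (ae_neq _).
move=> x xs; apply: H; apply/negP => /(nthP 0)[i il xi].
by have := xs (Ordinal il); rewrite (tnth_nth 0) /= xi eqxx.
Qed.

Lemma Rintegral_off_finite (f g : R -> R) : (forall x, D x -> x \notin s -> f x = g x) ->
  measurable_fun D f -> \int[mu]_(x in D) f x = \int[mu]_(x in D) g x.
Proof.
move=> fg mf; have mg := measurable_off_finite fg mf.
congr fine; apply: ae_eq_integral => //; [exact/measurable_EFinP..|].
by apply: ae_off_finite => x xs Dx; rewrite fg.
Qed.

Lemma rint_off_finite (f g : R -> R) : (forall x, D x -> x \notin s -> f x = g x) ->
  rint D f -> rint D g.
Proof.
move=> fg hf; have /measurable_EFinP mf := measurable_int _ hf.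
have mg := measurable_off_finite fg mf; apply/integrableP; split; first exact/measurable_EFinP.
have /integrableP[_] := hf; apply: le_lt_trans; rewrite le_eqVlt; apply/orP; left; apply/eqP.
apply: ae_eq_integral => //; [| |].
- by apply/measurable_EFinP; exact: measurableT_comp.
- by apply/measurable_EFinP; exact: measurableT_comp.
- by apply: ae_off_finite => x xs Dx /=; rewrite fg.
Qed.

Section Matrices.
Variables (q r : nat) (F G : R -> 'M[R[i]]_(q, r)).
Hypothesis FG : forall x, D x -> x \notin s -> F x = G x.

Lemma mx_measurable_off_finite : mx_measurable D F -> mx_measurable D G.
Proof.
move=> mF i j; have [a b] := mF i j.
by split; [apply: measurable_off_finite a|apply: measurable_off_finite b] => x Dx xs; rewrite FG.
Qed.

Lemma mx_integrable_off_finite : mx_integrable D F -> mx_integrable D G.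
Proof.
move=> mF i j; have [a b] := mF i j.
by split; [apply: rint_off_finite a|apply: rint_off_finite b] => x Dx xs; rewrite FG.
Qed.

Lemma mxint_off_finite : mx_measurable D F -> mxint D F = mxint D G.
Proof.
move=> mF; apply/matrixP => i j; rewrite !mxE; have [a b] := mF i j.
by congr Complex; apply: Rintegral_off_finite => // x Dx xs; rewrite FG.
Qed.

Lemma mxL2_off_finite : mxL2 D F -> mxL2 D G.
Proof.
move=> [mF fF]; split; first exact: mx_measurable_off_finite.
move=> i j; have h := rint_off_finite (f := fun x => sqnorm (F x i j)) (g := fun x => sqnorm (G x i j)) _
  (sqnorm_integrable (mF i j) (fF i j)).
have /integrableP[_] : rint D (fun x => sqnorm (G x i j)) by apply: h => x Dx xs; rewrite FG.
apply: le_lt_trans; rewrite le_eqVlt; apply/orP; left; apply/eqP.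
by apply: eq_integral => x _; rewrite /= ger0_norm// sqnorm_ge0.
Qed.

End Matrices.

(** Integrability is asked at every x and not almost every x. Kernels with continuous factors
    provide this, and it allows the kernels to be exchanged at each x outside [s]. *)
Definition strongly_acts p (K : R -> R -> 'M[R[i]]_p) :=
  forall f : R -> 'cV[R[i]]_p, mxL2 D f ->
    (forall x, 0 < x < l -> mx_integrable D (fun t => K x t *m f t)) /\ mxL2 D (int_op l K f).

Section Kernels.
Variables (p : nat) (K K' : R -> R -> 'M[R[i]]_p).
Hypothesis KK' : forall x t, 0 < x < l -> 0 < t < l -> x \notin s -> t \notin s -> K x t = K' x t.
Hypothesis actK : strongly_acts K.

Lemma int_op_off_finite (f g : R -> 'cV[R[i]]_p) x : mxL2 D f ->
  (forall t, D t -> t \notin s -> f t = g t) -> 0 < x < l -> x \notin s ->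
  int_op l K f x = int_op l K' g x.
Proof.
move=> fL2 fg xl xs; rewrite /int_op fg//; congr (_ + _).
have [iK _] := actK fL2.
apply: mxint_off_finite => [t|]; last exact: mx_integrable_measurable (iK x xl).
by rewrite /= in_itv /= => tl ts; rewrite KK'// fg//= in_itv.
Qed.

Lemma acts_off_finite : acts_on_L2 l K'.
Proof.
move=> f fL2; have [iK aK] := actK fL2; split.
  apply: ae_off_finite => x xs xl; apply: mx_integrable_off_finite (iK x xl) => t.
  by rewrite /= in_itv /= => tl ts; rewrite KK'.
apply: mxL2_off_finite aK => x; rewrite /= in_itv /= => xl xs.
exact: (int_op_off_finite fL2).
Qed.

End Kernels.

(** The outer operator sees the inner one only under an integral, so the exact identities for K S
    and K T survive at every x outside [s], which is almost every x. *)
Lemma inverse_off_finite p (KS KS' KT KT' : R -> R -> 'M[R[i]]_p) :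
  (forall x t, 0 < x < l -> 0 < t < l -> x \notin s -> t \notin s -> KS x t = KS' x t) ->
  (forall x t, 0 < x < l -> 0 < t < l -> x \notin s -> t \notin s -> KT x t = KT' x t) ->
  strongly_acts KS -> strongly_acts KT ->
  (forall f x, mxL2 D f -> 0 < x < l -> int_op l KT (int_op l KS f) x = f x) ->
  (forall f x, mxL2 D f -> 0 < x < l -> int_op l KS (int_op l KT f) x = f x) ->
  L2_inverse l KS' KT'.
Proof.
move=> eS eT aS aT TS ST; split; [exact: acts_off_finite eS aS|exact: acts_off_finite eT aT|].
move=> f fL2; apply: ae_off_finite => x xs xl; have [_ sL2] := aS f fL2; have [_ tL2] := aT f fL2.
split.
- rewrite -(int_op_off_finite eT aT sL2 _ xl xs); first exact: TS.
  move=> t; rewrite /= in_itv /= => tl ts; exact: (int_op_off_finite eS aS fL2).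
- rewrite -(int_op_off_finite eS aS tL2 _ xl xs); first exact: ST.
  move=> t; rewrite /= in_itv /= => tl ts; exact: (int_op_off_finite eT aT fL2).
Qed.

End FiniteExceptions.

(** * The block structure of D and the projections P_j *)

Section Blocks.
Context {R : realType} (kappa : nat) (p_ : 'I_kappa -> nat).

Lemma mxdiag_scalar (c : 'I_kappa -> R[i]) :
  (\mxdiag_j (c j)%:M : 'M[R[i]]_(\sum_j p_ j)) = diag_mx (\row_a c (tagnat.sig1 a)).
Proof.
transitivity (diag_mx (\mxrow_j @const_mx _ 1 (p_ j) (c j))).
  by rewrite diag_mxrow; apply: eq_mxdiag => j; rewrite diag_const_mx.
by congr diag_mx; apply/rowP => a; rewrite !mxE.
Qed.

Lemma diagDE (d : 'I_kappa -> R) : diagD p_ d = diag_mx (\row_a (d (tagnat.sig1 a))%:C%C).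
Proof. exact: mxdiag_scalar. Qed.

Lemma blockPE j : blockP R p_ j = diag_mx (\row_a (tagnat.sig1 a == j)%:R).
Proof.
rewrite -[RHS](mxdiag_scalar (fun i => (i == j)%:R)); apply: eq_mxdiag => i.
by case: eqP => _; rewrite ?scalar_mx0//; apply/matrixP => a b; rewrite !mxE ?mul0rn.
Qed.

(** The index a lies in exactly one block, [tagnat.sig1 a], so at most one summand contributes to
    its diagonal entry. *)
Lemma below_blocks (d : 'I_kappa -> R) w :
  below (fun a : 'I_(\sum_j p_ j) => d (tagnat.sig1 a)) w = \sum_(j | d j < w) blockP R p_ j.
Proof.
apply/matrixP => a b; rewrite summxE mxE mxE.
transitivity (\sum_(j | d j < w) ((tagnat.sig1 a == j)%:R *+ (a == b) : R[i])); last first.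
  by apply: eq_bigr => j _; rewrite blockPE mxE mxE.
rewrite sumrMnl; congr (_ *+ _).
have [dw|dw] := boolP (d (tagnat.sig1 a) < w).
  rewrite (bigD1 (tagnat.sig1 a))//= eqxx big1 ?addr0// => j /andP[_ /negbTE].
  by rewrite eq_sym => ->.
rewrite big1// => j djw; case: eqP => // e; by move: dw; rewrite e djw.
Qed.

Lemma block_psd n (N : 'M[R[i]]_(n, \sum_j p_ j)) j (v : 'cV[R[i]]_n) :
  0 <= complex.Re ((v^t* *m (N *m blockP R p_ j *m N^t* ) *m v) ord0 ord0).
Proof.
have -> : v^t* *m (N *m blockP R p_ j *m N^t* ) *m v = (N^t* *m v)^t* *m blockP R p_ j *m (N^t* *m v).
  by rewrite ctM trmxCK !mulmxA.
rewrite blockPE mul_mx_diag; move: (N^t* *m v) => u; rewrite mxE Re_sum; apply: sumr_ge0 => a _.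
rewrite !mxE; case: (tagnat.sig1 a == j); rewrite ?mulr1 ?mulr0 ?mul0r//.
by rewrite ReM !ReImE; have := sqr_ge0 (complex.Re (u a ord0)); have := sqr_ge0 (complex.Im (u a ord0)); nra.
Qed.

End Blocks.

(** * S as a semiseparable operator and its boundary projections *)

Section KernelForm.
Context {R : realType} (n p kappa : nat) (th1 : 'M[R[i]]_(n, p)) (beta : 'M[R[i]]_n)
  (d : 'I_kappa -> R) (X : 'I_kappa -> 'M[R[i]]_n).
Local Notation L := (Lx beta d X).
Implicit Types (x t : R).

Definition Plow : 'M[R[i]]_(n + n) := block_mx 0 0 0 1%:M.

Lemma compl_Plow : 1%:M - Plow = block_mx 1%:M 0 0 0.
Proof. by rewrite /Plow scalar_mx_block opp_block_mx add_block_mx !oppr0 !addr0 subrr. Qed.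

(** For t < x the upper half of B contributes L(t), otherwise the right half of C contributes L(x);
    both cases are L(min(x, t)). *)
Lemma semisep_kerS x t :
  semisep (C0 th1 beta d X) (- (1%:M - Plow)) Plow (B0 th1 beta d X) x t =
  2 *: (th1^t* *m phase beta x *m L (Num.min x t) *m (phase beta t)^t* *m th1).
Proof.
rewrite /semisep /C0 /B0 /Cof /Bof -!scalemxAl -scalemxAr scalerA rt2M; congr (_ *: _).
rewrite compl_Plow /Plow; move: (phase beta x) ((phase beta t)^t* ) => P E.
have [xt|tx] := leP x t.
  rewrite -!mulmxA; congr (_ *m _).
  rewrite [block_mx _ _ _ _ *m _]mulmxA mul_block_col !(mul0mx, mul1mx, add0r, addr0).
  by rewrite mul_col_mx mul_row_col mul0mx mulmx0 add0r !mulmxA.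
rewrite -!mulmxA; congr (_ *m _).
rewrite opp_block_mx !oppr0 [block_mx _ _ _ _ *m _]mulmxA mul_block_col !(mul0mx, add0r, addr0).
by rewrite mulNmx mul1mx mulNmx opprK mul_col_mx mul_row_col mul0mx mulmx0 addr0 !mulmxA.
Qed.

Variable Ul : 'M[R[i]]_(n + n).
Hypothesis Ul_unit : drsubmx Ul \in unitmx.
Local Notation W := (invmx (drsubmx Ul)).

(** So P^x times U(l)^-1 is diag(0, U22(l)^-1), which annihilates the first n coordinates: this is
    the boundary condition that T needs. *)
Lemma Pcross_factor : Pcross Ul = block_mx 0 0 0 W *m Ul.
Proof.
have := mulVmx Ul_unit; rewrite /Pcross; move: W => w wd.
by rewrite -[in RHS](submxK Ul) mulmx_block !(mul0mx, add0r) wd.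
Qed.

Lemma Pcross_Plow : Pcross Ul *m Plow = Plow.
Proof. by rewrite /Pcross /Plow mulmx_block !(mul0mx, mulmx0, mul1mx, mulmx1, add0r, addr0). Qed.

Lemma Plow_Pcross : Plow *m Pcross Ul = Pcross Ul.
Proof. by rewrite /Pcross /Plow mulmx_block !(mul0mx, mulmx0, mul1mx, mulmx1, add0r, addr0). Qed.

Lemma Pcross_boundary (V : 'M[R[i]]_(n + n)) : Ul *m V = 1%:M -> Pcross Ul *m V *m (1%:M - Plow) = 0.
Proof.
move=> UV; rewrite Pcross_factor -[_ *m Ul *m V]mulmxA UV mulmx1 compl_Plow mulmx_block.
by rewrite !(mul0mx, mulmx0, add0r) block_mx0.
Qed.

Lemma Plow_boundary : Plow *m Ul *m (1%:M - Pcross Ul) = 0.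
Proof.
rewrite /Pcross scalar_mx_block opp_block_mx add_block_mx !oppr0 !addr0 subrr add0r.
rewrite -[X in _ *m X *m _](submxK Ul) /Plow mulmx_block !(mul0mx, mul1mx, add0r) mulmx_block.
by rewrite !(mul0mx, mulmx0, mulmx1, add0r, addr0) mulmxN mulmxA mulmxV// mul1mx subrr block_mx0.
Qed.

End KernelForm.

Lemma semisep_strongly_acts (R : realType) (l : R) (p q : nat) (H : R -> 'M[R[i]]_(p, q))
    (M1 M2 : 'M[R[i]]_q) (G : R -> 'M[R[i]]_(q, p)) : 0 < l ->
  (forall x, mcont H x) -> (forall x, mcont G x) -> strongly_acts l (semisep H M1 M2 G).
Proof.
move=> l0 cH cG f fL2; split; last by case: (semisep_acts l0 M1 M2 cH cG fL2).
by move=> x xl; case: (semisep_int H M1 M2 cG (mxL2_integrable fL2) xl).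
Qed.

Theorem proposition4p7 (R : realType) (n kappa : nat)
    (n_gt0 : (0 < n)%N) (kappa_gt0 : (0 < kappa)%N)
    (p_ : 'I_kappa -> nat) (p_gt0 : forall j, (0 < p_ j)%N)
    (d : 'I_kappa -> R) (d_ge0 : forall j, 0 <= d j)
    (d_incr : forall i j : 'I_kappa, (i < j)%N -> d i < d j)
    (th1 th2 : 'M[R[i]]_(n, \sum_j p_ j)) (beta : 'M[R[i]]_n)
    (Ru : 'M[R[i]]_(\sum_j p_ j)) (Ru_unitary : Ru \is unitarymx)
    (X : 'I_kappa -> 'M[R[i]]_n) (X_herm : forall j, (X j)^t* = X j)
    (X_sol : forall j,
       'i%C *: (beta *m X j - X j *m beta^t*)
       = nu th2 beta (diagD p_ d) *m blockP R p_ j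
           *m (nu th2 beta (diagD p_ d))^t*)
    (M eta : R) (M_gt0 : 0 < M)
    (M_spec : forall a : R[i],
       eigenvalue (beta + ('i%C * M%:C%C)%:M) a -> 0 < complex.Im a)
    (eta_lt : eta < - 2%:R * M)
    (g s k : R -> 'M[R[i]]_(\sum_j p_ j))
    (g_lim : is_lim_in_mean
       (fourier_part (phi th1 th2 beta (diagD p_ d) Ru) eta) g)
    (s_def : forall x, 0 <= x ->
       s x = ('i%C / (2%:R * pi)%:C%C * (expR (- eta * x))%:C%C) *: g x)
    (k_def : is_ae_derivative s k)
    (l : R) (l_gt0 : 0 < l)
    (B : R -> 'M[R[i]]_(n + n, \sum_j p_ j))
    (C : R -> 'M[R[i]]_(\sum_j p_ j, n + n))
    (U : R -> 'M[R[i]]_(n + n))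
    (B_def : forall (m : nat) (x : R), (m <= kappa)%N -> node d l m < l ->
       node d l m < x < Num.min l (node d l m.+1) ->
       B x = Bform beta th1 (Zsum X m) (Ztsum d beta X m) x)
    (C_def : forall (m : nat) (x : R), (m <= kappa)%N -> node d l m < l ->
       node d l m < x < Num.min l (node d l m.+1) ->
       C x = Cform beta th1 (Zsum X m) (Ztsum d beta X m) x)
    (U0 : U 0 = 1%:M)
    (U_def : forall (m : nat) (x : R), (m <= kappa)%N -> node d l m < l ->
       node d l m <= x <= Num.min l (node d l m.+1) ->
       U x = flow beta th1 (Zsum X m) (Ztsum d beta X m) x
             *m invmx (flow beta th1 (Zsum X m) (Ztsum d beta X m)
                         (node d l m))
             *m U (node d l m)) :
  drsubmx (U l) \in unitmx /\
  L2_inverse l (kerS k) (kerT B C U (Pcross (U l))) /\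
  (forall x, 0 <= x <= l ->
     (U x)^t* *m Jmx R n *m U x = Jmx R n /\
     invmx (U x) = Jmx R n *m (U x)^t* *m (Jmx R n)^t*).
Proof.
pose p := (\sum_j p_ j)%N; pose dd (a : 'I_p) := d (tagnat.sig1 a).
rewrite diagDE in X_sol g_lim.
set N := nu th2 beta _ in X_sol.
pose Q j := N *m blockP R p_ j *m N^t*.
have Q_sum w : N *m below dd w *m N^t* = \sum_(j | d j < w) Q j.
  by rewrite below_blocks mulmx_sumr mulmx_suml.
have Q_psd j (v : 'cV[R[i]]_n) : 0 <= complex.Re ((v^t* *m Q j *m v) ord0 ord0) := block_psd N j v.
have k_ae := kernel_ae M_gt0 M_spec eta_lt g_lim s_def k_def.
pose Uk := Ut th1 beta d X l kappa.
have UE x : 0 <= x <= l -> U x = Uk x := U_global d_ge0 d_incr l_gt0 U0 U_def (x := x).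
have ll : 0 <= l <= l by rewrite lexx ltW.
have Ul := UE l ll.
have uUl : drsubmx (U l) \in unitmx.
  rewrite Ul; exact: (Uk_lower_unit th1 d_ge0 d_incr l_gt0 X_herm X_sol Q_psd).
pose V x := invmx (Uk x).
have uU x : Uk x \in unitmx := Uk_unit th1 beta l d_ge0 d_incr X_herm x.
have VE x : V x = Jmx R n *m (Uk x)^t* *m (Jmx R n)^t* := invmx_Uk th1 beta l d_ge0 d_incr X_herm x.
have dU x : is_mder Uk x (B0 th1 beta d X x *m C0 th1 beta d X x *m Uk x) :=
  Uk_der th1 beta X l d_incr x.
have cB x : mcont (B0 th1 beta d X) x := B0_mcont th1 d X_sol x.
have cC x : mcont (C0 th1 beta d X) x := C0_mcont th1 d X_herm X_sol x.
(* The formula V = J U^* J^* gives the derivative of the inverse without differentiating an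
   inversion. *)
have dV x : is_mder V x (- (V x *m B0 th1 beta d X x *m C0 th1 beta d X x)).
  apply: (mder_ext (F := fun x => Jmx R n *m (Uk x)^t* *m (Jmx R n)^t* )) => [y|]; first by rewrite VE.
  apply: mder_eq (mderMr _ (mderMl _ (mder_adj (dU x)))) _.
  rewrite VE !ctM (C0E th1 beta d X_herm) ctM trmxCK Jmx_adj.
  move: (Uk x) (B0 th1 beta d X x) (Jmx R n) => Ux Bx J.
  by rewrite !(mulmxN, mulNmx) !mulmxA !opprK.
have UV x : Uk x *m V x = 1%:M := mulmxV (uU x).
have VU x : V x *m Uk x = 1%:M := mulVmx (uU x).
pose Px := Pcross (U l).
split; first exact: uUl.
split; last first.
  move=> x xl; rewrite (UE x xl); split; last exact: VE.
  exact: (Uk_symplectic th1 beta l d_ge0 d_incr X_herm x).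
pose ns := [seq d j | j : 'I_kappa].
have off x : x \notin ns -> forall j, x != d j.
  move=> xs j; apply: contra xs => /eqP ->; apply/mapP; exists j => //.
  by rewrite mem_enum.
have cU x : mcont Uk x := mder_mcont (dU x).
have cV x : mcont V x := mder_mcont (dV x).
have cCU x : mcont (fun x => C0 th1 beta d X x *m Uk x) x by exact: mcontM.
have cVB x : mcont (fun x => V x *m B0 th1 beta d X x) x by exact: mcontM.
have PxP : Px *m Plow n = Plow n := Pcross_Plow (U l).
have PPx : Plow n *m Px = Px := Plow_Pcross (U l).
have bV : Px *m V l *m (1%:M - Plow n) = 0.
  by apply: (Pcross_boundary uUl); rewrite Ul UV.
have bU : Plow n *m Uk l *m (1%:M - Px) = 0 by rewrite -Ul; exact: Plow_boundary.
have Uk00 := Uk0 th1 beta X l d_ge0 d_incr.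
(* The exceptional points are the nodes, where nothing is prescribed for B and C. The kernel of S
   agrees with its semiseparable form at all interior points; only that of T requires x and t off
   the nodes. *)
apply: (inverse_off_finite (s := ns)
  (KS := semisep (C0 th1 beta d X) (- (1%:M - Plow n)) (Plow n) (B0 th1 beta d X))
  (KT := semisep (fun x => C0 th1 beta d X x *m Uk x) (1%:M - Px) (- Px) (fun x => V x *m B0 th1 beta d X x))).
- move=> x t /andP[x0 _] /andP[t0 _] _ _; rewrite semisep_kerS; apply/esym.
  exact: (kerS_kexpl Ru_unitary d_ge0 X_sol Q_sum x0 t0 k_def.1 k_ae).
- move=> x t xl tl xs ts.
  have [_ eC] := piece_coefficients d_incr B_def C_def xl (off x xs).
  have [eB _] := piece_coefficients d_incr B_def C_def tl (off t ts).
  have xl' : 0 <= x <= l by case/andP: xl => /ltW -> /ltW ->.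
  have tl' : 0 <= t <= l by case/andP: tl => /ltW -> /ltW ->.
  rewrite /kerT /semisep eC eB (UE x xl') (UE t tl') -/Px -/(V t) -/(C0 th1 beta d X x) -/(B0 th1 beta d X t).
  move: (C0 th1 beta d X x) (B0 th1 beta d X t) (Uk x) (V t) => c b u v.
  by case: ifP => _; rewrite ?(mulmxN, mulNmx) !mulmxA.
- exact: semisep_strongly_acts.
- exact: semisep_strongly_acts.
- move=> f x fL2 xl; exact: (KTS l_gt0 cB cC Uk00 UV VU dV PxP bV fL2 xl).
- move=> f x fL2 xl; exact: (KST l_gt0 cB cC Uk00 UV dU dV PPx bU fL2 xl).
Qed.
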